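(* Let $k\ge1$, let $\bm\lambda=(\lambda_1,\dots,\lambda_k)\in(\mathfrak h^* )^k$ and $\bm a=(a_1,\dots,a_k)\in(\mathbb C^\times)^k$ be such that $\lambda_i(\mathrm k_0)\ne0$ for all $i$ and $a_1,\dots,a_k$ are distinct. Assume that $\bm\lambda\in(P_+)^k$, i.e. every $\lambda_i$ is a dominant weight. Then the $\widetilde{\mathfrak g}(\mu)$-module $\widetilde V(\bm\lambda,\bm a)$ is integrable.
   Context: **The Lie algebra.** $\dot{\mathfrak g}$ is a finite dimensional complex simple Lie algebra with Cartan subalgebra $\dot{\mathfrak h}$, root system $\dot\Delta$ (not containing $0$), a choice of positive roots with sum of positive root spaces $\dot{\mathfrak n}_+$, and normalized invariant symmetric form $\langle\cdot,\cdot\rangle$. $\mu\in\mathbb C$ is fixed. $\mathcal R=\mathbb C[t_0^{\pm1},t_1^{\pm1}]$; for $m=(m_0,m_1)\in\mathbb Z^2$ put $t^m=t_0^{m_0}t_1^{m_1}$, and put $\det(m,n)=m_0n_1-m_1n_0$. $\mathcal K$ is spanned by symbols $t^m\mathrm k_0,t^m\mathrm k_1$ subject to $m_0t^m\mathrm k_0+m_1t^m\mathrm k_1=0$; $\mathrm k_a=t^0\mathrm k_a$. $\mathcal S$ is spanned by the derivations $\mathrm d_i=t_i\frac{\partial}{\partial t_i}$ ($i=0,1$) and $\mathrm d(m)=\mathrm d(m_0,m_1)=m_0t^m\mathrm d_1-m_1t^m\mathrm d_0$. As a vector space $\widetilde{\mathfrak g}(\mu)=(\mathcal R\otimes\dot{\mathfrak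 g})\oplus\mathcal K\oplus\mathcal S$, with brackets $[t^m\otimes x,t^n\otimes y]=t^{m+n}\otimes[x,y]+\langle x,y\rangle\sum_{a}m_at^{m+n}\mathrm k_a$; $[\mathcal K,\mathcal K]=[\mathcal K,\mathcal R\otimes\dot{\mathfrak g}]=0$; $[\mathrm d_i,t^n\otimes x]=n_it^n\otimes x$, $[\mathrm d_i,t^n\mathrm k_j]=n_it^n\mathrm k_j$, $[\mathrm d_i,\mathrm d(m)]=m_i\mathrm d(m)$, $[\mathrm d_0,\mathrm d_1]=0$; $[\mathrm d(m),t^n\otimes x]=\det(m,n)t^{m+n}\otimes x$; $[\mathrm d(m),t^n\mathrm k_j]=\det(m,n)t^{m+n}\mathrm k_j+(m_0\delta_{j,1}-m_1\delta_{j,0})\sum_am_at^{m+n}\mathrm k_a$; $[\mathrm d(m),\mathrm d(n)]=\det(m,n)\mathrm d(m+n)+\mu\det(m,n)^2\sum_am_at^{m+n}\mathrm k_a$. $\widehat{\mathfrak g}(\mu)=(\mathcal R\otimes\dot{\mathfrak g})\oplus\mathcal K\oplus\sum_m\mathbb C\,\mathrm d(m)\oplus\mathbb C\mathrm d_0$, a subalgebra with $\widetilde{\mathfrak g}(\mu)=\widehat{\mathfrak g}(\mu)\oplus\mathbb C\mathrm d_1$. It is $\mathbb Z$-graded by $\mathrm{ad}\,\mathrm d_1$: $\widehat{\mathfrak g}(\mu)=\bigoplus_n\widehat{\mathfrak g}(\mu)_n$. Put $\tilde{\mathrm d}(m,n)=\mathrm d(m,n)+n\mu\,t_0^mt_1^n\mathrm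 k_0$. Also $\mathfrak h=\dot{\mathfrak h}\oplus\mathbb C\mathrm k_0\oplus\mathbb C\mathrm d_0$. **The Virasoro-affine algebra.** $\dot{\mathfrak b}=\mathbb C\mathrm k_1\oplus\mathbb C\mathrm d_1$ is an abelian Lie algebra with symmetric form $\langle\mathrm d_1,\mathrm k_1\rangle=1$, $\langle\mathrm d_1,\mathrm d_1\rangle=\langle\mathrm k_1,\mathrm k_1\rangle=0$; $\dot{\mathfrak f}=\dot{\mathfrak g}\oplus\dot{\mathfrak b}$ (orthogonal direct sum). $\bar{\mathfrak f}$ is the Lie algebra with spanning elements $L(m)$, $x(m)=t_0^m\otimes x$ ($m\in\mathbb Z$, $x\in\dot{\mathfrak f}$, linear in $x$) and central $\mathrm k_0,\mathrm k_v$, with $[L(m),L(n)]=(m-n)L(m+n)+\frac{m^3-m}{12}\delta_{m+n,0}\mathrm k_v$, $[x(m),y(n)]=[x,y](m+n)+m\delta_{m+n,0}\langle x,y\rangle\mathrm k_0$, $[L(m),x(n)]=-nx(m+n)$; here $\mathrm d_0=-L(0)$. Put $\bar{\mathfrak f}_0=\mathfrak h\oplus\dot{\mathfrak b}\oplus\mathbb C\mathrm k_v$ (identify $x$ with $x(0)$) and $\bar{\mathfrak f}_+=\mathrm{span}\{L(m),x(m):m>0,x\in\dot{\mathfrak f}\}+\dot{\mathfrak n}_+$. For $\eta\in\bar{\mathfrak f}_0^*$, $V_{\bar{\mathfrak f}}(\eta)$ is the irreducible highest weight $\bar{\mathfrak f}$-module of highest weight $\eta$ (highest weight vector killed by $\bar{\mathfrak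 f}_+$). For $\lambda\in\mathfrak h^*$ let $\bar\lambda\in\bar{\mathfrak f}_0^*$ be given by $\bar\lambda|_{\mathfrak h}=\lambda$, $\bar\lambda(\mathrm k_v)=24\mu\lambda(\mathrm k_0)$, $\bar\lambda(\mathrm k_1)=\bar\lambda(\mathrm d_1)=0$. **Operators on $V_{\bar{\mathfrak f}}(\bar\lambda)$.** Let $c=\lambda(\mathrm k_0)\ne0$. Put $x(z)=\sum_mx(m)z^{-m-1}$ ($x\in\dot{\mathfrak f}$), $L(z)=\sum_mL(m)z^{-m-2}$, $\bar L(z)=L(z)-\frac1c{:}\mathrm d_1(z)\mathrm k_1(z){:}$, $\bar{\mathrm k}_1(z)=(z^{-1}+\frac{\partial}{\partial z})\mathrm k_1(z)=\sum_m(-m)\mathrm k_1(m)z^{-m-2}$, $\bar{\mathrm d}_1(z)=(z^{-1}+\frac{\partial}{\partial z})\mathrm d_1(z)=\sum_m(-m)\mathrm d_1(m)z^{-m-2}$, and $E(n,z)=\exp\big(\frac1c\sum_{j\ge1}\frac{n\mathrm k_1(-j)}{j}z^{j}\big)\exp\big(-\frac1c\sum_{j\ge1}\frac{n\mathrm k_1(j)}{j}z^{-j}\big)$. In normal ordered products ${:}\ {:}$ the modes $\mathrm d_1(m)$ with $m<0$ are put on the left and those with $m\ge0$ on the right. Define operators for $m,n\in\mathbb Z$, $x\in\dot{\mathfrak g}$ by $\sum_m\mathrm k_0(m,n)z^{-m}=cE(n,z)$, $\sum_m\mathrm k_1(m,n)z^{-m-1}=\mathrm k_1(z)E(n,z)$,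 $\sum_mx(m,n)z^{-m-1}=x(z)E(n,z)$, $\sum_m\bar L(m,n)z^{-m-2}=\bar L(z)E(n,z)$, $\sum_m\bar{\mathrm k}_1(m,n)z^{-m-2}=\bar{\mathrm k}_1(z)E(n,z)$, $\sum_m\bar{\mathrm d}_1(m,n)z^{-m-2}={:}\bar{\mathrm d}_1(z)E(n,z){:}$, and $\bar{\mathrm d}(m,n)=n\bar L(m,n)+n^2\mu\bar{\mathrm k}_1(m,n)-\bar{\mathrm d}_1(m,n)$. **The modules.** $\widehat V(\bm\lambda,\bm a)=V_{\bar{\mathfrak f}}(\bar\lambda_1)\otimes\cdots\otimes V_{\bar{\mathfrak f}}(\bar\lambda_k)$ is a $\widehat{\mathfrak g}(\mu)$-module in which each of $t_0^mt_1^n\mathrm k_j$ ($j=0,1$), $t_0^mt_1^n\otimes x$, $\tilde{\mathrm d}(m,n)$ acts on $v_1\otimes\cdots\otimes v_k$ by $\sum_{i=1}^ka_i^n\,v_1\otimes\cdots\otimes X(m,n).v_i\otimes\cdots\otimes v_k$ with $X(m,n)=\mathrm k_j(m,n)$, $x(m,n)$, $\bar{\mathrm d}(m,n)$ respectively (formed with $c=\lambda_i(\mathrm k_0)$ on the $i$-th factor), and $\mathrm d_0$ acts by $\sum_iv_1\otimes\cdots\otimes\mathrm d_0.v_i\otimes\cdots\otimes v_k$. The space $\widetilde V(\bm\lambda,\bm a)=\widehat V(\bm\lambda,\bm a)\otimes\mathbb C[t_1,t_1^{-1}]$ is a $\widetilde{\mathfrak g}(\mu)$-module by $x.(v\otimes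 t_1^l)=(x.v)\otimes t_1^{l+n}$ for $x\in\widehat{\mathfrak g}(\mu)_n$, and $\mathrm d_1.(v\otimes t_1^l)=l\,v\otimes t_1^l$. **Integrability and dominant weights.** $\widetilde{\mathfrak h}=\dot{\mathfrak h}\oplus\mathbb C\mathrm k_0\oplus\mathbb C\mathrm k_1\oplus\mathbb C\mathrm d_0\oplus\mathbb C\mathrm d_1$; roots $\dot\alpha\in\dot\Delta$ are extended by $0$ on $\mathrm k_i,\mathrm d_i$, and $\delta_i\in\widetilde{\mathfrak h}^*$ satisfies $\delta_i(\dot{\mathfrak h})=0$, $\delta_i(\mathrm k_j)=0$, $\delta_i(\mathrm d_j)=\delta_{i,j}$. $\widetilde\Delta^\times=\{\dot\alpha+m_0\delta_0+m_1\delta_1:\dot\alpha\in\dot\Delta,\ m_0,m_1\in\mathbb Z\}$ and $\widetilde{\mathfrak g}(\mu)_\alpha$ is the root space of $\alpha$. A $\widetilde{\mathfrak g}(\mu)$-module is integrable if it is a weight module (direct sum of weight spaces for $\widetilde{\mathfrak h}$) and for every $\alpha\in\widetilde\Delta^\times$ the elements of $\widetilde{\mathfrak g}(\mu)_\alpha$ act locally nilpotently. $P_+=\{\lambda\in\mathfrak h^*:\lambda(\alpha^\vee)\in\mathbb N\ \text{for all simple roots }\alpha\}$, where the simple roots are the standard ones of the affine Kac-Moody algebra $\mathfrak g=(\mathbb C[t_0^{\pm1}]\otimes\dot{\mathfrak g})\oplus\mathbb C\mathrm k_0\oplus\mathbb C\mathrm d_0$ (coroots: the simple coroots of $\dot{\mathfrak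 g}$ and $\mathrm k_0-\theta^\vee$, $\theta$ the highest root), and $\mathbb N$ contains $0$. *)

(* Defs.v *)
From HB Require Import structures.
From mathcomp Require Import all_boot all_order all_algebra.
From mathcomp Require Import ring_quotient ring.
From mathcomp Require Import mathcomp_extra boolp classical_sets functions.
From mathcomp Require Import cardinality fsbigop.

Set Implicit Arguments.
Unset Strict Implicit.
Unset Printing Implicit Defensive.

Import GRing.Theory.

Local Open Scope ring_scope.
Local Open Scope classical_set_scope.
Local Open Scope quotient_scope.

Section FinitelySupported.
Variables (K : fieldType) (T : Type) (V : lmodType K).

Definition fin_supp : {pred T -> V} :=
  fun f => `[< finite_set [set t | f t != 0] >].

Lemma fin_suppE f : (f \in fin_supp) = `[< finite_set [set t | f t != 0] >].
Proof. by []. Qed.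

Lemma fin_supp_closed : submod_closed fin_supp.
Proof.
split=> [|a f g]; rewrite !fin_suppE.
  apply/asboolP; apply: (sub_finite_set _ (finite_set0 T)) => t /=.
  by rewrite eqxx.
move=> /asboolP ff /asboolP fg; apply/asboolP.
apply: (@sub_finite_set _ _ ([set t | f t != 0] `|` [set t | g t != 0])).
  move=> t /=; rewrite !fctE; have [->|] := eqVneq (f t) 0; last by left.
  by rewrite scaler0 add0r; right.
by rewrite finite_setU.
Qed.

HB.instance Definition _ := GRing.isSubmodClosed.Build K (T -> V) fin_supp
  fin_supp_closed.

(* fsupp T V is V tensored with the vector space of basis T. *)
Record fsupp := Fsupp { fsval :> T -> V; _ : fsval \in fin_supp }.
HB.instance Definition _ := [isSub for fsval].
HB.instance Definition _ := [Choice of fsupp by <:].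
HB.instance Definition _ := [SubChoice_isSubLmodule of fsupp by <:].

Lemma mono_subproof t v : (fun u => if `[< u = t >] then v else 0) \in fin_supp.
Proof.
rewrite fin_suppE; apply/asboolP; apply: (sub_finite_set _ (finite_set1 t)).
by move=> u /=; case: asboolP => //; rewrite eqxx.
Qed.

(* The element t (x) v. *)
Definition mono t v : fsupp := Fsupp (mono_subproof t v).
End FinitelySupported.

(* The linear map with t (x) v |-> phi t v. *)
HB.lock Definition lext (K : fieldType) (T : choiceType) (V W : lmodType K)
    (phi : T -> V -> W) (f : fsupp T V) : W :=
  \sum_(t \in [set: T]) phi t (f t).

Section Span.
Variables (K : fieldType) (V : lmodType K).

Definition is_subspace (P : V -> Prop) : Prop :=
  P 0 /\ forall (a : K) u v, P u -> P v -> P (a *: u + v).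

Definition lspan (S : V -> Prop) (v : V) : Prop :=
  forall P, is_subspace P -> (forall u, S u -> P u) -> P v.

Definition lspan_pred (S : V -> Prop) : {pred V} := fun v => `[< lspan S v >].

Lemma lspan_predE S v : (v \in lspan_pred S) = `[< lspan S v >].
Proof. by []. Qed.

Lemma lspan_closed S : submod_closed (lspan_pred S).
Proof.
split=> [|a u v]; rewrite !lspan_predE; first by apply/asboolP => P [].
move=> /asboolP hu /asboolP hv; apply/asboolP => P sP SP.
by apply: sP.2; [apply: hu | apply: hv].
Qed.

HB.instance Definition _ S := GRing.isSubmodClosed.Build K V (lspan_pred S)
  (lspan_closed S).
End Span.

Section Quotient.
Variables (K : fieldType) (V : lmodType K) (S : V -> Prop).

Definition quotmod : Type := (Quotient.quot (lspan_pred S)).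
HB.instance Definition _ := GRing.Zmodule.on quotmod.

Definition qproj (v : V) : quotmod := \pi_(Quotient.quot (lspan_pred S)) v.
Definition qrepr (q : quotmod) : V := repr q.

Lemma qreprK : cancel qrepr qproj. Proof. exact: reprK. Qed.

Lemma qprojP u v : (qproj u = qproj v) <-> lspan S (u - v).
Proof.
split=> [/eqP|h]; last apply/eqP;
  rewrite -Quotient.idealrBE lspan_predE; by [move/asboolP|apply/asboolP].
Qed.

Lemma qprojD : {morph qproj : u v / u + v}.
Proof. by move=> u v; rewrite /qproj raddfD. Qed.

Definition qscale (a : K) (q : quotmod) : quotmod := qproj (a *: qrepr q).

Lemma qscale_proj a v : qproj (a *: v) = qscale a (qproj v).
Proof.
apply/qprojP; rewrite -scalerBr -[_ *: _]addr0 => P sP SP.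
have [P0 PD] := sP; apply: (PD) => //.
by have /qprojP := esym (qreprK (qproj v)); apply.
Qed.

Lemma qscaleA a b q : qscale a (qscale b q) = qscale (a * b) q.
Proof. by rewrite -[q]qreprK -!qscale_proj scalerA. Qed.
Lemma qscale1 : left_id 1 qscale.
Proof. by move=> q; rewrite -[q]qreprK -qscale_proj scale1r. Qed.
Lemma qscaleDr : right_distributive qscale +%R.
Proof.
by move=> a p q; rewrite -[p]qreprK -[q]qreprK -qprojD -!qscale_proj scalerDr qprojD.
Qed.
Lemma qscaleDl q : {morph qscale^~ q : a b / a + b}.
Proof. by move=> a b; rewrite -[q]qreprK -!qscale_proj scalerDl qprojD. Qed.

HB.instance Definition _ := GRing.Zmodule_isLmodule.Build K quotmod
  qscaleA qscale1 qscaleDr qscaleDl.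

Lemma qprojZ a v : qproj (a *: v) = a *: qproj v.
Proof. exact: qscale_proj. Qed.

Lemma qproj_linear : linear qproj.
Proof. by move=> a u v; rewrite qprojD qprojZ. Qed.
HB.instance Definition _ := GRing.isLinear.Build K V quotmod *:%R qproj
  qproj_linear.
End Quotient.

Section Tensor.
Variables (K : fieldType) (k : nat) (V : 'I_k -> lmodType K).

Definition upd (v : forall i, V i) (i : 'I_k) (x : V i) : forall i, V i :=
  @dfwith _ (fun i => V i) v i x.

Definition tensor_rel (w : fsupp (forall i, V i) K^o) : Prop :=
  exists (v : forall i, V i) (i : 'I_k) (a : K) (x y : V i),
    w = mono (upd v (a *: x + y)) 1 -
        (a *: mono (upd v x) 1 + mono (upd v y) 1).

Definition tensor : lmodType K := quotmod tensor_rel.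

Definition tpure (v : forall i, V i) : tensor := qproj tensor_rel (mono v 1).
End Tensor.

Section Lie.
Variables (K : fieldType) (L : lmodType K) (br : L -> L -> L).

Record lie_algebra : Prop := LieAlgebra {
  lie_linl : forall y, linear (br^~ y);
  lie_linr : forall x, linear (br x);
  lie_alt : forall x, br x x = 0;
  lie_jacobi : forall x y z,
    br x (br y z) + br y (br z x) + br z (br x y) = 0 }.

(* act makes M a module over the subalgebra D of L. *)
Record lie_module (D : L -> Prop) (M : lmodType K) (act : L -> M -> M) : Prop :=
  LieModule {
  act_linl : forall (a : K) x y v, D x -> D y ->
    act (a *: x + y) v = a *: act x v + act y v;
  act_linr : forall x, D x -> linear (act x);
  act_br : forall x y v, D x -> D y ->
    act (br x y) v = act x (act y v) - act y (act x v) }.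

Definition irreducible_module (M : lmodType K) (act : L -> M -> M) : Prop :=
  (exists v : M, v != 0) /\
  forall P : M -> Prop, is_subspace P -> (forall x v, P v -> P (act x v)) ->
    (forall v, P v -> v = 0) \/ (forall v, P v).

Definition locally_nilpotent (M : lmodType K) (f : M -> M) : Prop :=
  forall v, exists N, iter N f v = 0.
End Lie.

Section Roots.
Variables (K : fieldType) (g : vectType K) (br : g -> g -> g) (h : {vspace g}).

Definition simple_lie : Prop :=
  (exists x y, br x y != 0) /\
  forall I : {vspace g}, (forall x y, y \in I -> br x y \in I) ->
    I = 0%VS \/ I = fullv.

(* a maximal abelian subalgebra all of whose elements are ad-diagonalizable *)
Definition cartan : Prop :=
  [/\ {in h &, forall x y, br x y = 0},
      forall x, {in h, forall y, br y x = 0} -> x \in h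
    & {in h, forall y, exists2 X : seq g, basis_of fullv X &
        {in X, forall x, exists a : K, br y x = a *: x}}].

Let hdual := 'Hom(subvs_of h, K^o).

Definition root_space (al : hdual) (x : g) : Prop :=
  forall t : subvs_of h, br (vsval t) x = (al t : K) *: x.

Definition lroot (al : hdual) : Prop :=
  al != 0 /\ exists2 x, x != 0 & root_space al x.

Definition nneg_comb (B : seq hdual) (be : hdual) : Prop :=
  exists n : nat -> nat, be = \sum_(i < size B) B`_i *+ n i.

Definition root_base (B : seq hdual) : Prop :=
  [/\ basis_of fullv B, {in B, forall al, lroot al}
    & forall al, lroot al -> nneg_comb B al \/ nneg_comb B (- al)].

Definition positive_root (B : seq hdual) (al : hdual) : Prop :=
  lroot al /\ nneg_comb B al.

Definition highest_root (B : seq hdual) (th : hdual) : Prop :=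
  lroot th /\ forall al, lroot al -> nneg_comb B (th - al).

(* t is the coroot of al, i.e. the element of [g_al, g_-al] with al(t) = 2 *)
Definition coroot (al : hdual) (t : subvs_of h) : Prop :=
  al t = 2%:R /\
  exists x y, [/\ root_space al x, root_space (- al) y & br x y = vsval t].

(* <,> is symmetric and invariant, and the form it induces on the dual of h   *)
(* takes the value 2 on (th, th).                                             *)
Definition normalized_form (th : hdual) (form : g -> g -> K) : Prop :=
  [/\ forall x (a : K) y z, form x (a *: y + z) = a * form x y + form x z,
      forall x y, form x y = form y x,
      forall x y z, form (br x y) z = form x (br y z)
    & exists2 t : subvs_of h,
        forall u : subvs_of h, form (vsval t) (vsval u) = th u
        & form (vsval t) (vsval t) = 2%:R].
End Roots.

Record simpleLie (K : fieldType) := SimpleLie {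
  gdot :> vectType K;
  gbr : gdot -> gdot -> gdot;
  gcartan : {vspace gdot};
  gbase : seq 'Hom(subvs_of gcartan, K^o);
  ghighest : 'Hom(subvs_of gcartan, K^o);
  gform : gdot -> gdot -> K;
  gbr_lie : lie_algebra gbr;
  gbr_simple : simple_lie gbr;
  gcartanP : cartan gbr gcartan;
  gbaseP : root_base gbr gbase;
  ghighestP : highest_root gbr gbase ghighest;
  gformP : normalized_form gbr ghighest gform }.

Arguments gbr {K g} : rename.
Arguments gform {K g} : rename.

Notation hdot g := (subvs_of (gcartan g)).
Notation Z2 := (int * int)%type.
Notation Z2nz := {m : Z2 | m != 0}.

Section Toroidal.
Variables (K : fieldType) (g : simpleLie K) (mu : K).

Definition detZ2 (m n : Z2) : K := (m.1 * n.2 - m.2 * n.1)%:~R.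

(* In fsupp Z2 (K^o * K^o), the pair (u0, u1) placed at m stands for          *)
(* u0 t^m k_0 + u1 t^m k_1.                                                   *)
Definition kvec (m : Z2) : K^o * K^o := (m.1%:~R, m.2%:~R).

Definition kd_rel (w : fsupp Z2 (K^o * K^o)%type) : Prop :=
  exists m, w = mono m (kvec m).

Definition kd : lmodType K := quotmod kd_rel.

(* ((a0, a1), f) is a0 d_0 + a1 d_1 + \sum_(m != 0) f(m) d(m); d(0) = 0. *)
Definition skewder : lmodType K := (K^o * K^o * fsupp Z2nz K^o)%type.

Definition dmono (m : Z2) : fsupp Z2nz K^o :=
  if insub m is Some m' then mono m' 1 else 0.

Definition gtilde : lmodType K := (fsupp Z2 g * kd * skewder)%type.

Definition gt_x (m : Z2) (x : g) : gtilde := (mono m x, 0, 0).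
Definition gt_k0 (m : Z2) : gtilde := (0, qproj _ (mono m (1, 0)), 0).
Definition gt_k1 (m : Z2) : gtilde := (0, qproj _ (mono m (0, 1)), 0).
Definition gt_d0 : gtilde := (0, 0, (1, 0, 0)).
Definition gt_d1 : gtilde := (0, 0, (0, 1, 0)).
Definition gt_d (m : Z2) : gtilde := (0, 0, (0, 0, dmono m)).
Definition gt_dt (m : Z2) : gtilde := gt_d m + (m.2%:~R * mu) *: gt_k0 m.

Definition sdeg (s : skewder) (n : Z2) : K :=
  s.1.1 * n.1%:~R + s.1.2 * n.2%:~R.

Definition xx_x (f f' : fsupp Z2 g) : fsupp Z2 g :=
  lext (fun (m : Z2) (x : g) => lext (fun (n : Z2) (y : g) =>
    mono (m + n) (gbr x y)) f') f.

Definition xx_k (f f' : fsupp Z2 g) : fsupp Z2 (K^o * K^o)%type :=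
  lext (fun (m : Z2) (x : g) => lext (fun (n : Z2) (y : g) =>
    mono (m + n) (gform x y *: kvec m)) f') f.

Definition sx_x (s : skewder) (f : fsupp Z2 g) : fsupp Z2 g :=
  lext (fun (n : Z2) (x : g) => mono n (sdeg s n *: x) +
    lext (V := K^o) (W := fsupp Z2 g) (fun (m : Z2nz) (b : K) =>
      mono (val m + n) ((b * detZ2 (val m) n) *: x)) s.2) f.

Definition sk_k (s : skewder) (f : fsupp Z2 (K^o * K^o)%type) :
    fsupp Z2 (K^o * K^o)%type :=
  lext (fun (n : Z2) (u : K^o * K^o) => mono n (sdeg s n *: u) +
    lext (V := K^o) (W := fsupp Z2 (K^o * K^o)%type) (fun (m : Z2nz) (b : K) =>
      mono (val m + n) ((b * detZ2 (val m) n) *: u +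
        (b * ((val m).1%:~R * u.2 - (val m).2%:~R * u.1)) *: kvec (val m)))
      s.2) f.

Definition ss_s (s s' : skewder) : fsupp Z2nz K^o :=
  lext (V := K^o) (fun (m : Z2nz) (b : K) =>
    mono m (sdeg s (val m) * b : K^o)) s'.2 -
  lext (V := K^o) (fun (m : Z2nz) (b : K) =>
    mono m (sdeg s' (val m) * b : K^o)) s.2 +
  lext (V := K^o) (fun (m : Z2nz) (b : K) =>
    lext (V := K^o) (fun (n : Z2nz) (b' : K) =>
      (b * b' * detZ2 (val m) (val n)) *: dmono (val m + val n)) s'.2) s.2.

Definition ss_k (s s' : skewder) : fsupp Z2 (K^o * K^o)%type :=
  lext (V := K^o) (fun (m : Z2nz) (b : K) =>
    lext (V := K^o) (fun (n : Z2nz) (b' : K) => mono (val m + val n)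
      ((mu * (b * b') * detZ2 (val m) (val n) ^+ 2) *: kvec (val m))) s'.2) s.2.

(* Computed on representatives of the components in kd; the values on         *)
(* generators are given below.                                                *)
Definition gt_br (X Y : gtilde) : gtilde :=
  let: (f, q, s) := X in let: (f', q', s') := Y in
  (xx_x f f' + sx_x s f' - sx_x s' f,
   qproj _ (xx_k f f' + sk_k s (qrepr q') - sk_k s' (qrepr q) + ss_k s s'),
   (0, 0, ss_s s s')).

Definition ghat (X : gtilde) : Prop := X.2.1.2 = 0.

(* htilde: an element (t, (a0, a1), (b0, b1)) stands for                      *)
(* t + a0 k_0 + a1 k_1 + b0 d_0 + b1 d_1.                                     *)
Definition htilde : vectType K := (hdot g * (K^o * K^o) * (K^o * K^o))%type.

Definition ht_emb (t : htilde) : gtilde :=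
  gt_x 0 (vsval t.1.1) + t.1.2.1 *: gt_k0 0 + t.1.2.2 *: gt_k1 0
  + t.2.1 *: gt_d0 + t.2.2 *: gt_d1.

(* the roots al + m_0 delta_0 + m_1 delta_1 with al in the root system of g *)
Definition nonisotropic_root (ga : 'Hom(htilde, K^o)) : Prop :=
  exists al (m : Z2), lroot (@gbr _ g) al /\
    forall t : htilde, ga t = al t.1.1 + m.1%:~R * t.2.1 + m.2%:~R * t.2.2.

Definition gt_root_space (ga : 'Hom(htilde, K^o)) (X : gtilde) : Prop :=
  forall t : htilde, gt_br (ht_emb t) X = (ga t : K) *: X.

Section Integrable.
Variables (M : lmodType K) (act : gtilde -> M -> M).

Definition weight_space (ga : 'Hom(htilde, K^o)) (v : M) : Prop :=
  forall t : htilde, act (ht_emb t) v = (ga t : K) *: v.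

Definition weight_module : Prop :=
  (forall v, exists (s : seq 'Hom(htilde, K^o)) (w : 'Hom(htilde, K^o) -> M),
    (forall ga, weight_space ga (w ga)) /\ v = \sum_(ga <- s) w ga) /\
  (forall (s : seq 'Hom(htilde, K^o)) (w : 'Hom(htilde, K^o) -> M),
    uniq s -> (forall ga, weight_space ga (w ga)) ->
    \sum_(ga <- s) w ga = 0 -> {in s, forall ga, w ga = 0}).

Definition integrable_module : Prop :=
  weight_module /\
  forall ga X, nonisotropic_root ga -> gt_root_space ga X ->
    locally_nilpotent (act X).
End Integrable.

End Toroidal.

Section VirasoroAffine.
Variables (K : fieldType) (g : simpleLie K).

(* (x, (a, b)) stands for x + a k_1 + b d_1. *)
Definition fdot : lmodType K := (g * (K^o * K^o))%type.
Definition fk1 : fdot := (0, (1, 0)).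
Definition fd1 : fdot := (0, (0, 1)).

Definition fdot_br (x y : fdot) : fdot := (gbr x.1 y.1, 0).
Definition fdot_form (x y : fdot) : K :=
  gform x.1 y.1 + (x.2.1 * y.2.2 + x.2.2 * y.2.1).

(* (l, x, a, b) stands for                                                    *)
(* \sum_m l(m) L(m) + \sum_m (x(m))(m) + a k_0 + b k_v.                       *)
Definition fbar : lmodType K :=
  (fsupp int K^o * fsupp int fdot * K^o * K^o)%type.

Definition fb_L (m : int) : fbar := (mono m 1, 0, 0, 0).
Definition fb_x (m : int) (x : fdot) : fbar := (0, mono m x, 0, 0).
Definition fb_k0 : fbar := (0, 0, 1, 0).
Definition fb_kv : fbar := (0, 0, 0, 1).
Definition fb_d0 : fbar := - fb_L 0.

Definition fb_br (X Y : fbar) : fbar :=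
  let: (l, x, _, _) := X in let: (l', x', _, _) := Y in
  (lext (V := K^o) (fun (m : int) (b : K) =>
     lext (V := K^o) (fun (n : int) (b' : K) =>
       mono (m + n) (b * b' * (m - n)%:~R : K^o)) l') l,
   lext (fun (m : int) (u : fdot) => lext (fun (n : int) (u' : fdot) =>
     mono (m + n) (fdot_br u u')) x') x
   + lext (V := K^o) (fun (m : int) (b : K) =>
       lext (fun (n : int) (u : fdot) =>
         mono (m + n) ((b * (- n)%:~R) *: u)) x') l
   - lext (V := K^o) (fun (m : int) (b : K) =>
       lext (fun (n : int) (u : fdot) =>
         mono (m + n) ((b * (- n)%:~R) *: u)) x) l',
   lext (fun (m : int) (u : fdot) => m%:~R * fdot_form u (x' (- m)) : K^o) x,
   lext (V := K^o) (fun (m : int) (b : K) =>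
     b * l' (- m) * ((m ^+ 3 - m)%:~R / 12%:R) : K^o) l).

(* (t, a, b) stands for t + a k_0 + b d_0. *)
Definition haff : vectType K := (hdot g * K^o * K^o)%type.

(* (t, (a, b), c) stands for t + a k_1 + b d_1 + c k_v, with t in haff. *)
Definition fbar0 : vectType K := (haff * (K^o * K^o) * K^o)%type.

Definition fb0_emb (t : fbar0) : fbar :=
  fb_x 0 (vsval t.1.1.1.1, t.1.2) + t.1.1.1.2 *: fb_k0 + t.1.1.2 *: fb_d0
  + t.2 *: fb_kv.

Definition fbar_plus : fbar -> Prop := lspan (fun X =>
  [\/ exists2 m : int, (0 < m)%R & X = fb_L m,
      exists (m : int) (x : fdot), (0 < m)%R /\ X = fb_x m x
    | exists al x, [/\ positive_root gbr (gbase g) al, root_space gbr al x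
        & X = fb_x 0 (x, 0)]]).

Definition irreducible_highest_weight (eta : 'Hom(fbar0, K^o))
    (V : lmodType K) (act : fbar -> V -> V) : Prop :=
  [/\ lie_module fb_br (fun=> True) act, irreducible_module act
    & exists v : V, [/\ v != 0,
        forall t : fbar0, act (fb0_emb t) v = (eta t : K) *: v
      & forall X, fbar_plus X -> act X v = 0]].

Definition level (la : 'Hom(haff, K^o)) : K := la (0, 1, 0).

Definition lambda_bar_fun (mu : K) (la : 'Hom(haff, K^o)) (t : fbar0) : K^o :=
  la t.1.1 + 24%:R * mu * level la * t.2.

Lemma lambda_bar_linear mu la : linear (lambda_bar_fun mu la).
Proof.
move=> a u v; rewrite /lambda_bar_fun /= linearP mulrDr scalerDr addrACA.
by congr (_ + (_ + _)); rewrite /GRing.scale /= mulrCA.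
Qed.
HB.instance Definition _ mu la := GRing.isLinear.Build K fbar0 K^o *:%R
  (lambda_bar_fun mu la) (lambda_bar_linear mu la).

Definition lambda_bar mu la : 'Hom(fbar0, K^o) := linfun (lambda_bar_fun mu la).

Definition dominant (la : 'Hom(haff, K^o)) : Prop :=
  (forall al t, al \in gbase g -> coroot gbr al t ->
    exists n : nat, la (t, 0, 0) = n%:R) /\
  (forall t, coroot gbr (ghighest g) t ->
    exists n : nat, level la - la (t, 0, 0) = n%:R).
End VirasoroAffine.

Section Exponential.
Variables (K : fieldType) (V : lmodType K) (A : nat -> V -> V).

(* coefficient of z^r in (\sum_(j >= 1) A_j z^j)^s *)
Fixpoint pow_coef (s r : nat) (v : V) : V :=
  if s is s'.+1 then \sum_(1 <= j < r.+1) A j (pow_coef s' (r - j) v)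
  else if r == 0 then v else 0.

(* coefficient of z^r in exp(\sum_(j >= 1) A_j z^j) *)
Definition exp_coef (r : nat) (v : V) : V :=
  \sum_(0 <= s < r.+1) (s`!%:R : K)^-1 *: pow_coef s r v.
End Exponential.

Section VertexOperators.
Variables (K : fieldType) (g : simpleLie K) (mu c : K).
Variables (V : lmodType K) (act : fbar g -> V -> V).

Local Notation L m := (act (fb_L g m)).
Local Notation x_ m x := (act (fb_x m x)).
Local Notation k1_ m := (act (fb_x m (fk1 g))).
Local Notation d1_ m := (act (fb_x m (fd1 g))).

(* All sums below have finite support when applied to a vector of a highest   *)
(* weight module.                                                             *)

(* coefficient of z^-q in E(n, z) *)
Definition Ecoef (n q : int) (v : V) : V :=
  \sum_(rs \in [set rs : nat * nat | rs.2%:Z - rs.1%:Z = q])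
    exp_coef (fun j w => (n%:~R / (c * j%:R)) *: k1_ (- j%:Z) w) rs.1
      (exp_coef (fun j w => - (n%:~R / (c * j%:R)) *: k1_ j%:Z w) rs.2 v).

(* coefficient of z^-m in (\sum_p A_p z^-p) E(n, z) *)
Definition timesE (A : int -> V -> V) (m n : int) (v : V) : V :=
  \sum_(p \in [set: int]) A p (Ecoef n (m - p) v).

(* modes of L(z) - 1/c :d_1(z) k_1(z): *)
Definition Lbar (m : int) (v : V) : V :=
  L m v - c^-1 *: \sum_(p \in [set: int])
    (if (p < 0)%R then d1_ p (k1_ (m - p) v) else k1_ (m - p) (d1_ p v)).

Definition k0_op (m n : int) (v : V) : V := c *: Ecoef n m v.
Definition k1_op (m n : int) : V -> V := timesE (fun p => k1_ p) m n.
Definition x_op (x : g) (m n : int) : V -> V :=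
  timesE (fun p => x_ p ((x, 0) : fdot g)) m n.
Definition Lbar_op (m n : int) : V -> V := timesE Lbar m n.
Definition k1bar_op (m n : int) : V -> V :=
  timesE (fun p v => (- p)%:~R *: k1_ p v) m n.
Definition d1bar_op (m n : int) (v : V) : V :=
  \sum_(p \in [set: int]) (- p)%:~R *:
    (if (p < 0)%R then d1_ p (Ecoef n (m - p) v)
     else Ecoef n (m - p) (d1_ p v)).
Definition dbar_op (m n : int) (v : V) : V :=
  n%:~R *: Lbar_op m n v + (n%:~R ^+ 2 * mu) *: k1bar_op m n v - d1bar_op m n v.
End VertexOperators.

Section Modules.
Variables (K : fieldType) (g : simpleLie K) (mu : K) (k : nat).
Variables (la : 'I_k -> 'Hom(haff g, K^o)) (a : 'I_k -> K).
Variables (V : 'I_k -> lmodType K) (actV : forall i, fbar g -> V i -> V i).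

Definition tensor_sum (X : forall i, V i -> V i) (n : int) (v : forall i, V i) :
    tensor V :=
  \sum_(i < k) a i ^ n *: tpure (upd v (X i (v i))).

Record Vhat_action (act : gtilde g -> tensor V -> tensor V) : Prop := {
  Vhat_module : lie_module (@gt_br _ g mu) (@ghat _ g) act;
  Vhat_k0 : forall m n v, act (gt_k0 g (m, n)) (tpure v) =
    tensor_sum (fun i => k0_op (level (la i)) (@actV i) m n) n v;
  Vhat_k1 : forall m n v, act (gt_k1 g (m, n)) (tpure v) =
    tensor_sum (fun i => k1_op (level (la i)) (@actV i) m n) n v;
  Vhat_x : forall x m n v, act (gt_x (m, n) x) (tpure v) =
    tensor_sum (fun i => x_op (level (la i)) (@actV i) x m n) n v;
  Vhat_d : forall m n v, act (gt_dt g mu (m, n)) (tpure v) =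
    tensor_sum (fun i => dbar_op mu (level (la i)) (@actV i) m n) n v;
  Vhat_d0 : forall v, act (gt_d0 g) (tpure v) =
    tensor_sum (fun i => actV (fb_d0 g)) 0 v }.

(* mono l v stands for v (x) t_1^l. *)
Definition Vtilde : lmodType K := fsupp int (tensor V).

Record Vtilde_action (act : gtilde g -> Vtilde -> Vtilde) : Prop := {
  Vtilde_module : lie_module (@gt_br _ g mu) (fun=> True) act;
  Vtilde_hat : exists2 act' : gtilde g -> tensor V -> tensor V,
    Vhat_action act' &
    forall (n : int) X, ghat X -> gt_br mu (gt_d1 g) X = n%:~R *: X ->
      forall v l, act X (mono l v) = mono (l + n) (act' X v);
  Vtilde_d1 : forall v l, act (gt_d1 g) (mono l v) = mono l (l%:~R *: v) }.
End Modules.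

Section LinearExtensionTheory.
Variables (K : fieldType) (T : choiceType) (V W : lmodType K).

Lemma fsupp_seq (f : fsupp T V) :
  exists2 r : seq T, uniq r & forall t, t \notin r -> f t = 0.
Proof.
case: f => f /= ff; have := ff; rewrite fin_suppE => /asboolP.
move=> /finite_seqP[X fX]; exists (undup X); first exact: undup_uniq.
move=> t; rewrite mem_undup => tX; apply/eqP/contraT => ft; move/seteqP: fX => [/(_ t ft) /= + _].
by rewrite (negPf tX).
Qed.

Lemma lextE (phi : T -> V -> W) (f : fsupp T V) (r : seq T) :
  (forall t, phi t 0 = 0) -> uniq r -> (forall t, t \notin r -> f t = 0) ->
  lext phi f = \sum_(t <- r) phi t (f t).
Proof.
move=> phi0 ur fr; rewrite unlock (fsbigE r)//=; first last.
  by move=> t _ /fr ->.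
by apply: eq_bigl => t; rewrite in_setT.
Qed.

Lemma lext_mono (phi : T -> V -> W) t v :
  (forall t, phi t 0 = 0) -> lext phi (mono t v) = phi t v.
Proof.
move=> phi0; rewrite (@lextE _ _ [:: t])//=.
  by rewrite big_seq1 /=; case: asboolP.
by move=> u; rewrite inE; case: asboolP => // ->; rewrite eqxx.
Qed.

Lemma lext_linear (phi : T -> V -> W) :
  (forall t, linear (phi t)) -> linear (lext phi).
Proof.
move=> phil; have phi0 t : phi t 0 = 0.
  by have := phil t (-1) 0 0; rewrite addr0 !scaler0 scaleN1r addNr.
move=> a f g; have [r ur fr] := fsupp_seq f; have [s us gs] := fsupp_seq g.
have inu t : t \notin undup (r ++ s) -> (f t = 0) /\ (g t = 0).
  by rewrite mem_undup mem_cat negb_or => /andP[/fr -> /gs ->].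
rewrite !(@lextE _ _ (undup (r ++ s))) ?undup_uniq//.
- by rewrite scaler_sumr -big_split; apply: eq_bigr => t _; rewrite /= -phil.
- by move=> t /inu[].
- by move=> t /inu[].
- by move=> t /inu[f0 g0] /=; rewrite !fctE /= f0 g0 scaler0 addr0.
Qed.
End LinearExtensionTheory.

Section MonoTheory.
Variables (K : fieldType) (T : Type) (V : lmodType K).
Lemma mono_linear t : linear (@mono K T V t).
Proof.
move=> a u v; apply: val_inj; apply/funext => s /=; rewrite !fctE /=.
by case: asboolP; rewrite ?scaler0 ?addr0.
Qed.
HB.instance Definition _ t := GRing.isLinear.Build K V (fsupp T V) *:%R
  (@mono K T V t) (mono_linear t).
Lemma mono0 t : @mono K T V t 0 = 0.
Proof. by apply: val_inj; apply/funext => s /=; rewrite if_same. Qed.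
Lemma monoD t u v : @mono K T V t (u + v) = mono t u + mono t v.
Proof. by have := mono_linear t 1 u v; rewrite !scale1r. Qed.
Lemma monoZ t a v : @mono K T V t (a *: v) = a *: mono t v.
Proof. by have := mono_linear t a v 0; rewrite mono0 !addr0. Qed.
End MonoTheory.

Section ToroidalTheory.
Variables (K : fieldType) (g : simpleLie K) (mu : K).
Implicit Types (m n : Z2) (x y : g).

Lemma gbr0l y : gbr (0 : g) y = 0.
Proof.
by have := lie_linl (gbr_lie g) y (-1) 0 0; rewrite addr0 !scaler0 scaleN1r addNr.
Qed.

Lemma gbr0r x : gbr x (0 : g) = 0.
Proof.
by have := lie_linr (gbr_lie g) x (-1) 0 0; rewrite addr0 !scaler0 scaleN1r addNr.
Qed.

Lemma gform0r x : gform x (0 : g) = 0.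
Proof.
case: (gformP g) => + _ _ _ => /(_ x (-1) 0 0).
by rewrite addr0 scaler0 mulN1r addNr.
Qed.

Lemma gform0l y : gform (0 : g) y = 0.
Proof. by case: (gformP g) => _ fC _ _; rewrite fC gform0r. Qed.

Lemma sk_k_linear (s : skewder K) : linear (sk_k s).
Proof.
apply: lext_linear => n a u v.
rewrite [X in mono n X](_ : _ = a *: (sdeg s n *: u) + sdeg s n *: v); last first.
  by rewrite scalerDr !scalerA mulrC.
rewrite mono_linear scalerDr [RHS]addrACA; congr (_ + _).
have [r ur sr] := fsupp_seq s.2.
have z (t : Z2nz) (u' : K^o * K^o) : mono (val t + n) (((0 : K) * detZ2 K (val t) n) *: u' +
     ((0 : K) * ((val t).1%:~R * u'.2 - (val t).2%:~R * u'.1)) *: kvec K (val t))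
  = 0 :> fsupp Z2 (K^o * K^o)%type.
  by rewrite !mul0r !scale0r addr0 mono0.
rewrite !(@lextE _ _ _ _ _ _ r)// scaler_sumr -big_split; apply: eq_bigr => t _ /=.
rewrite -mono_linear; congr mono; rewrite !scalerDr !scalerA.
rewrite [in RHS]addrACA -!addrA; congr (_ + _); first by rewrite mulrC.
congr (_ + _); rewrite -scalerDl; congr (_ *: _).
rewrite /GRing.scale /=; ring.
Qed.

Lemma lext0 (T : choiceType) (V W : lmodType K) (phi : T -> V -> W) :
  (forall t, phi t 0 = 0) -> lext phi 0 = 0.
Proof. by move=> phi0; rewrite (@lextE _ _ _ _ _ _ [::]) ?big_nil. Qed.

Lemma sx_x_phi0 (s : skewder K) (n : Z2) :
  mono n (sdeg s n *: (0 : g)) + lext (V := K^o) (W := fsupp Z2 g)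
    (fun (m : Z2nz) (b : K) => mono (val m + n) ((b * detZ2 K (val m) n) *: (0 : g)))
    s.2 = 0.
Proof.
rewrite scaler0 mono0 add0r unlock; under eq_fsbigr do rewrite scaler0 mono0.
by rewrite fsbig1.
Qed.

Lemma sk_k_phi0 (s : skewder K) (n : Z2) :
  mono n (sdeg s n *: 0) + lext (V := K^o) (W := fsupp Z2 (K^o * K^o)%type)
    (fun (m : Z2nz) (b : K) => mono (val m + n) ((b * detZ2 K (val m) n) *: 0 +
      (b * ((val m).1%:~R * (0 : K^o * K^o).2 - (val m).2%:~R * (0 : K^o * K^o).1))
       *: kvec K (val m)))
    s.2 = 0.
Proof.
rewrite scaler0 mono0 add0r unlock.
by rewrite fsbig1// => m _; rewrite !mulr0 subrr mulr0 scaler0 scale0r addr0 mono0.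
Qed.

Lemma lspan0 (V : lmodType K) (S : V -> Prop) : lspan S 0.
Proof. by move=> P []. Qed.

Lemma lspanZ (V : lmodType K) (S : V -> Prop) a u : S u -> lspan S (a *: u).
Proof. by move=> Su P [P0 PD] SP; rewrite -[_ *: _]addr0; apply: PD => //; apply: SP. Qed.

Lemma lspanD (V : lmodType K) (S : V -> Prop) u v :
  lspan S u -> lspan S v -> lspan S (u + v).
Proof.
move=> hu hv P sP SP; rewrite -[u]scale1r; apply: sP.2; [exact: hu|exact: hv].
Qed.

Lemma kvecD m n : kvec K (m + n) = kvec K m + kvec K n.
Proof. by rewrite /kvec /= !intrD. Qed.

Lemma sk_k_rel (s : skewder K) (w : fsupp Z2 (K^o * K^o)%type) :
  @kd_rel K w -> lspan (@kd_rel K) (sk_k s w).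
Proof.
case=> n ->; rewrite /sk_k lext_mono; last exact: sk_k_phi0.
have mz := mono_linear.
have mZ p b (u : K^o * K^o) : mono p (b *: u) = b *: mono p u
  :> fsupp Z2 (K^o * K^o)%type.
  by have := mono_linear p b u 0; rewrite mono0 !addr0.
apply: lspanD; first by rewrite mZ; apply: lspanZ; exists n.
have [r ur sr] := fsupp_seq s.2; rewrite (@lextE _ _ _ _ _ _ r)//; last first.
  by move=> t; rewrite !mul0r !scale0r addr0 mono0.
apply: (big_ind (fun w => lspan (@kd_rel K) w)).
- exact: lspan0.
- exact: lspanD.
move=> t _; rewrite [X in mono _ X](_ : _ =
    (s.2 t * detZ2 K (val t) n) *: kvec K (val t + n)).
  by rewrite mZ; apply: lspanZ; exists (val t + n).
rewrite kvecD scalerDr addrC; congr (_ *: _ + _).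
by rewrite /detZ2 rmorphB !rmorphM.
Qed.

Lemma sk_k_qrepr (s : skewder K) (u : fsupp Z2 (K^o * K^o)%type) :
  qproj (@kd_rel K) (sk_k s (qrepr (qproj (@kd_rel K) u))) =
  qproj (@kd_rel K) (sk_k s u).
Proof.
apply/qprojP; have sB w z : sk_k s w - sk_k s z = sk_k s (w - z).
  by rewrite addrC -scaleN1r -sk_k_linear scaleN1r addrC.
rewrite sB; have /qprojP := qreprK (qproj (@kd_rel K) u) => h.
apply: (h (fun w => lspan (@kd_rel K) (sk_k s w))).
  split=> [|a w z hw hz]; first by rewrite /sk_k lext0; [exact: lspan0|exact: sk_k_phi0].
  rewrite sk_k_linear; apply: lspanD => // P sP SP.
  by rewrite -[_ *: _]addr0; apply: sP.2 => //; [apply: hw|case: sP].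
exact: sk_k_rel.
Qed.

Lemma gt_brE f u s f' u' s' :
  gt_br mu ((f, qproj _ u, s) : gtilde g) ((f', qproj _ u', s') : gtilde g) =
  ((xx_x f f' + sx_x s f' - sx_x s' f,
    qproj _ (xx_k f f' + sk_k s u' - sk_k s' u + ss_k mu s s'),
    (0, 0, ss_s s s')) : gtilde g).
Proof.
rewrite /gt_br !qprojD !(raddfN (qproj _)) !sk_k_qrepr.
by congr (_, _ - _ + _, _); apply: sk_k_qrepr.
Qed.

(* \sum_a m_a t^p k_a *)
Definition gt_km m p : gtilde g :=
  m.1%:~R *: gt_k0 g p + m.2%:~R *: gt_k1 g p.

Lemma gt_kmE m p : gt_km m p = (0, qproj _ (mono p (kvec K m)), 0).
Proof.
rewrite /gt_km /gt_k0 /gt_k1.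
have -> : kvec K m = m.1%:~R *: (1, 0) + m.2%:~R *: (0, 1) :> (K^o * K^o)%type.
  by congr (_, _); rewrite /= ?scaler0 ?addr0 ?add0r /GRing.scale /= mulr1.
apply: injective_projections; [apply: injective_projections|]; rewrite /=.
- by rewrite !scaler0 addr0.
- by rewrite monoD !monoZ qprojD !qprojZ.
- by rewrite !scaler0 addr0.
Qed.

Lemma lextl0 (T : choiceType) (V W : lmodType K) (phi : T -> V -> W) f :
  (forall t v, phi t v = 0) -> lext phi f = 0.
Proof. by move=> phi0; rewrite unlock fsbig1. Qed.

Lemma xx_x0l (f : fsupp Z2 g) : xx_x 0 f = 0.
Proof. by rewrite /xx_x lext0// => m; rewrite lextl0// => n y; rewrite gbr0l mono0. Qed.
Lemma xx_x0r (f : fsupp Z2 g) : xx_x f 0 = 0.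
Proof. by rewrite /xx_x lextl0// => m x; rewrite lext0// => n; rewrite gbr0r mono0. Qed.
Lemma xx_k0l (f : fsupp Z2 g) : xx_k 0 f = 0.
Proof.
rewrite /xx_k lext0// => m; rewrite lextl0// => n y.
by rewrite gform0l scale0r mono0.
Qed.
Lemma xx_k0r (f : fsupp Z2 g) : xx_k f 0 = 0.
Proof.
rewrite /xx_k lextl0// => m x; rewrite lext0// => n.
by rewrite gform0r scale0r mono0.
Qed.
Lemma sx_x0r s : sx_x s (0 : fsupp Z2 g) = 0.
Proof. by rewrite /sx_x lext0// => n; rewrite sx_x_phi0. Qed.
Lemma sdeg0 n : sdeg (0 : skewder K) n = 0.
Proof. by rewrite /sdeg /= !mul0r addr0. Qed.
Lemma sx_x0l (f : fsupp Z2 g) : sx_x 0 f = 0.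
Proof.
rewrite /sx_x lextl0// => n y; rewrite sdeg0 scale0r mono0 add0r lext0// => m.
by rewrite mul0r scale0r mono0.
Qed.
Lemma sk_k0r s : sk_k s (0 : fsupp Z2 (K^o * K^o)%type) = 0.
Proof. by rewrite /sk_k lext0// => n; rewrite sk_k_phi0. Qed.
Lemma sk_k0l u : sk_k (0 : skewder K) u = 0.
Proof.
rewrite /sk_k lextl0// => n y; rewrite sdeg0 scale0r mono0 add0r lext0// => m.
by rewrite !mul0r !scale0r addr0 mono0.
Qed.
Lemma ss_s0l (s : skewder K) : ss_s 0 s = 0.
Proof.
rewrite /ss_s lextl0; last by move=> m b; rewrite sdeg0 mul0r mono0.
rewrite lext0; last by move=> m; rewrite mulr0 mono0.
rewrite lext0 ?subr0 ?addr0// => m; rewrite lextl0// => n b.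
by rewrite !mul0r scale0r.
Qed.
Lemma ss_s0r (s : skewder K) : ss_s s 0 = 0.
Proof.
rewrite /ss_s lext0; last by move=> m; rewrite mulr0 mono0.
rewrite lextl0; last by move=> m b; rewrite sdeg0 mul0r mono0.
rewrite lextl0 ?subr0 ?addr0// => m b; rewrite lext0// => n.
by rewrite mulr0 mul0r scale0r.
Qed.
Lemma ss_k0l s : ss_k mu 0 s = 0.
Proof.
rewrite /ss_k lext0// => m; rewrite lextl0// => n b.
by rewrite mul0r mulr0 mul0r scale0r mono0.
Qed.
Lemma ss_k0r s : ss_k mu s 0 = 0.
Proof.
rewrite /ss_k lextl0// => m b; rewrite lext0// => n.
by rewrite !mulr0 mul0r scale0r mono0.
Qed.

Lemma gt_br_xx m n x y : gt_br mu (gt_x m x) (gt_x n y) =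
  gt_x (m + n) (gbr x y) + gform x y *: gt_km m (m + n).
Proof.
rewrite gt_kmE /gt_x -[0 in LHS](linear0 (qproj (@kd_rel K))).
rewrite (gt_brE (mono m x) 0 0 (mono n y) 0 0).
rewrite !sx_x0l !sk_k0l ss_s0l ss_k0l !subr0 !addr0.
rewrite /xx_x /xx_k !lext_mono.
- congr (_, _, _); rewrite /= ?scaler0 ?addr0 ?add0r//.
  by rewrite monoZ qprojZ.
- by move=> p; rewrite gform0r scale0r mono0.
- by move=> p; rewrite lextl0// => q z; rewrite gform0l scale0r mono0.
- by move=> p; rewrite gbr0r mono0.
- by move=> p; rewrite lextl0// => q z; rewrite gbr0l mono0.
Qed.

Lemma dmonoP m : (m = 0 /\ dmono K m = 0) \/
  exists2 m' : Z2nz, val m' = m & dmono K m = mono m' 1.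
Proof.
rewrite /dmono; case: insubP => [m' _ mm'|/negPn/eqP ->]; last by left.
by right; exists m'.
Qed.

Local Notation sd m := ((0, 0, dmono K m) : skewder K).
Local Notation s0 a b := ((a, b, 0) : skewder K).

Lemma detZ20 n : detZ2 K 0 n = 0.
Proof. by rewrite /detZ2 /= !mul0r subrr. Qed.

Lemma sx_x_d m n x : sx_x (sd m) (mono n x) = mono (m + n) (detZ2 K m n *: x).
Proof.
rewrite /sx_x lext_mono; last exact: sx_x_phi0.
rewrite /sdeg /= !mul0r addr0 scale0r mono0 add0r.
case: (dmonoP m) => [[-> ->]|[m' <- ->]].
  by rewrite lext0 ?detZ20 ?scale0r ?mono0// => p; rewrite mul0r scale0r mono0.
by rewrite lext_mono ?mul1r// => p; rewrite mul0r scale0r mono0.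
Qed.

Lemma sx_x_0 (a b : K) n x :
  sx_x (s0 a b) (mono n x) = mono n ((a * n.1%:~R + b * n.2%:~R) *: x).
Proof.
rewrite /sx_x lext_mono; last exact: sx_x_phi0.
by rewrite lext0 ?addr0// => p; rewrite mul0r scale0r mono0.
Qed.

Lemma sk_k_d m n (u : K^o * K^o) : sk_k (sd m) (mono n u) = mono (m + n)
  (detZ2 K m n *: u + (m.1%:~R * u.2 - m.2%:~R * u.1 : K) *: kvec K m).
Proof.
rewrite /sk_k lext_mono; last exact: sk_k_phi0.
rewrite /sdeg /= !mul0r addr0 scale0r mono0 add0r.
case: (dmonoP m) => [[-> ->]|[m' <- ->]].
  rewrite lext0; last by move=> p; rewrite !mul0r !scale0r addr0 mono0.
  by rewrite detZ20 !mul0r subrr !scale0r addr0 mono0.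
by rewrite lext_mono ?mul1r// => p; rewrite !mul0r !scale0r addr0 mono0.
Qed.

Lemma sk_k_0 (a b : K) n (u : K^o * K^o) :
  sk_k (s0 a b) (mono n u) = mono n ((a * n.1%:~R + b * n.2%:~R) *: u).
Proof.
rewrite /sk_k lext_mono; last exact: sk_k_phi0.
by rewrite lext0 ?addr0// => p; rewrite !mul0r !scale0r addr0 mono0.
Qed.

Lemma ss_s_dd m n : ss_s (sd m) (sd n) = detZ2 K m n *: dmono K (m + n).
Proof.
rewrite /ss_s; do 2![rewrite lextl0; last
  by move=> p b; rewrite /sdeg /= !mul0r addr0 mul0r mono0].
rewrite subr0 add0r /=.
case: (dmonoP m) => [[-> ->]|[m' <- ->]].
  rewrite lext0 ?detZ20 ?scale0r// => p; rewrite lextl0// => q b.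
  by rewrite !mul0r scale0r.
rewrite lext_mono; last by move=> p; rewrite lextl0// => q b; rewrite !mul0r scale0r.
case: (dmonoP n) => [[-> ->]|[n' <- ->]].
  rewrite lext0; last by move=> p; rewrite mulr0 mul0r scale0r.
  by rewrite /detZ2 /= !mulr0 subrr scale0r.
rewrite lext_mono; last by move=> p; rewrite mulr0 mul0r scale0r.
by rewrite !mul1r.
Qed.

Lemma ss_s_0d (a b : K) m :
  ss_s (s0 a b) (sd m) = (a * m.1%:~R + b * m.2%:~R) *: dmono K m.
Proof.
rewrite /ss_s /= [X in _ - X + _]lext0; last by move=> p; rewrite mulr0 mono0.
rewrite [X in _ - _ + X]lext0; last first.
  by move=> p; rewrite lextl0// => q c; rewrite !mul0r scale0r.
rewrite subr0 addr0; case: (dmonoP m) => [[-> ->]|[m' <- ->]].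
  by rewrite scaler0 lext0// => p; rewrite mulr0 mono0.
rewrite lext_mono; last by move=> p; rewrite mulr0 mono0.
by rewrite -monoZ.
Qed.

Lemma ss_s_00 (a b a' b' : K) : ss_s (s0 a b) (s0 a' b') = 0.
Proof.
rewrite /ss_s /= !lext0 ?subr0 ?addr0//.
- by move=> m; rewrite lextl0// => n c; rewrite !mul0r scale0r.
- by move=> m; rewrite mulr0 mono0.
- by move=> m; rewrite mulr0 mono0.
Qed.

Lemma ss_k_dd m n : ss_k mu (sd m) (sd n) =
  mono (m + n) ((mu * detZ2 K m n ^+ 2) *: kvec K m).
Proof.
rewrite /ss_k /=; case: (dmonoP m) => [[-> ->]|[m' <- ->]].
  rewrite lext0 ?detZ20 ?expr0n ?mulr0 ?scale0r ?mono0// => p.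
  by rewrite lextl0// => q b; rewrite mul0r mulr0 mul0r scale0r mono0.
rewrite lext_mono; last first.
  by move=> p; rewrite lextl0// => q b; rewrite mul0r mulr0 mul0r scale0r mono0.
case: (dmonoP n) => [[-> ->]|[n' <- ->]].
  rewrite lext0; last by move=> p; rewrite !mulr0 mul0r scale0r mono0.
  by rewrite /detZ2 /= !mulr0 subrr expr0n mulr0 scale0r mono0.
rewrite lext_mono; last by move=> p; rewrite !mulr0 mul0r scale0r mono0.
by rewrite !mulr1.
Qed.

Lemma ss_k_0l (a b : K) s : ss_k mu (s0 a b) s = 0.
Proof.
rewrite /ss_k lext0// => m; rewrite lextl0// => n c.
by rewrite mul0r mulr0 mul0r scale0r mono0.
Qed.

Let qr0 : 0 = qproj (@kd_rel K) 0.
Proof. by apply: (addrI (qproj (@kd_rel K) 0)); rewrite -qprojD !addr0. Qed.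

Let pairE (A B C : lmodType K) (x y : (A * B * C)%type) :
  x.1.1 = y.1.1 -> x.1.2 = y.1.2 -> x.2 = y.2 -> x = y.
Proof. by case: x => [[? ?] ?]; case: y => [[? ?] ?] /= -> -> ->. Qed.

Let simp := (xx_x0l, xx_x0r, xx_k0l, xx_k0r, sx_x0r, sx_x0l, sk_k0r, sk_k0l,
  ss_s0l, ss_s0r, ss_k0l, ss_k0r, subr0, sub0r, oppr0, addr0, add0r).

Local Notation gk p u := ((0, qproj (@kd_rel K) (mono p u), 0) : gtilde g).
Local Notation gs a b := ((0, 0, (a, b, 0)) : gtilde g).

Lemma gt_br_xk n p x u : gt_br mu (gt_x n x) (gk p u) = 0.
Proof.
rewrite /gt_x; have := gt_brE (mono n x) 0 0 0 (mono p u) 0.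
by rewrite !simp -!qr0 => ->.
Qed.

Lemma gt_br_kk n p u v : gt_br mu (gk n u) (gk p v) = 0.
Proof.
have := gt_brE 0 (mono n u) 0 0 (mono p v) 0.
by rewrite !simp -!qr0 => ->.
Qed.

Lemma gt_br_sx (a b : K) n x : gt_br mu (gs a b) (gt_x n x) =
  (a * n.1%:~R + b * n.2%:~R) *: gt_x n x.
Proof.
rewrite /gt_x; have := gt_brE 0 0 (s0 a b) (mono n x) 0 0.
rewrite !simp -!qr0 => ->; rewrite sx_x_0 monoZ.
by apply: pairE; rewrite /= ?scaler0.
Qed.

Lemma gt_br_sk (a b : K) n u : gt_br mu (gs a b) (gk n u) =
  (a * n.1%:~R + b * n.2%:~R) *: gk n u.
Proof.
have := gt_brE 0 0 (s0 a b) 0 (mono n u) 0.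
rewrite !simp -!qr0 => ->; rewrite sk_k_0 monoZ qprojZ.
by apply: pairE; rewrite /= ?scaler0.
Qed.

Lemma gt_br_sd (a b : K) m : gt_br mu (gs a b) (gt_d g m) =
  (a * m.1%:~R + b * m.2%:~R) *: gt_d g m.
Proof.
rewrite /gt_d; have := gt_brE 0 0 (s0 a b) 0 0 (sd m).
rewrite !simp ss_k_0l -!qr0 => ->; rewrite ss_s_0d.
by apply: pairE; rewrite /= ?scaler0//; apply: pairE; rewrite /= ?scaler0.
Qed.

Lemma gt_br_ss (a b a' b' : K) : gt_br mu (gs a b) (gs a' b') = 0.
Proof.
have := gt_brE 0 0 (s0 a b) 0 0 (s0 a' b').
by rewrite !simp ss_k_0l -!qr0 => ->; rewrite ss_s_00.
Qed.

Lemma gt_br_d0x n x : gt_br mu (gt_d0 g) (gt_x n x) = n.1%:~R *: gt_x n x.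
Proof. by rewrite gt_br_sx mul1r mul0r addr0. Qed.
Lemma gt_br_d1x n x : gt_br mu (gt_d1 g) (gt_x n x) = n.2%:~R *: gt_x n x.
Proof. by rewrite gt_br_sx mul1r mul0r add0r. Qed.
Lemma gt_br_d0k0 n : gt_br mu (gt_d0 g) (gt_k0 g n) = n.1%:~R *: gt_k0 g n.
Proof. by rewrite gt_br_sk mul1r mul0r addr0. Qed.
Lemma gt_br_d0k1 n : gt_br mu (gt_d0 g) (gt_k1 g n) = n.1%:~R *: gt_k1 g n.
Proof. by rewrite gt_br_sk mul1r mul0r addr0. Qed.
Lemma gt_br_d1k0 n : gt_br mu (gt_d1 g) (gt_k0 g n) = n.2%:~R *: gt_k0 g n.
Proof. by rewrite gt_br_sk mul1r mul0r add0r. Qed.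
Lemma gt_br_d1k1 n : gt_br mu (gt_d1 g) (gt_k1 g n) = n.2%:~R *: gt_k1 g n.
Proof. by rewrite gt_br_sk mul1r mul0r add0r. Qed.
Lemma gt_br_d0d m : gt_br mu (gt_d0 g) (gt_d g m) = m.1%:~R *: gt_d g m.
Proof. by rewrite gt_br_sd mul1r mul0r addr0. Qed.
Lemma gt_br_d1d m : gt_br mu (gt_d1 g) (gt_d g m) = m.2%:~R *: gt_d g m.
Proof. by rewrite gt_br_sd mul1r mul0r add0r. Qed.
Lemma gt_br_d0d1 : gt_br mu (gt_d0 g) (gt_d1 g) = 0.
Proof. exact: gt_br_ss. Qed.

Lemma gt_br_dx m n x : gt_br mu (gt_d g m) (gt_x n x) =
  detZ2 K m n *: gt_x (m + n) x.
Proof.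
rewrite /gt_x /gt_d; have := gt_brE 0 0 (sd m) (mono n x) 0 0.
rewrite !simp -!qr0 => ->; rewrite sx_x_d monoZ.
by apply: pairE; rewrite /= ?scaler0.
Qed.

Lemma gt_br_dk0 m n : gt_br mu (gt_d g m) (gt_k0 g n) =
  detZ2 K m n *: gt_k0 g (m + n) - m.2%:~R *: gt_km m (m + n).
Proof.
rewrite gt_kmE /gt_k0 /gt_d; have := gt_brE 0 0 (sd m) 0 (mono n (1, 0)) 0.
have E : m.1%:~R * ((1, 0) : K^o * K^o).2 - m.2%:~R * ((1, 0) : K^o * K^o).1 =
    - m.2%:~R :> K by rewrite /= mulr0 mulr1 sub0r.
rewrite !simp -!qr0 => ->; rewrite sk_k_d E scaleNr monoD (monoZ _ (detZ2 _ _ _)).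
rewrite -scaleNr monoZ qprojD !qprojZ scaleNr.
by apply: pairE; rewrite /= ?scaler0 ?subr0.
Qed.

Lemma gt_br_dk1 m n : gt_br mu (gt_d g m) (gt_k1 g n) =
  detZ2 K m n *: gt_k1 g (m + n) + m.1%:~R *: gt_km m (m + n).
Proof.
rewrite gt_kmE /gt_k1 /gt_d; have := gt_brE 0 0 (sd m) 0 (mono n (0, 1)) 0.
have E : m.1%:~R * ((0, 1) : K^o * K^o).2 - m.2%:~R * ((0, 1) : K^o * K^o).1 =
    m.1%:~R :> K by rewrite /= mulr0 mulr1 subr0.
rewrite !simp -!qr0 => ->; rewrite sk_k_d E monoD !monoZ qprojD !qprojZ.
by apply: pairE; rewrite /= ?scaler0 ?addr0.
Qed.

Lemma gt_br_dd m n : gt_br mu (gt_d g m) (gt_d g n) =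
  detZ2 K m n *: gt_d g (m + n) + (mu * detZ2 K m n ^+ 2) *: gt_km m (m + n).
Proof.
rewrite gt_kmE /gt_d; have := gt_brE 0 0 (sd m) 0 0 (sd n).
rewrite !simp => h; rewrite [LHS](_ : _ = gt_br mu (0, qproj (@kd_rel K) 0, sd m)
  ((0, qproj (@kd_rel K) 0, sd n) : gtilde g)); last by rewrite -qr0.
rewrite h ss_s_dd ss_k_dd monoZ qprojZ.
apply: pairE; rewrite /= ?scaler0 ?addr0 ?add0r//.
by apply: pairE; rewrite /= ?scaler0 ?addr0.
Qed.

Lemma gt_km_rel m : gt_km m m = 0.
Proof.
rewrite gt_kmE; apply: pairE => //=; rewrite qr0; apply/qprojP; rewrite subr0.
by rewrite -[mono _ _]scale1r; apply: lspanZ; exists m.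
Qed.

Lemma gt_d_0 : gt_d g 0 = 0.
Proof.
rewrite /gt_d; case: (dmonoP 0) => [[_ ->]//|[m' m0 _]].
by have := valP m'; rewrite m0 eqxx.
Qed.

End ToroidalTheory.

Section VirasoroAffineTheory.
Variables (K : fieldType) (g : simpleLie K).

Lemma lie0 (u v : fdot g) : fdot_br 0 v = 0 /\ fdot_br u 0 = 0.
Proof. by split; rewrite /fdot_br /= ?gbr0l ?gbr0r. Qed.

Lemma fform0 (u v : fdot g) : fdot_form 0 v = 0 /\ fdot_form u 0 = 0.
Proof. by split; rewrite /fdot_form /= ?gform0l ?gform0r ?mul0r ?mulr0 !addr0. Qed.

Let quadE (A B C D : lmodType K) (x y : (A * B * C * D)%type) :
  x.1.1.1 = y.1.1.1 -> x.1.1.2 = y.1.1.2 -> x.1.2 = y.1.2 -> x.2 = y.2 -> x = y.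
Proof. by case: x => [[[? ?] ?] ?]; case: y => [[[? ?] ?] ?] /= -> -> -> ->. Qed.

Lemma fb_br_LL m n : fb_br (fb_L g m) (fb_L g n) = (m - n)%:~R *: fb_L g (m + n)
  + ((m ^+ 3 - m)%:~R / 12%:R * (m + n == 0)%:R) *: fb_kv g.
Proof.
have z p : mono p (0 : K^o) = 0 by exact: mono0.
apply: quadE => /=.
- rewrite lext_mono; last by move=> p; rewrite lextl0// => q b; rewrite !mul0r z.
  rewrite lext_mono; last by move=> p; rewrite mulr0 mul0r z.
  by rewrite !mul1r scaler0 addr0 -monoZ /GRing.scale /= mulr1.
- rewrite lext0; last by move=> p; rewrite lextl0// => q u; rewrite (lie0 u u).1 mono0.
  do 2![rewrite lextl0; last by
    move=> p b; rewrite lext0// => q; rewrite scaler0 mono0].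
  by rewrite !scaler0 subr0 !addr0.
- by rewrite !scaler0 addr0 lext0// => p; rewrite (fform0 0 _).1 mulr0.
rewrite lext_mono; last by move=> p; rewrite !mul0r.
rewrite scaler0 add0r /GRing.scale /= mul1r mulr1 mulrC; congr (_ * _).
case: asboolP => [<-|mn]; first by rewrite subrr eqxx.
by case: eqP => // /eqP; rewrite addrC addr_eq0 => /eqP nm; case: mn.
Qed.

Lemma fb_br_xx m n (u v : fdot g) : fb_br (fb_x m u) (fb_x n v) =
  fb_x (m + n) (fdot_br u v)
  + (m%:~R * (m + n == 0)%:R * fdot_form u v) *: fb_k0 g.
Proof.
apply: quadE => /=.
- by rewrite scaler0 addr0 lext0// => p; rewrite lext0// => q; rewrite !mul0r mono0.
- rewrite lext_mono; last first.
    by move=> p; rewrite lextl0// => q w; rewrite (lie0 w w).1 mono0.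
  rewrite lext_mono; last by move=> p; rewrite (lie0 u u).2 mono0.
  do 2![rewrite lext0; last by
    move=> p; rewrite lextl0// => q w; rewrite mul0r scale0r mono0].
  by rewrite scaler0 subr0 !addr0.
- rewrite lext_mono; last by move=> p; rewrite (fform0 u (mono n v (- p))).1 mulr0.
  rewrite add0r /GRing.scale /= mulr1 -mulrA; congr (_ * _).
  case: asboolP => [<-|mn]; first by rewrite subrr eqxx mul1r.
  case: eqP => [/eqP|]; last by rewrite mul0r (fform0 u u).2.
  by rewrite addrC addr_eq0 => /eqP nm; case: mn.
by rewrite scaler0 addr0 lext0// => p; rewrite !mul0r.
Qed.

Lemma fb_br_Lx m n (u : fdot g) : fb_br (fb_L g m) (fb_x n u) =
  (- n)%:~R *: fb_x (m + n) u.
Proof.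
apply: quadE => /=.
- rewrite scaler0 lextl0// => p b; rewrite lext0// => q.
  by rewrite mulr0 mul0r mono0.
- rewrite lext0; last by move=> p; rewrite lextl0// => q w; rewrite (lie0 w w).1 mono0.
  rewrite lext_mono; last by move=> p; rewrite lextl0// => q w; rewrite mul0r scale0r mono0.
  rewrite lext_mono; last by move=> p; rewrite scaler0 mono0.
  rewrite lext0; last by move=> p; rewrite lextl0// => q w; rewrite mul0r scale0r mono0.
  by rewrite add0r subr0 mul1r monoZ.
- by rewrite scaler0 lext0// => p; rewrite (fform0 u (mono n u (- p))).1 mulr0.
by rewrite scaler0 lextl0// => p b; rewrite mulr0 mul0r.
Qed.
End VirasoroAffineTheory.

(* Main.v *)
From HB Require Import structures.
Require Import Defs.
From mathcomp Require Import all_boot all_order all_algebra.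
From mathcomp Require Import ring zify boolp classical_sets fsbigop.
From mathcomp Require Import reals.
From mathcomp Require Import complex.

(** Why the theorem holds. A root vector of the toroidal algebra for a
    non-isotropic root is [t^m x] with [x] a root vector of the finite simple
    algebra ([nonisotropic_root_space]). It acts on a tensor product by a sum of
    operators on the separate factors, and these commute, so local nilpotency
    may be checked on each factor ([tensor_nilp]). There it acts by a mode of
    [x(z) E(n, z)]. Applied to a fixed vector, such a mode is a finite sum of
    products [x(p) E_q]; the modes [x(p)] and the coefficients [E_q] of
    [E(n, z)] all commute, hence everything follows once each [x(p)] is locally
    nilpotent ([x_op_nilp_at]).

    So the heart of the matter is that an irreducible highest weight module of
    the Virasoro-affine algebra with dominant highest weight is integrable for
    the affine algebra ([real_root_nilp]). The vectors killed by some power of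
    [x(p)] form a submodule, so one nonzero vector is enough
    ([real_root_nilp_at]). For a simple root vector the highest weight vector
    will do: a negative simple root vector, applied once more than the coroot
    value, yields a singular vector, hence zero ([simple_root_nilp]). By the
    representation theory of sl2 every weight that is negative on a simple
    coroot can then be reflected ([simple_reflection]), and the usual descent to
    a dominant weight shows that no weight is longer than the highest one for
    the invariant form of the affine algebra ([weight_norm_le]). A real root
    [be + p delta] has positive length, so along it the length grows
    quadratically and the highest weight can be moved only finitely often. This
    treats all real roots at once, without the Weyl group moving them to simple
    roots.

    The length argument rests on the structure of the finite algebra: root
    decomposition, integrality of the weights on coroots, and [(al, al) > 0] for
    all roots. The last point comes from the Killing form, which is proportional
    to the given form ([killing_gform]) and positive on coroots because it is
    there a sum of squares of integers ([killing_coroot]); the normalization on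
    the highest root fixes the sign ([hform_root_gt0]).

    The weight decomposition is inherited from the factors: weight vectors span
    each of them, and pure tensors of weight vectors are weight vectors. *)

Set Implicit Arguments.
Unset Strict Implicit.
Unset Printing Implicit Defensive.

Import Order.TTheory GRing.Theory Num.Theory.

Local Open Scope ring_scope.

(** * Linear maps and subspaces given by predicates *)

Section LinearPredicates.
Variables (K : fieldType) (M N : lmodType K).

Lemma linD (f : M -> N) : linear f -> {morph f : u v / u + v}.
Proof. by move=> lf u v; have := lf 1 u v; rewrite !scale1r. Qed.

Lemma lin0 (f : M -> N) : linear f -> f 0 = 0.
Proof. by move=> lf; have := lf (-1) 0 0; rewrite addr0 !scaler0 scaleN1r addNr. Qed.

Lemma linZ (f : M -> N) a u : linear f -> f (a *: u) = a *: f u.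
Proof. by move=> lf; have := lf a u 0; rewrite addr0 lin0// addr0. Qed.

Lemma linN (f : M -> N) u : linear f -> f (- u) = - f u.
Proof. by move=> lf; rewrite -scaleN1r linZ// scaleN1r. Qed.

Lemma linB (f : M -> N) u v : linear f -> f (u - v) = f u - f v.
Proof. by move=> lf; rewrite linD// linN. Qed.

Lemma lin_sum (f : M -> N) (I : Type) (r : seq I) (P : pred I) (F : I -> M) :
  linear f -> f (\sum_(i <- r | P i) F i) = \sum_(i <- r | P i) f (F i).
Proof. by move=> lf; apply: (big_morph f (linD lf) (lin0 lf)). Qed.

Section Subspace.
Variable P : M -> Prop.
Hypothesis sP : is_subspace P.

Lemma subsp0 : P 0. Proof. by case: sP. Qed.
Lemma subspD u v : P u -> P v -> P (u + v).
Proof. by move=> hu hv; rewrite -[u]scale1r; apply: sP.2. Qed.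
Lemma subspZ a u : P u -> P (a *: u).
Proof. by move=> hu; rewrite -[_ *: _]addr0; apply: sP.2 => //; exact: subsp0. Qed.
Lemma subspN u : P u -> P (- u).
Proof. by rewrite -scaleN1r; exact: subspZ. Qed.
Lemma subspB u v : P u -> P v -> P (u - v).
Proof. by move=> hu hv; apply: subspD => //; exact: subspN. Qed.
Lemma subsp_sum (I : eqType) (r : seq I) (F : I -> M) :
  (forall i, i \in r -> P (F i)) -> P (\sum_(i <- r) F i).
Proof.
move=> PF; rewrite big_seq; apply: (big_ind P); [exact: subsp0|exact: subspD|].
exact: PF.
Qed.
End Subspace.

End LinearPredicates.

Section Endomorphisms.
Variables (K : fieldType) (M : lmodType K).

Lemma subspace_eigen (T : M -> M) (a : K) :
  linear T -> is_subspace (fun u => T u = a *: u).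
Proof.
move=> lT; split=> [|b u v hu hv]; first by rewrite lin0// scaler0.
by rewrite lT hu hv scalerDr !scalerA mulrC.
Qed.

Lemma lin_iter n (T : M -> M) : linear T -> linear (iter n T).
Proof. by move=> lT; elim: n => [|n IHn] a u v //; rewrite !iterS -lT -IHn. Qed.
End Endomorphisms.

(** On a finite dimensional space the predicate form of a subspace is a genuine
    one: take a vector space of maximal dimension among those contained in it. *)
Lemma subspace_vspace (K : fieldType) (W : vectType K) (P : W -> Prop) :
  is_subspace P -> exists U : {vspace W}, forall x, x \in U <-> P x.
Proof.
move=> sP.
pose D n := `[< exists U : {vspace W}, \dim U = n /\ forall x, x \in U -> P x >].
have D0 : exists n, D n.
  exists 0; apply/asboolP; exists 0%VS; split=> [|x]; first exact: dimv0.
  by rewrite memv0 => /eqP ->; apply: subsp0.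
have Dle n : D n -> (n <= \dim {:W})%N.
  by move=> /asboolP[U [<- _]]; apply/dimvS/subvf.
have [n /asboolP[U [Un UP]] maxn] := ex_maxnP D0 Dle.
exists U => x; split=> [/UP//|Px]; apply: contraT => xU.
have : D (\dim (U + <[x]>)).
  apply/asboolP; exists (U + <[x]>)%VS; split=> // y /memv_addP[u uU [w wx ->]].
  have /vlineP[b ->] := wx.
  by apply: subspD => //; [exact: UP|exact: subspZ].
move=> /maxn; rewrite -Un => le; have sU : (U <= U + <[x]>)%VS by exact: addvSl.
have : (U == U + <[x]>)%VS by rewrite -dimv_leqif_eq// eqn_leq le dimvS.
move=> /eqP UE; move: xU; rewrite UE => /negP[].
by apply: (subvP (addvSr _ _)); exact: memv_line.
Qed.

Lemma linear_lfun (K : fieldType) (U W : vectType K) (f : U -> W) :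
  linear f -> exists F : 'Hom(U, W), F =1 f.
Proof.
move=> lf; pose fL : {linear U -> W} := HB.pack f (GRing.isLinear.Build _ _ _ _ f lf).
by exists (linfun fL) => u; rewrite lfunE.
Qed.

Lemma lspan_subspace (K : fieldType) (V : lmodType K) (S : V -> Prop) :
  is_subspace (lspan S).
Proof.
split=> [|a u v hu hv]; first exact: lspan0.
by move=> P sP SP; apply: sP.2; [exact: hu|exact: hv].
Qed.

Lemma lspan1 (K : fieldType) (V : lmodType K) (S : V -> Prop) u : S u -> lspan S u.
Proof. by move=> Su P _; apply. Qed.

Lemma fsupp_sum (K : fieldType) (T : choiceType) (V : lmodType K) (f : fsupp T V) :
  exists r : seq T, f = \sum_(t <- r) mono t (f t).
Proof.
have [r ur fr] := fsupp_seq f; exists r; apply: val_inj; apply/funext => t /=.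
have ev : forall f1 f2 : fsupp T V, fsval (f1 + f2) t = fsval f1 t + fsval f2 t by [].
rewrite (big_morph (fun f : fsupp T V => fsval f t) (id1 := 0) (op1 := +%R))//.
have [tr|tr] := boolP (t \in r); last first.
  rewrite fr// big_seq big1// => u ur' /=; case: asboolP => // tu.
  by rewrite tu ur' in tr.
rewrite (bigD1_seq t)//= asboolT// big1 ?addr0// => u /eqP ut.
by rewrite asboolF// => tu; exact: ut.
Qed.

(** * Simultaneous eigenvectors *)

Section Eigenvectors.
Variables (K : fieldType) (M : lmodType K) (S : Type) (T : S -> M -> M).
Variables (I : eqType) (chi : I -> S -> K).
Hypothesis Tlin : forall s, linear (T s).
Hypothesis chi_inj : forall i j, (forall s, chi i s = chi j s) -> i = j.

Definition eigen (i : I) (u : M) := forall s, T s u = chi i s *: u.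

Lemma eigen_subspace i : is_subspace (eigen i).
Proof.
split=> [s|a u v hu hv s]; have [P0 PD] := subspace_eigen (chi i s) (@Tlin s).
  exact: P0.
exact: PD.
Qed.

Lemma eigen_free (r : seq I) (w : I -> M) : uniq r ->
  (forall i, i \in r -> eigen i (w i)) -> \sum_(i <- r) w i = 0 ->
  forall i, i \in r -> w i = 0.
Proof.
elim: r w => [//|i r IHr] w /= /andP[ir ur] ew sw.
have wr j : j \in r -> w j = 0.
  move=> jr; apply/eqP; apply: contraT => wj.
  suff ij : i = j by rewrite ij jr in ir.
  apply: chi_inj => s; apply/esym/eqP; rewrite -subr_eq0.
  have /eqP : (chi j s - chi i s) *: w j = 0.
    apply: (IHr (fun j => (chi j s - chi i s) *: w j)) => // [h hr|].
      by apply: (subspZ (eigen_subspace h)); apply: ew; rewrite inE hr orbT.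
    have : T s (\sum_(h <- i :: r) w h) - chi i s *: \sum_(h <- i :: r) w h = 0.
      by rewrite sw lin0// scaler0 subr0.
    rewrite lin_sum// scaler_sumr -sumrB big_cons ew ?mem_head// subrr add0r => E; rewrite -[RHS]E.
    by apply: eq_big_seq => h hr; rewrite ew ?inE ?hr ?orbT// scalerBl.
  by rewrite scaler_eq0 (negPf wj) orbF.
move=> j; rewrite inE => /orP[/eqP ->|/wr//].
by move: sw; rewrite big_cons big_seq big1 ?addr0// => h /wr.
Qed.

(** The characters in [r] are distinct, so that independence applies to a
    decomposition as it stands; [w] is made of eigenvectors off [r] as well. *)
Definition eigensum (A : I -> Prop) (u : M) := exists (r : seq I) (w : I -> M),
  [/\ uniq r, forall i, i \in r -> A i, forall i, eigen i (w i)
    & u = \sum_(i <- r) w i].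

Lemma eigensum1 (A : I -> Prop) i u : A i -> eigen i u -> eigensum A u.
Proof.
move=> Ai eu; exists [:: i], (fun j => if j == i then u else 0).
split=> // [j|j|]; first by rewrite inE => /eqP ->.
  by case: eqP => [->//|_]; exact: subsp0 (eigen_subspace _).
by rewrite big_seq1 eqxx.
Qed.

Lemma eigensum_subspace A : is_subspace (eigensum A).
Proof.
split=> [|a u v [r [w [ur rA ew ->]]] [s [z [us sA ez ->]]]].
  by exists [::], (fun=> 0); split=> // [i|]; [exact: subsp0 (eigen_subspace i)|rewrite big_nil].
pose ext (q : seq I) (y : I -> M) i := if i \in q then y i else 0.
have extE (q : seq I) y : uniq q -> {subset q <= undup (r ++ s)} ->
    \sum_(i <- undup (r ++ s)) ext q y i = \sum_(i <- q) y i.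
  move=> uq qrs; rewrite /ext -big_mkcond -big_filter; apply: perm_big.
  apply: uniq_perm => [|//|i]; first by rewrite filter_uniq ?undup_uniq.
  by rewrite mem_filter; case: (boolP (i \in q)) => // /qrs ->.
have eext q y i : (forall i, eigen i (y i)) -> eigen i (ext q y i).
  by rewrite /ext; case: ifP => // _ _; exact: subsp0 (eigen_subspace i).
exists (undup (r ++ s)), (fun i => a *: ext r w i + ext s z i).
split=> [|i|i|]; first exact: undup_uniq.
- by rewrite mem_undup mem_cat => /orP[/rA|/sA].
- by apply: (eigen_subspace i).2; exact: eext.
rewrite big_split -scaler_sumr /= !extE// => i si; rewrite mem_undup mem_cat si //.
by rewrite orbT.
Qed.

(** By independence, no other character can occur in an eigenvector. *)
Lemma eigensum_eigen A i u : eigensum A u -> eigen i u -> u <> 0 -> A i.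
Proof.
move=> [r [w [ur rA ew uE]]] eu u0; have [/rA//|ir] := boolP (i \in r).
case: u0; apply: oppr_inj; rewrite oppr0.
have := @eigen_free (i :: r) (fun j => if j == i then - u else w j).
rewrite /= ir ur big_cons eqxx; move=> /(_ isT) /= h.
have := h _ _ i (mem_head _ _); rewrite eqxx; apply.
  move=> j _; case: eqP => // ->; exact: subspN (eigen_subspace i) _ eu.
rewrite uE addrC; apply/eqP; rewrite subr_eq0; apply/eqP.
by apply: eq_big_seq => j jr; case: eqP => // ji; rewrite -ji jr in ir.
Qed.
End Eigenvectors.

(** Otherwise the [y k] would form an infinite free family. *)
Lemma eigen_sequence_eq0 (K : fieldType) (W : vectType K) (T : W -> W)
    (a : nat -> K) (y : nat -> W) : linear T -> injective a ->
  (forall k, T (y k) = a k *: y k) -> exists k, y k = 0.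
Proof.
move=> lT ainj Ty; apply: contrapT => y0.
pose n := (\dim {:W}).+1; pose X := mktuple (fun i : 'I_n => y i).
pose ch (i : 'I_n) (_ : unit) := a i.
have ch_inj i j : (forall s, ch i s = ch j s) -> i = j.
  by move=> /(_ tt)/ainj/val_inj.
have lT1 (_ : unit) : linear T by [].
have : free X.
  apply/freeP => c c0 i; have := @eigen_free _ _ _ _ _ ch lT1 ch_inj (index_enum _)
    (fun i => c i *: y i) (index_enum_uniq _) _ _ i (mem_index_enum i).
  move=> h; have /eqP : c i *: y i = 0.
    apply: h => [j _ s|]; first by rewrite (linZ _ _ lT) Ty !scalerA mulrC.
    by rewrite -[RHS]c0; apply: eq_bigr => j _; rewrite (nth_mktuple _ _ j).
  rewrite scaler_eq0 => /orP[/eqP//|/eqP yi].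
  by case: y0; exists i.
rewrite /free size_tuple => /eqP dX.
by have := dimvS (subvf <<X>>); rewrite dX ltnn.
Qed.

(** * Strings of sl2-type operators *)

Section Strings.
Variables (K : numFieldType) (M : lmodType K) (e f h : M -> M) (s : K).
Hypotheses (elin : linear e) (flin : linear f).
Hypothesis ef : forall u, e (f u) = f (e u) + h u.
Hypothesis hf : forall u, h (f u) = f (h u) - s *: f u.

Lemma iter_f_weight m u j : h u = m *: u ->
  h (iter j f u) = (m - j%:R * s) *: iter j f u.
Proof.
move=> hu; elim: j => [|j IHj]; first by rewrite mul0r subr0.
rewrite iterS hf IHj linZ// -scalerBl; congr (_ *: _).
by rewrite -natr1; ring.
Qed.

(** The scalar [s] is arbitrary, so that Heisenberg triples ([s = 0]) are covered as well
    as sl2-triples ([s = 2]). *)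
Lemma string_ef m u j : h u = m *: u -> e (iter j.+1 f u) =
  iter j.+1 f (e u) + (j.+1%:R * (m - j%:R * s / 2%:R)) *: iter j f u.
Proof.
move=> hu; elim: j => [|j IHj].
  by rewrite /= ef hu; congr (_ + _ *: _); rewrite !mul0r subr0 mul1r.
rewrite [iter j.+2 f u]iterS ef IHj linD// linZ// (iter_f_weight _ hu) -addrA.
congr (_ + _); set w := iter j.+1 f u; rewrite -[f _]/w.
rewrite -scalerDl; congr (_ *: _).
by rewrite -!natr1; field.
Qed.

Lemma string_top m u N : h u = m *: u -> e u = 0 -> u <> 0 -> iter N f u = 0 ->
  exists j : nat, m = j%:R * s / 2%:R.
Proof.
move=> hu eu u0; elim: N => [//|j IHj fj].
have [/IHj//|fj0] := pselect (iter j f u = 0).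
have := string_ef j hu; rewrite fj eu lin0// (lin0 (lin_iter _ flin)) add0r.
move=> /esym/eqP; rewrite scaler_eq0 mulf_eq0 pnatr_eq0 /=.
case/orP => [|/eqP//]; rewrite subr_eq0 => /eqP ->.
by exists j.
Qed.

Section Eigenvalues.
Hypothesis he : forall u, h (e u) = e (h u) + s *: e u.

Lemma iter_e_weight m u j : h u = m *: u ->
  h (iter j e u) = (m + j%:R * s) *: iter j e u.
Proof.
move=> hu; elim: j => [|j IHj]; first by rewrite mul0r addr0.
rewrite iterS he IHj (linZ _ _ elin) -scalerDl; congr (_ *: _).
by rewrite -natr1; ring.
Qed.

(** The vector at the top of the [e]-string of [u] has eigenvalue [m + k s], and
    the length [j] of the [f]-string below it determines that eigenvalue. *)
Lemma string_eigenvalue m u : h u = m *: u -> u <> 0 ->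
  (exists N, iter N e u = 0) -> (forall v, exists N, iter N f v = 0) ->
  exists j k : nat, m + k%:R * s = j%:R * s / 2%:R.
Proof.
move=> hu u0 eN fN.
have [k [ek0 ek]] : exists k, iter k e u <> 0 /\ iter k.+1 e u = 0.
  case: eN; elim=> [//|N IHN eN].
  by have [/IHN//|eN0] := pselect (iter N e u = 0); exists N.
have [N fNk] := fN (iter k e u).
by have [j jE] := string_top (iter_e_weight k hu) ek ek0 fNk; exists j, k.
Qed.

(** In a representation of sl2 with [e] locally nilpotent, [f ^ m] is injective
    on the vectors of weight [m]: applying [e] raises the weight by [2], and
    [f ^ m u = 0] gives [f ^ (m + 2) (e u) = 0], so induction on the exponent
    killing [u] reduces to [e u = 0], where strings are explicit. *)
Lemma string_injective (m k : nat) u : s = 2%:R -> h u = m%:R *: u ->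
  iter k e u = 0 -> iter m f u = 0 -> u = 0.
Proof.
move=> s2; elim: k m u => [//|k IHk] m u hu ek fm.
have fme : iter m.+1 f (e u) = 0.
  have := string_ef m hu; rewrite iterS fm (lin0 flin) (lin0 elin) => /esym.
  by rewrite scaler0 addr0.
have eu : e u = 0.
  apply: (IHk m.+2); last by rewrite iterS fme lin0.
    by rewrite he hu (linZ _ _ elin) -scalerDl s2 -natrD addn2.
  by rewrite -iterSr.
have fj j : (j <= m)%N -> iter (m - j) f u = 0.
  elim: j => [_|j IHj jm]; first by rewrite subn0.
  have dE : (m - j)%N = (m - j.+1).+1 by lia.
  have := string_ef (m - j.+1) hu; rewrite -dE IHj ?(ltnW jm)// (lin0 elin).
  rewrite eu (lin0 (lin_iter _ flin)) add0r dE => /esym/eqP.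
  rewrite scaler_eq0 mulf_eq0 pnatr_eq0 /= subr_eq0.
  case/orP=> [|/eqP//]; rewrite s2 mulfK ?pnatr_eq0// eqr_nat => /eqP mE.
  by lia.
by have := fj m (leqnn m); rewrite subnn.
Qed.
End Eigenvalues.
End Strings.

(** * Vectors killed by a power of an operator *)

Section LocalNilpotency.
Variables (K : fieldType) (M : lmodType K).

Definition nilp_at (T : M -> M) (u : M) := exists N, iter N T u = 0.

Lemma iter_eq0_le (T : M -> M) u m n : linear T -> (m <= n)%N ->
  iter m T u = 0 -> iter n T u = 0.
Proof.
by move=> lT /subnK <- Tm; rewrite iterD Tm (lin0 (lin_iter _ lT)).
Qed.

Lemma nilp_at_subspace T : linear T -> is_subspace (nilp_at T).
Proof.
move=> lT; split=> [|a u v [m um] [n vn]]; first by exists 0.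
exists (maxn m n); rewrite (lin_iter _ lT) !(@iter_eq0_le T _ _ (maxn m n) lT _ um).
  by rewrite (iter_eq0_le lT _ vn) ?leq_maxr// scaler0 addr0.
by rewrite leq_maxl.
Qed.

Lemma nilp_at_step T u : nilp_at T (T u) -> nilp_at T u.
Proof. by case=> N TN; exists N.+1; rewrite iterSr. Qed.

(** By induction on the exponent: in [T (S u) = S (T u) + S1 u] the vector [T u]
    needs one power of [T] less than [u]. *)
Lemma nilp_at_commutator (T S S1 : M -> M) : linear T -> linear S ->
  (forall u, T (S u) = S (T u) + S1 u) ->
  (forall u, nilp_at T u -> nilp_at T (S1 u)) ->
  forall u, nilp_at T u -> nilp_at T (S u).
Proof.
move=> lT lS TS hS1 u [N]; elim: N u => [|N IHN] u TN.
  by exists 0; rewrite /= in TN *; rewrite TN lin0.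
apply: nilp_at_step; rewrite TS; apply: (subspD (nilp_at_subspace lT)).
  by apply: IHN; rewrite -iterSr.
by apply: hS1; exists N.+1.
Qed.
End LocalNilpotency.

(** * The root decomposition *)

Section RootDecomposition.
Variables (K : numClosedFieldType) (g : simpleLie K).
Local Notation hd := 'Hom(hdot g, K^o).
Implicit Types (x y z : g) (t : hdot g) (al be : hd).

Lemma gbr_linl y : linear (gbr^~ y : g -> g).
Proof. exact: lie_linl (gbr_lie g) y. Qed.

Lemma gbr_linr x : linear (gbr x).
Proof. exact: lie_linr (gbr_lie g) x. Qed.

Lemma gbrC x y : gbr x y = - gbr y x.
Proof.
apply/eqP; rewrite -addr_eq0; apply/eqP.
have := lie_alt (gbr_lie g) (x + y).
rewrite (linD (gbr_linl _)) /= !(linD (gbr_linr _)) !(lie_alt (gbr_lie g)).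
by rewrite add0r addr0.
Qed.

Lemma gbrA x y z : gbr x (gbr y z) = gbr (gbr x y) z + gbr y (gbr x z).
Proof.
have := lie_jacobi (gbr_lie g) x y z.
rewrite [gbr z (gbr x y)]gbrC [gbr z x]gbrC (linN _ (gbr_linr y)).
by move=> /eqP; rewrite -addrA addr_eq0 opprD !opprK addrC => /eqP.
Qed.

Lemma hdot_comm t (u : hdot g) : gbr (vsval t) (vsval u) = 0.
Proof. by case: (gcartanP g) => hh _ _; apply: hh; exact: subvsP. Qed.

Local Notation adh := (fun t : hdot g => gbr (vsval t)).
Local Notation rch := (fun (al : hd) (t : hdot g) => al t : K).

Lemma adh_linear t : linear (gbr (vsval t)). Proof. exact: gbr_linr. Qed.

Lemma root_space_subspace al : is_subspace (root_space gbr al).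
Proof. exact: (@eigen_subspace _ _ _ _ _ rch adh_linear al). Qed.

(** Commuting diagonalizable operators are diagonalizable together: the
    components of an eigenvector of [d'] under the decomposition for [d] are
    again eigenvectors of [d'], by independence. *)
Lemma diag_span (s : seq g) : {subset s <= gcartan g} -> forall x,
  lspan (fun u => forall d, d \in s -> exists a : K, gbr d u = a *: u) x.
Proof.
elim: s => [_ x|d s IHs ds x]; first by apply: lspan1.
have sh : {subset s <= gcartan g} by move=> u us; apply: ds; rewrite inE us orbT.
apply: (IHs sh x); first exact: lspan_subspace.
move=> u us; have dh : d \in gcartan g by apply: ds; rewrite mem_head.
have ld (_ : unit) : linear (gbr d) by exact: gbr_linr.
pose ch (a : K) (_ : unit) := a.
have ch_inj a b : (forall s, ch a s = ch b s) -> a = b by move/(_ tt).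
have [r [w [ur _ ew uE]]] : eigensum (fun _ : unit => gbr d) ch (fun=> True) u.
  have [_ _ /(_ d dh)[X Xb Xe]] := gcartanP g.
  have : u \in <<in_tuple X>>%VS by rewrite (span_basis Xb) memvf.
  move=> /coord_span ->; apply: (subsp_sum (eigensum_subspace ch ld _)) => i _.
  apply: (subspZ (eigensum_subspace ch ld _)).
  have [a aE] := Xe _ (mem_nth 0 (ltn_ord i)).
  by apply: (eigensum1 ld (i := a)).
rewrite uE; apply: (subsp_sum (lspan_subspace _)) => a ar; apply: lspan1 => d'.
rewrite inE => /orP[/eqP ->|d's]; first by exists a; exact: ew a tt.
have [b bE] := us d' d's; exists b; apply/eqP; rewrite -subr_eq0; apply/eqP.
apply: (@eigen_free _ _ _ _ _ ch ld ch_inj r (fun a => gbr d' (w a) - b *: w a)) => //.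
  move=> c _; apply: (subspB (eigen_subspace ch ld c)); last first.
    by apply: (subspZ (eigen_subspace ch ld c)); exact: ew.
  move=> []; rewrite gbrA (ew c tt) (linZ _ _ (gbr_linr _)).
  have [hh _ _] := gcartanP g.
  by rewrite (hh d d')// ?gbr0l ?add0r//; exact: sh.
rewrite sumrB -scaler_sumr -uE -bE uE (lin_sum _ _ _ (gbr_linr d')).
exact: subrr.
Qed.

Lemma root_sum x : eigensum adh rch (fun=> True) x.
Proof.
have sE := eigensum_subspace rch adh_linear (fun=> True).
have bh : {subset vbasis (gcartan g) <= gcartan g} by move=> v /vbasis_mem.
apply: (diag_span bh x) => // u ub.
have [->|u0] := pselect (u = 0); first exact: subsp0 sE.
have sQ : is_subspace (fun d => exists a : K, gbr d u = a *: u).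
  split=> [|a d d' [b bE] [c cE]]; first by exists 0; rewrite gbr0l scale0r.
  by exists (a * b + c); rewrite gbr_linl /= bE cE scalerDl scalerA.
have hu t : exists a : K, gbr (vsval t) u = a *: u.
  rewrite (coord_vbasis (subvsP t)); apply: (subsp_sum sQ) => i _.
  by apply: (subspZ sQ); apply: ub; apply: mem_nth; rewrite size_tuple.
have [c cE] := choice hu.
have clin : linear (c : hdot g -> K^o).
  move=> a s t; apply/eqP; rewrite -subr_eq0; apply/eqP.
  have /eqP : (c (a *: s + t) - (a *: (c s : K^o) + c t)) *: u = 0.
    rewrite scalerBl -cE linearP gbr_linl /= !cE scalerDl scalerA.
    by rewrite subrr.
  by rewrite scaler_eq0 => /orP[/eqP//|/eqP].
have [al alE] := linear_lfun clin.
by apply: (eigensum1 adh_linear (i := al)) => // t; rewrite cE alE.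
Qed.

(** The value [al = 0] is allowed: it covers the Cartan subalgebra. *)
Lemma root_ind (P : g -> Prop) : is_subspace P ->
  (forall al x, root_space gbr al x -> P x) -> forall x, P x.
Proof.
move=> sP hP x; have [r [w [_ _ ew ->]]] := root_sum x.
by apply: (subsp_sum sP) => al _; exact: hP (ew al).
Qed.

Lemma root_space_br al be x y : root_space gbr al x -> root_space gbr be y ->
  root_space gbr (al + be) (gbr x y).
Proof.
move=> hx hy t; rewrite gbrA hx hy (linZ _ _ (gbr_linr _)).
by rewrite (linZ _ _ (gbr_linl _)) -scalerDl add_lfunE.
Qed.

Lemma root_space0 x : root_space gbr (0 : hd) x -> exists t, x = vsval t.
Proof.
move=> hx; have [_ mh _] := gcartanP g.
suff /mh xh : {in gcartan g, forall y, gbr y x = 0}.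
  by exists (vsproj (gcartan g) x); rewrite vsprojK.
move=> y yh; have := hx (vsproj (gcartan g) y).
by rewrite vsprojK// zero_lfunE scale0r.
Qed.

Lemma hdot_root_space t : root_space gbr (0 : hd) (vsval t).
Proof. by move=> u; rewrite hdot_comm zero_lfunE scale0r. Qed.

Lemma simple_ideal (P : g -> Prop) : is_subspace P ->
  (forall x y, P y -> P (gbr x y)) -> (forall x, P x -> x = 0) \/ forall x, P x.
Proof.
move=> sP iP; have [U UP] := subspace_vspace sP.
case: (gbr_simple g) => _ /(_ U)[x y /UP yP|U0|U1]; first by apply/UP/iP.
  by left=> x /UP; rewrite U0 memv0 => /eqP.
by right=> x; apply/UP; rewrite U1 memvf.
Qed.

Lemma gbr_center x : (forall y, gbr x y = 0) -> x = 0.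
Proof.
pose P (x : g) := forall y, gbr x y = 0.
have sP : is_subspace P.
  split=> [y|a u v hu hv y]; first by rewrite gbr0l.
  by rewrite gbr_linl /= hu hv scaler0 addr0.
case: (@simple_ideal P) => // [u v hv y|h|h]; last 2 first.
- exact: h.
- by case: (gbr_simple g) => [[u [v /eqP uv]] _]; case: uv; exact: (h u v).
by rewrite [gbr u v]gbrC hv oppr0 gbr0l.
Qed.

(** ** The invariant form *)

Lemma gformC x y : gform x y = gform y x.
Proof. by case: (gformP g). Qed.

Lemma gform_linr x : linear (gform x : g -> K^o).
Proof. by case: (gformP g) => lf _ _ _ a y z; rewrite lf. Qed.

Lemma gform_linl y : linear (gform^~ y : g -> K^o).
Proof. by move=> a x z; rewrite /= !(gformC _ y) gform_linr. Qed.

Lemma gformZr a x y : gform x (a *: y) = a * gform x y.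
Proof. exact: linZ _ _ (gform_linr x). Qed.
Lemma gformZl a x y : gform (a *: x) y = a * gform x y.
Proof. exact: linZ _ _ (gform_linl y). Qed.
Lemma gformNl x y : gform (- x) y = - gform x y.
Proof. exact: linN _ (gform_linl y). Qed.
Lemma gformNr x y : gform x (- y) = - gform x y.
Proof. exact: linN _ (gform_linr x). Qed.

Lemma gform_inv x y z : gform (gbr x y) z = gform x (gbr y z).
Proof. by case: (gformP g). Qed.

Lemma gform_nondeg x : (forall y, gform x y = 0) -> x = 0.
Proof.
pose P (x : g) := forall y, gform x y = 0.
have sP : is_subspace P.
  split=> [y|a u v hu hv y]; first by rewrite gform0l.
  by rewrite (gform_linl y) /= hu hv scaler0 addr0.
case: (@simple_ideal P) => // [u v hv y|h|h]; last 2 first.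
- exact: h.
- case: (gformP g) => _ _ _ [t _ tt]; have := h (vsval t) (vsval t).
  by rewrite tt => /eqP; rewrite pnatr_eq0.
by rewrite gbrC gformNl gform_inv hv oppr0.
Qed.

Lemma gform_root al be x y : root_space gbr al x -> root_space gbr be y ->
  gform x y <> 0 -> be = - al.
Proof.
move=> hx hy xy; apply/lfunP => t; rewrite opp_lfunE; apply/eqP.
rewrite -addr_eq0; apply/eqP; have := gform_inv x (vsval t) y.
rewrite hy gbrC hx gformNl gformZl gformZr => /eqP.
rewrite -subr_eq0 -mulNr -mulrBl mulf_eq0 => /orP[|/eqP//].
by rewrite -opprD oppr_eq0 addrC => /eqP.
Qed.

Lemma gform_pair al x : root_space gbr al x -> x <> 0 ->
  exists2 y, root_space gbr (- al) y & gform x y = 1.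
Proof.
move=> hx x0.
have [[y xy]|h] := pselect (exists y, root_space gbr (- al) y /\ gform x y <> 0).
  case: xy => hy /eqP xy; exists ((gform x y)^-1 *: y).
    exact: subspZ (root_space_subspace _) _ _ hy.
  by rewrite gformZr mulVf.
case: x0; apply: gform_nondeg; apply: root_ind.
  split=> [|a u v hu hv]; first by rewrite gform0r.
  by rewrite gform_linr hu hv scaler0 addr0.
move=> be y hy; have [//|xy] := pselect (gform x y = 0).
by case: h; exists y; split=> //; rewrite -(gform_root hx hy xy).
Qed.

Lemma hdot_nondeg t : (forall u : hdot g, gform (vsval t) (vsval u) = 0) -> t = 0.
Proof.
move=> h; apply: (can_inj (@vsvalK _ _ _)); rewrite linear0; apply: gform_nondeg.
apply: root_ind.
  split=> [|a u v hu hv]; first by rewrite gform0r.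
  by rewrite gform_linr hu hv scaler0 addr0.
move=> be y hy; have [//|ty] := pselect (gform (vsval t) y = 0).
have be0 := gform_root (hdot_root_space t) hy ty; rewrite oppr0 in be0.
by rewrite be0 in hy; have [u ->] := root_space0 hy.
Qed.

(** The bracket of opposite root spaces is one-dimensional: by invariance it is
    the form times the element of the Cartan subalgebra dual to the root. *)
Lemma opposite_br al x y : root_space gbr al x -> root_space gbr (- al) y ->
  exists t, gbr x y = vsval t /\
    forall u, gform (vsval t) (vsval u) = gform x y * al u.
Proof.
move=> hx hy; have := root_space_br hx hy; rewrite subrr => /root_space0[t tE].
exists t; split=> // u; rewrite -tE gform_inv gbrC hy.
by rewrite gformNr gformZr opp_lfunE mulNr opprK mulrC.
Qed.
End RootDecomposition.

(** * Coroots, integrality and the positivity of the form on roots *)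

Section RootStrings.
Variables (K : numClosedFieldType) (g : simpleLie K).
Local Notation hd := 'Hom(hdot g, K^o).
Local Notation isroot al := (lroot (@gbr _ g) al).
Implicit Types (x y z : g) (t u : hdot g) (al be : hd).

Lemma root_space_iter al be x y k : root_space gbr al x -> root_space gbr be y ->
  root_space gbr (be + al *+ k) (iter k (gbr x) y).
Proof.
move=> hx hy; elim: k => [|k IHk]; first by rewrite mulr0n addr0.
by rewrite iterS mulrS addrCA; exact: root_space_br.
Qed.

Lemma root_neq0 al : al <> 0 -> exists t, al t <> 0 :> K.
Proof.
move=> al0; apply: contrapT => h; apply: al0; apply/lfunP => t.
by rewrite zero_lfunE; apply: contrapT => alt; apply: h; exists t.
Qed.

Lemma lfun_natE al t k : (al *+ k) t = k%:R * (al t : K).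
Proof.
by elim: k => [|k IHk]; rewrite ?mulr0n ?zero_lfunE ?mul0r// mulrS add_lfunE IHk mulrS mulrDl mul1r.
Qed.

(** Bracketing with [x] shifts the eigenvalues of the Cartan subalgebra by [al],
    and there are finitely many of them. *)
Lemma gbr_nilp al x y : al <> 0 -> root_space gbr al x -> nilp_at (gbr x) y.
Proof.
move=> al0 hx; move: y; apply: root_ind.
  exact: nilp_at_subspace (gbr_linr x).
move=> be y hy; have [t alt] := root_neq0 al0.
apply: (@eigen_sequence_eq0 _ _ (gbr (vsval t)) (fun k => be t + k%:R * al t)).
- exact: gbr_linr.
- move=> i j /addrI /eqP; rewrite -subr_eq0 -mulrBl mulf_eq0 => /orP[|/eqP//].
  by rewrite subr_eq0 eqr_nat => /eqP.
move=> k; rewrite -lfun_natE; have := root_space_iter k hx hy t.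
by rewrite add_lfunE.
Qed.

Lemma root_opp al : isroot al -> isroot (- al).
Proof.
case=> al0 [x /eqP x0 hx]; split; first by rewrite oppr_eq0.
have [y hy xy] := gform_pair hx x0; exists y => //; apply/eqP => y0.
by move: xy; rewrite y0 gform0r => /eqP; rewrite eq_sym oner_eq0.
Qed.

Lemma root_dual al : isroot al -> exists x y t,
  [/\ root_space gbr al x, root_space gbr (- al) y, gform x y = 1,
      gbr x y = vsval t & forall u, gform (vsval t) (vsval u) = al u].
Proof.
case=> al0 [x /eqP x0 hx]; have [y hy xy] := gform_pair hx x0.
have [t [tE tu]] := opposite_br hx hy; exists x, y, t; split=> // u.
by rewrite tu xy mul1r.
Qed.

Lemma dual_exists al : exists t, forall u, gform (vsval t) (vsval u) = al u.
Proof.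
have sP : is_subspace (fun al : hd =>
    exists t, forall u, gform (vsval t) (vsval u) = al u).
  split=> [|a be ga [t tE] [s sE]].
    by exists 0 => u; rewrite zero_lfunE linear0 gform0l.
  exists (a *: t + s) => u; rewrite linearP (gform_linl (vsval u)) /=.
  by rewrite tE sE add_lfunE scale_lfunE.
have [Bb Br _] := gbaseP g.
have /coord_span -> : al \in <<in_tuple (gbase g)>>%VS by rewrite (span_basis Bb) memvf.
apply: (subsp_sum sP) => i _; apply: (subspZ sP).
have /root_dual[x [y [t [_ _ _ _ tE]]]] := Br _ (mem_nth 0 (ltn_ord i)).
by exists t.
Qed.

(** The element of the Cartan subalgebra identified with [al] by the form. *)
Definition dual al : hdot g := sval (cid (dual_exists al)).

Lemma dualE al u : gform (vsval (dual al)) (vsval u) = al u.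
Proof. exact: svalP (cid (dual_exists al)) u. Qed.

Lemma dual_uniq al t : (forall u, gform (vsval t) (vsval u) = al u) -> t = dual al.
Proof.
move=> tE; apply/eqP; rewrite -subr_eq0; apply/eqP; apply: hdot_nondeg => u.
by rewrite linearB (linB _ _ (gform_linl (vsval u))) /= tE dualE subrr.
Qed.

(** The form induced on the dual of the Cartan subalgebra. *)
Definition hform al be : K := be (dual al).

Lemma hformC al be : hform al be = hform be al.
Proof. by rewrite /hform -!dualE gformC. Qed.

Lemma hform_linr al : linear (hform al : hd -> K^o).
Proof. by move=> a be ga; rewrite /hform add_lfunE scale_lfunE. Qed.

Lemma hform_linl be : linear (hform^~ be : hd -> K^o).
Proof. by move=> a al ga; rewrite /= !(hformC _ be) hform_linr. Qed.

Lemma hformDr al be ga : hform al (be + ga) = hform al be + hform al ga.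
Proof. exact: linD (hform_linr al) be ga. Qed.
Lemma hformDl al be ga : hform (be + ga) al = hform be al + hform ga al.
Proof. exact: linD (hform_linl al) be ga. Qed.
Lemma hformZr a al be : hform al (a *: be) = a * hform al be.
Proof. exact: linZ _ _ (hform_linr al). Qed.
Lemma hformZl a al be : hform (a *: al) be = a * hform al be.
Proof. exact: linZ _ _ (hform_linl be). Qed.

(** If [(al, al) = 0], then [x], [y] and the dual of [al] span a Heisenberg
    algebra whose first two elements act nilpotently; so its central element has
    no nonzero eigenvalue, and being diagonalizable it is central in the whole
    algebra, hence zero. *)
Lemma hform_root_neq0 al : isroot al -> hform al al <> 0.
Proof.
move=> ral; have [/eqP al0 _] := ral.
have [x [y [t [hx hy _ xy tE]]]] := root_dual ral.
rewrite /hform -(dual_uniq tE) => alt0; apply: (al0); apply/lfunP => u.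
rewrite zero_lfunE -tE (_ : vsval t = 0) ?gform0l//.
apply: gbr_center; apply: root_ind.
  split=> [|a v w hv hw]; first by rewrite gbr0r.
  by rewrite gbr_linr hv hw scaler0 addr0.
move=> be z hz; have [->|z0] := pselect (z = 0); first by rewrite gbr0r.
have xef v : gbr x (gbr y v) = gbr y (gbr x v) + gbr (vsval t) v.
  by rewrite gbrA xy addrC.
have xhf v : gbr (vsval t) (gbr y v) = gbr y (gbr (vsval t) v) - 0 *: gbr y v.
  by rewrite gbrA hy opp_lfunE alt0 oppr0 !scale0r gbr0l add0r subr0.
have xhe v : gbr (vsval t) (gbr x v) = gbr x (gbr (vsval t) v) + 0 *: gbr x v.
  by rewrite gbrA hx alt0 !scale0r gbr0l add0r addr0.
have alN0 : - al <> 0 by apply/eqP; rewrite oppr_eq0; apply/eqP.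
have [j [k]] := string_eigenvalue (gbr_linr x) (gbr_linr y) xef xhf
  xhe (hz t) z0 (gbr_nilp z al0 hx) (fun v => gbr_nilp v alN0 hy).
by rewrite hz !mulr0 mul0r addr0 => ->; rewrite scale0r.
Qed.

Definition coroot_of al : hdot g := (2%:R / hform al al) *: dual al.

Lemma coroot_ofE al be : be (coroot_of al) = 2%:R * hform al be / hform al al :> K.
Proof. by rewrite /coroot_of linearZ /= /hform mulrAC. Qed.

Lemma coroot_of_root al : isroot al -> al (coroot_of al) = 2%:R :> K.
Proof. by move=> /hform_root_neq0/eqP r; rewrite coroot_ofE mulfK. Qed.

Lemma sl2_triple al : isroot al -> exists x y,
  [/\ root_space gbr al x, root_space gbr (- al) y,
      gform x y = 2%:R / hform al al & gbr x y = vsval (coroot_of al)].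
Proof.
move=> ral; have [x [y [t [hx hy fxy xy tE]]]] := root_dual ral.
exists x, ((2%:R / hform al al) *: y); split=> //.
- exact: subspZ (root_space_subspace _) _ _ hy.
- by rewrite gformZr fxy mulr1.
by rewrite (linZ _ _ (gbr_linr x)) xy /coroot_of (dual_uniq tE) linearZ.
Qed.

Section Triple.
Variables (al : hd) (x y : g).
Hypotheses (ral : isroot al) (hx : root_space gbr al x).
Hypotheses (hy : root_space gbr (- al) y) (xy : gbr x y = vsval (coroot_of al)).
Local Notation h := (vsval (coroot_of al)).

Lemma triple_ef z : gbr x (gbr y z) = gbr y (gbr x z) + gbr h z.
Proof. by rewrite gbrA xy addrC. Qed.

Lemma triple_hf z : gbr h (gbr y z) = gbr y (gbr h z) - 2%:R *: gbr y z.
Proof.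
rewrite gbrA hy opp_lfunE coroot_of_root// (linZ _ _ (gbr_linl _)) /=.
by rewrite scaleNr addrC.
Qed.

Lemma triple_he z : gbr h (gbr x z) = gbr x (gbr h z) + 2%:R *: gbr x z.
Proof.
by rewrite gbrA hx coroot_of_root// (linZ _ _ (gbr_linl _)) /= addrC.
Qed.

Lemma triple_nilp z : nilp_at (gbr x) z /\ nilp_at (gbr y) z.
Proof.
case: ral => /eqP al0 _; split; first exact: gbr_nilp hx.
by apply: (@gbr_nilp (- al)) hy; apply/eqP; rewrite oppr_eq0; apply/eqP.
Qed.
End Triple.

(** Integrality: both root vectors of the sl2-triple are nilpotent, so its
    semisimple element has eigenvalues of the form (length of a string) minus
    twice (distance to its top). *)
Lemma coroot_eigenvalue al (a : K) z : isroot al ->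
  gbr (vsval (coroot_of al)) z = a *: z -> z <> 0 ->
  exists j k : nat, a = j%:R - k%:R * 2%:R.
Proof.
move=> ral hz z0; have [x [y [hx hy _ xy]]] := sl2_triple ral.
have [j [k jk]] := string_eigenvalue (gbr_linr x) (gbr_linr y)
  (triple_ef xy) (triple_hf ral hy) (triple_he ral hx) hz z0
  (proj1 (triple_nilp ral hx hy z)) (fun v => proj2 (triple_nilp ral hx hy v)).
by exists j, k; rewrite mulfK ?pnatr_eq0// in jk; rewrite -jk addrK.
Qed.

(** No proper multiple of a root is a root: a vector of [g_(k al)] has weight
    [2 k] for the triple of [al], so [y ^ (2 k)] does not kill it; but [y ^ k]
    sends it to the Cartan subalgebra, and two more factors [y] give [0]. *)
Lemma root_reduced al z k : isroot al -> root_space gbr (al *+ k) z -> (1 < k)%N ->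
  z = 0.
Proof.
move=> ral hz k1; have [x [y [hx hy _ xy]]] := sl2_triple ral.
have [N Nz] := proj1 (triple_nilp ral hx hy z).
apply: (string_injective (gbr_linr x) (gbr_linr y)
  (triple_ef xy) (triple_hf ral hy) (triple_he ral hx) (m := k.*2) erefl _ Nz).
  by rewrite hz lfun_natE coroot_of_root// -natrM muln2.
have := root_space_iter k hy hz; rewrite mulNrn subrr => /root_space0[t tE].
apply: (@iter_eq0_le _ _ _ _ k.+2 _ (gbr_linr y)); first by lia.
rewrite !iterS tE [gbr y (vsval t)]gbrC hy -scalerN (linZ _ _ (gbr_linr y)) (linN _ (gbr_linr y)).
by rewrite (lie_alt (gbr_lie g)) oppr0 scaler0.
Qed.
End RootStrings.

Import VectorInternalTheory.

Section KillingForm.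
Variables (K : numClosedFieldType) (g : simpleLie K).
Local Notation hd := 'Hom(hdot g, K^o).
Local Notation isroot al := (lroot (@gbr _ g) al).
Local Notation n := (dim g).
Implicit Types (x y z : g) (t u : hdot g) (al be : hd).

(** Matrices act on row vectors from the right, so products are reversed. *)
Definition adm x : 'M[K]_n := lin1_mx (fun v : 'rV_n => v2r (gbr x (r2v v))).

Lemma admE x (u : g) : v2r (gbr x u) = v2r u *m adm x.
Proof.
have lf : linear (fun v : 'rV[K]_n => v2r (gbr x (r2v v))).
  by move=> a v w; rewrite linearP gbr_linr linearP.
pose F : {linear 'rV[K]_n -> 'rV[K]_n} :=
  HB.pack (fun v : 'rV[K]_n => v2r (gbr x (r2v v)))
  (GRing.isLinear.Build _ _ _ _ _ lf).
by have /= := mul_rV_lin1 F (v2r u); rewrite /adm /= v2rK => ->.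
Qed.

Lemma adm_ext (A B : 'M[K]_n) : (forall u : g, v2r u *m A = v2r u *m B) -> A = B.
Proof.
by move=> AB; apply/row_matrixP => i; rewrite !rowE -[delta_mx _ _]r2vK AB.
Qed.

Lemma adm_linear : linear adm.
Proof.
move=> a x y; apply: adm_ext => u.
by rewrite mulmxDr -scalemxAr -!admE gbr_linl /= linearP.
Qed.

Lemma adm_br x y : adm (gbr x y) = adm y *m adm x - adm x *m adm y.
Proof.
apply: adm_ext => u; rewrite mulmxBr !mulmxA -!admE -linearB /=.
by congr v2r; rewrite gbrA addrK.
Qed.

Definition killing x y : K := \tr (adm x *m adm y).

Lemma killing_linl y : linear (killing^~ y : g -> K^o).
Proof.
by move=> a x z; rewrite /= /killing adm_linear mulmxDl -scalemxAl mxtraceD mxtraceZ.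
Qed.

Lemma killing_inv x y z : killing (gbr x y) z = killing x (gbr y z).
Proof.
rewrite /killing !adm_br mulmxBl mulmxBr !raddfB /= !mulmxA; congr (_ - _).
by rewrite -[in LHS]mulmxA mxtrace_mulC.
Qed.

(** The Killing form and the given form have Gram matrices of which the second
    is invertible, so they agree up to a scalar on some nonzero vector; the
    vectors on which they do form an ideal. *)
Lemma killing_gform : exists C : K, forall x y, killing x y = C * gform x y.
Proof.
pose e (i : 'I_n) : g := r2v (delta_mx 0 i).
pose F : 'M[K]_n := \matrix_(i, j) gform (e i) (e j).
pose Q : 'M[K]_n := \matrix_(i, j) killing (e i) (e j).
have eE (x : g) : x = \sum_i v2r x 0 i *: e i.
  apply: (can_inj v2rK); rewrite linear_sum [LHS]row_sum_delta.
  by apply: eq_bigr => i _; rewrite linearZ /= r2vK.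
have gramE (b : g -> g -> K) (lb : forall y, linear (b^~ y : g -> K^o)) x j :
    (v2r x *m \matrix_(i, j) b (e i) (e j)) 0 j = b x (e j).
  rewrite [in RHS](eE x) (lin_sum _ _ _ (lb (e j))) mxE; apply: eq_bigr => i _.
  by rewrite mxE (linZ _ _ (lb (e j))).
have eind (b b' : g -> g -> K) x : (forall x, linear (b x : g -> K^o)) ->
    (forall x, linear (b' x : g -> K^o)) ->
    (forall j, b x (e j) = b' x (e j)) -> forall y, b x y = b' x y.
  move=> lb lb' bb y; rewrite (eE y) (lin_sum _ _ _ (lb x)) (lin_sum _ _ _ (lb' x)).
  by apply: eq_bigr => j _; rewrite (linZ _ _ (lb x)) (linZ _ _ (lb' x)) bb.
have lk x : linear (killing x : g -> K^o).
  move=> a y z; rewrite /killing ![\tr (adm x *m _)]mxtrace_mulC.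
  exact: killing_linl.
have Fu : F \in unitmx.
  rewrite -row_free_unit -kermx_eq0; apply/eqP/row_matrixP => i; rewrite row0.
  rewrite -[row i _]r2vK; apply/eqP; rewrite -(linear0 v2r); apply/eqP; congr v2r.
  apply: gform_nondeg; apply: (eind _ (fun _ _ => 0)) => [x|x a y z|j].
  - exact: gform_linr.
  - by rewrite scaler0 addr0.
  rewrite -(gramE _ (@gform_linl _ g)) r2vK -row_mul mulmx_ker.
  by rewrite row0 mxE.
have n0 : (0 < n)%N.
  rewrite lt0n; apply/eqP => n0; case: (gbr_simple g) => [[x [y /eqP xy]] _].
  case: xy.
  apply: (can_inj v2rK); apply/rowP => i; have := ltn_ord i.
  by rewrite {2}n0.
have [C /eigenvalueP[v vE v0]] := eigenvalue_closed (Q *m invmx F) n0.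
exists C; pose P x := forall y, killing x y = C * gform x y.
have lC x : linear (fun y => C * gform x y : K^o).
  by move=> a y z; rewrite gform_linr mulrDr; congr (_ + _); exact: mulrCA.
have sP : is_subspace P.
  split=> [y|a x z hx hz y].
    by rewrite (lin0 (killing_linl y)) gform0l mulr0.
  rewrite (killing_linl y) /= hx hz (gform_linl y) mulrDr.
  by congr (_ + _); exact: mulrCA.
have Pv : P (r2v v).
  apply: (eind killing (fun x y => C * gform x y)) => // j.
  rewrite -(gramE _ killing_linl) -(gramE _ (@gform_linl _ g)).
  rewrite r2vK -[v *m _](mulmxKV Fu) -[v *m _ *m _]mulmxA vE.
  by rewrite -scalemxAl mxE.
case: (@simple_ideal _ g P) => // [x y hy z|/(_ _ Pv) vz].
  by rewrite gbrC (linN _ (killing_linl z)) killing_inv hy gformNl gform_inv mulrN.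
by move: v0; rewrite -[v]r2vK vz linear0 eqxx.
Qed.

Lemma killing_diag x (X : seq g) (a : g -> K) : basis_of fullv X ->
  {in X, forall y, gbr x y = a y *: y} ->
  killing x x = \sum_(y <- X) a y ^+ 2.
Proof.
move=> Xb Xe; have sX : size X = n by rewrite -[n]dimvf -(size_basis (X := in_tuple X) Xb).
pose P : 'M[K]_n := \matrix_(i < n) v2r X`_i.
pose D : 'M[K]_n := diag_mx (\row_i a X`_i).
have PA : P *m adm x = D *m P.
  apply/row_matrixP => i; rewrite !row_mul !rowK -admE Xe; last first.
    by rewrite mem_nth ?sX.
  rewrite row_diag_mx mxE -scalemxAl -rowE rowK.
  by rewrite linearZ.
have Pu : P \in unitmx.
  rewrite -row_full_unit -sub1mx; apply/row_subP => i.
  rewrite -[row i _]r2vK.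
  have : r2v (row i 1%:M) \in <<in_tuple X>>%VS by rewrite (span_basis Xb) memvf.
  move=> /coord_span ->; rewrite linear_sum /=; apply: summx_sub => j _.
  rewrite linearZ /=; apply: scalemx_sub.
  have jn : (j < n)%N by rewrite -sX.
  by rewrite (_ : v2r _ = row (Ordinal jn) P) ?row_sub// rowK.
have AE : adm x = invmx P *m D *m P by rewrite -mulmxA -PA mulKmx.
rewrite /killing AE -!mulmxA [P *m (invmx P *m _)]mulKVmx//.
rewrite mxtrace_mulC !mulmxA mulmxK// mul_diag_mx.
rewrite /mxtrace (big_nth 0) sX big_mkord; apply: eq_bigr => i _.
by rewrite !mxE eqxx mulr1n.
Qed.

Lemma highest_hform : hform (ghighest g) (ghighest g) = 2%:R.
Proof.
case: (gformP g) => _ _ _ [t tE t2].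
by rewrite /hform -(dual_uniq tE) -tE.
Qed.

Lemma highest_root_isroot : isroot (ghighest g).
Proof. by case: (ghighestP g). Qed.

(** The Killing form of a coroot is a nonzero sum of squares of integers. *)
Lemma killing_coroot al : isroot al ->
  0 < killing (vsval (coroot_of al)) (vsval (coroot_of al)).
Proof.
move=> ral; have [_ _ dd] := gcartanP g.
have [X Xb Xe] := dd _ (subvsP (coroot_of al)).
have hX y : exists b : K, y \in X -> gbr (vsval (coroot_of al)) y = b *: y.
  by have [/Xe[b bE]|] := boolP (y \in X); [exists b|exists 0].
have [a aE] := choice hX.
rewrite (killing_diag Xb aE).
have X0 y : y \in X -> y <> 0.
  move=> yX y0; have := free_not0 (X := in_tuple X) (v := y) (basis_free Xb) yX.
  by rewrite y0 eqxx.
have areal y : y \in X -> 0 <= a y ^+ 2.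
  move=> yX; have [j [k ->]] := coroot_eigenvalue ral (aE _ yX) (X0 _ yX).
  by rewrite real_exprn_even_ge0// rpredB ?rpredM ?realn.
have a2 : 0 <= \sum_(y <- X) a y ^+ 2.
  by rewrite big_seq; apply: sumr_ge0.
rewrite lt_neqAle a2 andbT eq_sym; apply/negP => /eqP s0.
have az y : y \in X -> a y = 0.
  move=> yX; apply/eqP; rewrite -sqrf_eq0; move: s0 => /eqP; rewrite big_seq.
  rewrite psumr_eq0 => [/allP/(_ _ yX)|i /areal//].
  by rewrite yX.
have [x [y [hx hy fxy xy]]] := sl2_triple ral.
have x0 : x = 0.
  have hz : gbr (vsval (coroot_of al)) x = 0.
    have : x \in <<in_tuple X>>%VS by rewrite (span_basis Xb) memvf.
    move=> /coord_span ->; rewrite (lin_sum _ _ _ (gbr_linr _)) big1// => i _.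
    have iX : X`_i \in X by exact: mem_nth.
    by rewrite (linZ _ _ (gbr_linr _)) (aE _ iX) az// scale0r scaler0.
  move: hz; rewrite hx coroot_of_root// => /eqP.
  by rewrite scaler_eq0 pnatr_eq0 => /eqP.
move: fxy; rewrite x0 gform0l => /esym/eqP; rewrite mulf_eq0 pnatr_eq0 invr_eq0.
by move=> /eqP; exact: hform_root_neq0.
Qed.

(** By the proportionality of the two forms the sign of [(al, al)] is the same
    for all roots, and it is positive for the highest root. *)
Lemma hform_root_gt0 al : isroot al -> 0 < hform al al.
Proof.
have [C CE] := killing_gform.
have h be : isroot be -> 0 < C / hform be be.
  move=> rbe; have := killing_coroot rbe; rewrite CE /coroot_of linearZ.
  rewrite gformZl gformZr dualE -/(hform be be).
  have /eqP b0 := hform_root_neq0 rbe.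
  rewrite (_ : C * _ = 4%:R * (C / hform be be)); last by field.
  by rewrite pmulr_rgt0 ?ltr0n.
have C0 : 0 < C.
  by have := h _ highest_root_isroot; rewrite highest_hform pmulr_lgt0 ?invr_gt0 ?ltr0n.
by move=> /h; rewrite pmulr_rgt0// invr_gt0.
Qed.
End KillingForm.

(** * The Virasoro-affine algebra and its generators *)

Section FbarBrackets.
Variables (K : fieldType) (g : simpleLie K).

Lemma fbar_eq (X Y : fbar g) : X.1.1.1 = Y.1.1.1 -> X.1.1.2 = Y.1.1.2 ->
  X.1.2 = Y.1.2 -> X.2 = Y.2 -> X = Y.
Proof. by case: X => [[[? ?] ?] ?]; case: Y => [[[? ?] ?] ?] /= -> -> -> ->. Qed.

Lemma fb_x_linear m : linear (@fb_x K g m).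
Proof.
move=> a u v; apply: fbar_eq; rewrite /= ?scaler0 ?addr0//.
exact: mono_linear.
Qed.

Lemma fb_x0 m : fb_x m (0 : fdot g) = 0.
Proof. exact: lin0 (fb_x_linear m). Qed.

Lemma fb_br_xL m n (u : fdot g) : fb_br (fb_x m u) (fb_L g n) =
  m%:~R *: fb_x (m + n) u.
Proof.
apply: fbar_eq => /=.
- rewrite scaler0 lext0// => p; rewrite lextl0// => q b.
  by rewrite !mul0r mono0.
- rewrite lextl0; last by move=> p v; rewrite lext0// => q; rewrite (lie0 v v).2 mono0.
  rewrite lext0; last by move=> p; rewrite lextl0// => q w; rewrite mul0r scale0r mono0.
  rewrite lext_mono; last by move=> p; rewrite lextl0// => q w; rewrite mul0r scale0r mono0.
  rewrite lext_mono; last by move=> p; rewrite scaler0 mono0.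
  by rewrite addr0 sub0r mul1r monoZ rmorphN /= scaleNr opprK addrC.
- by rewrite scaler0 lextl0// => p v; rewrite (fform0 v v).2 mulr0.
by rewrite scaler0 lext0// => p; rewrite !mul0r.
Qed.

Lemma fb_br_central (a b : K) (X : fbar g) : fb_br ((0, 0, a, b) : fbar g) X = 0.
Proof.
case: X => [[[l x] a'] b']; apply: fbar_eq => /=.
- by rewrite lext0// => p; rewrite lextl0// => q c; rewrite !mul0r mono0.
- rewrite lext0; last first.
    by move=> p; rewrite lextl0// => q v; rewrite (lie0 v v).1 mono0.
  rewrite lext0; last first.
    by move=> p; rewrite lextl0// => q v; rewrite mul0r scale0r mono0.
  rewrite lextl0 ?subr0 ?addr0// => p c.
  by rewrite lext0// => q; rewrite scaler0 mono0.
- by rewrite lext0// => p; rewrite (fform0 0 (x (- p))).1 mulr0.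
by rewrite lext0// => p; rewrite !mul0r.
Qed.

Lemma fb_br_central_r (a b : K) (X : fbar g) : fb_br X ((0, 0, a, b) : fbar g) = 0.
Proof.
case: X => [[[l x] a'] b']; apply: fbar_eq => /=.
- by rewrite lextl0// => p c; rewrite lext0// => q; rewrite mulr0 mul0r mono0.
- rewrite lextl0; last first.
    by move=> p v; rewrite lext0// => q; rewrite (lie0 v v).2 mono0.
  rewrite lextl0; last first.
    by move=> p c; rewrite lext0// => q; rewrite scaler0 mono0.
  rewrite lext0 ?subr0 ?addr0// => p.
  by rewrite lextl0// => q v; rewrite mul0r scale0r mono0.
- by rewrite lextl0// => p v; rewrite (fform0 v v).2 mulr0.
by rewrite lextl0// => p c; rewrite mulr0 mul0r.
Qed.

Lemma fbar_ind (P : fbar g -> Prop) : is_subspace P -> (forall m, P (fb_L g m)) ->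
  (forall m u, P (fb_x m u)) -> P (fb_k0 g) -> P (fb_kv g) -> forall X, P X.
Proof.
move=> sP PL Px P0 Pv [[[l x] a] b].
have -> : (l, x, a, b) = ((l, 0, 0, 0) : fbar g) + ((0, x, 0, 0) : fbar g)
    + a *: fb_k0 g + b *: fb_kv g.
  by apply: fbar_eq; rewrite /= ?scaler0 ?addr0 ?add0r// /GRing.scale /= mulr1.
have addm (T : choiceType) (W : lmodType K) (h : fsupp T W -> fbar g) r F :
    (forall u v, h (u + v) = h u + h v) -> h 0 = 0 -> (forall t : T, P (h (F t))) ->
    P (h (\sum_(t <- r) F t)).
  move=> hD h0 PF; rewrite (big_morph h hD h0).
  by apply: (big_ind P); [exact: subsp0 sP|exact: subspD sP|].
do !apply: (subspD sP); try exact: (subspZ sP).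
  have [r ->] := fsupp_sum l.
  apply: (addm _ _ (fun l => (l, 0, 0, 0) : fbar g)) => // [u v|m].
    by apply: fbar_eq; rewrite /= ?addr0.
  rewrite (_ : (_, _, _, _) = (l m : K) *: fb_L g m); first exact: (subspZ sP).
  apply: fbar_eq; rewrite /= ?scaler0// -monoZ; congr mono.
  by rewrite /GRing.scale /= mulr1.
have [r ->] := fsupp_sum x.
apply: (addm _ _ (fun x => (0, x, 0, 0) : fbar g)) => // [u v|m].
  by apply: fbar_eq; rewrite /= ?addr0.
exact: (Px m).
Qed.
End FbarBrackets.

(** * Affine weights and the positive cone *)

Section AffineWeights.
Variables (K : numClosedFieldType) (g : simpleLie K).
Local Notation hd := 'Hom(hdot g, K^o).
Local Notation isroot al := (lroot (@gbr _ g) al).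
Local Notation B := (gbase g).
Local Notation th := (ghighest g).

(** A weight [(al, l)]: [al] is the weight for the finite Cartan subalgebra and
    [l] the eigenvalue of [L(0)]; the root [al + p delta_0] is [(al, - p)]. *)
Definition afw : lmodType K := (hd * K^o)%type.
Implicit Types (w ga : afw) (al be : hd).

(** The simple roots of the affine algebra: first [delta_0 - theta], then those
    of the finite algebra. *)
Definition asimple (j : nat) : afw :=
  if j is i.+1 then (B`_i, 0) else (- th, - 1).

Definition acomb (n : nat -> nat) : afw :=
  \sum_(j < (size B).+1) asimple j *+ n j.

Definition pos_cone ga := exists n, ga = acomb n.

Lemma acombD m n : acomb m + acomb n = acomb (fun j => m j + n j)%N.
Proof. by rewrite /acomb -big_split; apply: eq_bigr => j _; rewrite mulrnDr. Qed.

Lemma acomb_single (j k : nat) : (j < (size B).+1)%N ->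
  acomb (fun i => (i == j) * k)%N = asimple j *+ k.
Proof.
move=> jB; rewrite /acomb (bigD1 (Ordinal jB))//= eqxx mul1n big1 ?addr0// => i.
by rewrite -val_eqE /= => /negPf ->; rewrite mul0n mulr0n.
Qed.

Lemma pos_cone0 : pos_cone 0.
Proof. by exists (fun=> 0%N); rewrite /acomb big1// => j _; rewrite mulr0n. Qed.

Lemma pos_coneD ga ga' : pos_cone ga -> pos_cone ga' -> pos_cone (ga + ga').
Proof. by move=> [m ->] [n ->]; rewrite acombD; eexists. Qed.

Lemma pos_coneMn ga k : pos_cone ga -> pos_cone (ga *+ k).
Proof.
by move=> h; elim: k => [|k IHk]; [exact: pos_cone0|rewrite mulrS; exact: pos_coneD].
Qed.

Lemma pos_cone_simple j : (j < (size B).+1)%N -> pos_cone (asimple j).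
Proof. by move=> jB; exists (fun i => (i == j) * 1)%N; rewrite acomb_single. Qed.

Lemma acomb_inj m n : acomb m = acomb n -> forall j, (j < (size B).+1)%N -> m j = n j.
Proof.
have free_asimple (c : nat -> K) : \sum_(j < (size B).+1) c j *: asimple j = 0 ->
    forall j, (j < (size B).+1)%N -> c j = 0.
  move=> c0; have c00 : c 0%N = 0.
    have := congr1 snd c0; rewrite raddf_sum big_ord_recl /= big1; last first.
      by move=> i _; rewrite /= scaler0.
    by rewrite addr0 /GRing.scale /= mulrN1 => /eqP; rewrite oppr_eq0 => /eqP.
  have [Bb _ _] := gbaseP g; have /(@vector.freeP _ _ _ (in_tuple B)) Bf := basis_free Bb.
  case=> [//|j] jB; have jB' : (j < size B)%N by [].
  have := Bf (fun i : 'I_(size B) => c i.+1) _ (Ordinal jB'); apply.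
  have := congr1 fst c0; rewrite raddf_sum big_ord_recl /= c00 scale0r add0r => h.
  by rewrite -[RHS]h; apply: eq_bigr => i _ /=.
move=> mn j jB; apply/eqP; rewrite -(eqr_nat K) -subr_eq0; apply/eqP.
apply: (free_asimple (fun j => (m j)%:R - (n j)%:R)) => //.
under eq_bigr do rewrite scalerBl !scaler_nat.
by rewrite sumrB -/(acomb m) mn subrr.
Qed.

Lemma pos_cone_opp ga : pos_cone ga -> pos_cone (- ga) -> ga = 0.
Proof.
move=> [m mE] [n nE]; have : acomb (fun j => m j + n j)%N = acomb (fun=> 0%N).
  by rewrite -acombD -mE -nE subrr /acomb big1// => j _; rewrite mulr0n.
move=> /acomb_inj h; rewrite mE /acomb big1// => j _.
by have := h j (ltn_ord j); case: (m j).
Qed.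

Lemma pos_cone_nneg be : nneg_comb B be -> pos_cone (be, 0).
Proof.
case=> n ->; exists (fun j => if j is i.+1 then n i else 0%N).
rewrite /acomb big_ord_recl mulr0n add0r /=; apply: injective_projections => /=.
  by rewrite raddf_sum; apply: eq_bigr => i _; rewrite /= raddfMn.
by rewrite raddf_sum big1// => i _; rewrite raddfMn /= mul0rn.
Qed.

(** The difference of the highest root and its opposite is non-negative, so the
    highest root cannot be negative. *)
Lemma nneg_comb_highest : nneg_comb B th.
Proof.
have rth := highest_root_isroot g; have [_ _ Bp] := gbaseP g.
have [//|[n nE]] := Bp _ rth.
have [_ hth] := ghighestP g; have [m mE] := hth _ (root_opp rth).
have : acomb (fun j => if j is i.+1 then m i + n i + n i else 0)%N = acomb (fun=> 0%N).
  rewrite /acomb big_ord_recl mulr0n add0r [RHS]big1 => [|j _]; last by rewrite mulr0n.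
  apply: injective_projections; rewrite raddf_sum /=; last first.
    by rewrite big1// => i _; rewrite raddfMn /= mul0rn.
  under eq_bigr do rewrite raddfMn /= !mulrnDr.
  by rewrite !big_split /= -mE -nE opprK addrK subrr.
move=> /acomb_inj h; have n0 (i : 'I_(size B)) : n i = 0%N.
  by have := h i.+1 (ltn_ord i) => /=; lia.
exists n; apply: oppr_inj; rewrite nE -sumrN; apply: eq_bigr => i _.
by rewrite n0 !mulr0n oppr0.
Qed.

Lemma pos_cone_delta m : pos_cone (0, - m%:R).
Proof.
have d1 : asimple 0 + ((th, 0) : afw) = ((0, - 1) : afw).
  by apply: injective_projections; rewrite /= ?addNr ?addr0.
have -> : ((0, - m%:R) : afw) = (asimple 0 + ((th, 0) : afw)) *+ m.
  rewrite d1; elim: m => [|m IHm]; first by rewrite mulr0n oppr0.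
  rewrite [RHS]mulrS -IHm; apply: injective_projections => /=; first by rewrite addr0.
  by rewrite -opprD mulrS.
apply: pos_coneMn; apply: pos_coneD; first exact: pos_cone_simple.
exact: pos_cone_nneg nneg_comb_highest.
Qed.

Lemma pos_cone_root al m : isroot al -> (0 < m)%N -> pos_cone (al, - m%:R).
Proof.
move=> ral; case: m => // m _.
have -> : (al, - m.+1%:R) = (0, - m%:R) + (asimple 0 + (th + al, 0)).
  apply: injective_projections => /=; first by rewrite add0r addrA addNr add0r.
  by rewrite addr0 -opprD natr1.
apply: pos_coneD; first exact: pos_cone_delta.
apply: pos_coneD; first exact: pos_cone_simple.
apply: pos_cone_nneg; have [_ hth] := ghighestP g.
by rewrite -[al]opprK; apply: hth; exact: root_opp.
Qed.

(** The mode [m] lowers the degree by [m]. In [Homx] the value [al = 0] is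
    allowed, which covers the modes of the Cartan subalgebra, and [Homb] those
    of [k_1] and [d_1]. *)
Inductive homogeneous : afw -> fbar g -> Prop :=
  | HomL m : homogeneous (0, - m%:~R) (fb_L g m)
  | Homx m al x : root_space gbr al x -> homogeneous (al, - m%:~R) (fb_x m (x, 0))
  | Homb m (a b : K) : homogeneous (0, - m%:~R) (fb_x m (0, (a, b)))
  | Homk0 : homogeneous 0 (fb_k0 g)
  | Homkv : homogeneous 0 (fb_kv g).

Lemma fbar_homogeneous_ind (P : fbar g -> Prop) : is_subspace P ->
  (forall ga X, homogeneous ga X -> P X) -> forall X, P X.
Proof.
move=> sP hP; apply: (fbar_ind sP) => [m|m [x [a b]]||].
- exact: hP (HomL m).
- have -> : fb_x m (x, (a, b)) = fb_x m (x, 0) + fb_x m (0, (a, b)).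
    rewrite -(linD (fb_x_linear m)); congr fb_x; apply: injective_projections => /=.
      by rewrite addr0.
    by rewrite add0r.
  apply: (subspD sP); last exact: hP (Homb m a b).
  move: x; apply: root_ind => [|al x hx]; last exact: hP (Homx m hx).
  split=> [|c u v hu hv]; first by rewrite fb_x0; exact: subsp0 sP.
  have -> : (c *: u + v, 0) = c *: (u, 0) + (v, 0) :> fdot g.
    by apply: injective_projections; rewrite /= ?scaler0 ?addr0.
  by rewrite fb_x_linear; exact: sP.2.
- exact: hP Homk0.
exact: hP Homkv.
Qed.

(** The sign of the mode decides, and for mode [0] the sign of the root: the
    imaginary root [delta] is the simple root [delta - theta] plus [theta], and
    [theta + al] is non-negative for every root [al]. *)
Lemma homogeneous_sign ga X : homogeneous ga X ->
  [\/ X = 0, pos_cone ga | pos_cone (- ga)].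
Proof.
have hm (m : int) : pos_cone (0, - m%:~R) \/ pos_cone (- (0, - m%:~R) : afw).
  case: m => n; first by left; rewrite -pmulrn; exact: pos_cone_delta.
  right; rewrite (_ : - _ = (0, - n.+1%:R)); first exact: pos_cone_delta.
  by apply: injective_projections; rewrite /= ?oppr0// NegzE rmorphN opprK pmulrn.
case=> [m|m al x hx|m a b||].
- by case: (hm m) => h; [apply: Or32|apply: Or33].
- have [->|x0] := pselect (x = 0); first by apply: Or31; rewrite fb_x0.
  have [al0|/eqP al0] := pselect (al = 0).
    by rewrite al0; case: (hm m) => h; [apply: Or32|apply: Or33].
  have ral : isroot al by split=> //; exists x => //; apply/eqP.
  case: m => [[|n]|n].
  + have [_ _ Bp] := gbaseP g; rewrite -pmulrn oppr0; case: (Bp _ ral) => h.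
      by apply: Or32; exact: pos_cone_nneg.
    apply: Or33; rewrite (_ : - _ = (- al, 0)); first exact: pos_cone_nneg.
    by apply: injective_projections; rewrite /= ?oppr0.
  + by apply: Or32; rewrite -pmulrn; exact: pos_cone_root.
  apply: Or33; rewrite (_ : - _ = (- al, - n.+1%:R)).
    by apply: pos_cone_root => //; exact: root_opp.
  by apply: injective_projections; rewrite //= NegzE rmorphN opprK pmulrn.
- by case: (hm m) => h; [apply: Or32|apply: Or33].
- by apply: Or32; exact: pos_cone0.
by apply: Or32; exact: pos_cone0.
Qed.

Lemma pos_cone_snd ga : pos_cone ga -> exists n : nat, ga.2 = - n%:R.
Proof.
case=> n ->; exists (n 0%N); rewrite /acomb raddf_sum big_ord_recl /= big1.
  by rewrite addr0 raddfMn /= mulNrn.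
by move=> i _; rewrite raddfMn /= mul0rn.
Qed.

Lemma homogeneous_plus ga X : homogeneous ga X -> pos_cone ga -> ga <> 0 ->
  X = 0 \/ fbar_plus X.
Proof.
have plus (m : int) al : pos_cone (al, - m%:~R) -> (0 <= m)%R.
  move=> /pos_cone_snd[n /= /oppr_inj mn].
  by move: mn; rewrite pmulrn => /(@intr_inj K) ->.
have mpos (m : int) : pos_cone (0, - m%:~R) -> (0, - m%:~R) <> 0 :> afw -> (0 < m)%R.
  move=> /plus; rewrite le_eqVlt => /orP[/eqP <-|//] [].
  by apply: injective_projections; rewrite /= ?oppr0.
case=> [m|m al x hx|m a b||] // hp h0.
- by right; apply: lspan1; apply: Or31; exists m => //; exact: mpos.
- have [->|x0] := pselect (x = 0); first by left; rewrite fb_x0.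
  have := plus _ _ hp; rewrite le_eqVlt => /orP[/eqP m0|m0]; last first.
    by right; apply: lspan1; apply: Or32; exists m, (x, 0).
  have /eqP al0 : al <> 0.
    by move=> al0; apply: h0; rewrite al0 -m0 oppr0.
  have ral : isroot al by split=> //; exists x => //; apply/eqP.
  right; apply: lspan1; apply: Or33; exists al, x; split=> //; last by rewrite -m0.
  split=> //; have [_ _ Bp] := gbaseP g; case: (Bp _ ral) => // /pos_cone_nneg hn.
  case: h0; apply: pos_cone_opp => //; rewrite -m0.
  rewrite (_ : - _ = (- al, 0)) //.
  by apply: injective_projections; rewrite /= ?oppr0.
by right; apply: lspan1; apply: Or32; exists m, (0, (a, b)); split=> //; exact: mpos.
Qed.
End AffineWeights.

(** * Irreducible highest weight modules *)

Local Arguments fb_br : simpl never.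
Local Arguments fb_x : simpl never.
Local Arguments fb_L : simpl never.

Section FbarModule.
Variables (K : numClosedFieldType) (g : simpleLie K).
Variables (V : lmodType K) (act : fbar g -> V -> V).
Hypothesis Vmod : lie_module (@fb_br K g) (fun=> True) act.
Local Notation hd := 'Hom(hdot g, K^o).
Local Notation isroot al := (lroot (@gbr _ g) al).
Local Notation afw := (afw g).
Implicit Types (X Y : fbar g) (u v : V) (w ga : afw) (al be : hd) (x y : g).

Lemma act_linear X : linear (act X).
Proof. exact: act_linr Vmod X I. Qed.

Lemma act_linearl v : linear (act^~ v : fbar g -> V).
Proof. by move=> a X Y; exact: act_linl Vmod _ _ _ _ I I. Qed.

Lemma act_commute X Y v : act X (act Y v) = act Y (act X v) + act (fb_br X Y) v.
Proof. by rewrite (act_br Vmod _ I I) addrC subrK. Qed.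

Lemma act0 v : act 0 v = 0.
Proof. exact: lin0 (act_linearl v). Qed.

(** [None] stands for [L(0)], the opposite of the degree derivation [d_0]. *)
Definition cartan_op (s : option (hdot g)) : V -> V :=
  act (if s is Some t then fb_x 0 (vsval t, 0) else fb_L g 0).

Definition wchar w (s : option (hdot g)) : K := if s is Some t then w.1 t else w.2.

Lemma cartan_op_linear s : linear (cartan_op s). Proof. exact: act_linear. Qed.

Lemma wchar_inj w w' : (forall s, wchar w s = wchar w' s) -> w = w'.
Proof.
move=> h; apply: injective_projections; last exact: (h None).
by apply/lfunP => t; exact: (h (Some t)).
Qed.

Local Notation weight_vec := (eigen cartan_op wchar).
Local Notation weight_sum := (eigensum cartan_op wchar).

Lemma homogeneous_weight w ga X u : weight_vec w u -> homogeneous ga X ->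
  weight_vec (w + ga) (act X u).
Proof.
move=> hu hX s; rewrite /cartan_op act_commute -/(cartan_op s u) hu.
rewrite (linZ _ _ (act_linear X)).
have -> : fb_br (if s is Some t then fb_x 0 (vsval t, 0) else fb_L g 0) X =
    wchar ga s *: X.
  case: hX => [m|m al x hx|m a b||]; case: s => [t|] /=.
  - by rewrite fb_br_xL mulr0z zero_lfunE !scale0r.
  - rewrite fb_br_LL sub0r rmorphN add0r expr0n /= subrr mul0r mul0r scale0r addr0.
    by rewrite /=.
  - rewrite fb_br_xx mulr0z !mul0r scale0r addr0 add0r -(linZ _ _ (fb_x_linear m)).
    congr fb_x; apply: injective_projections => /=; first exact: hx.
    by rewrite scaler0.
  - by rewrite fb_br_Lx add0r rmorphN.
  - rewrite fb_br_xx mulr0z !mul0r scale0r addr0 add0r zero_lfunE scale0r.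
    by rewrite /fdot_br /= gbr0r fb_x0.
  - by rewrite fb_br_Lx add0r rmorphN.
  - by rewrite fb_br_central_r zero_lfunE scale0r.
  - by rewrite fb_br_central_r scale0r.
  - by rewrite fb_br_central_r zero_lfunE scale0r.
  - by rewrite fb_br_central_r scale0r.
by rewrite (linZ _ _ (act_linearl u)) -scalerDl; congr (_ *: _); case: s => //= t;
  rewrite add_lfunE.
Qed.

Section Irreducible.
Hypothesis Virr : irreducible_module act.

(** A nonzero vector generates an irreducible module, and stability may be
    tested on homogeneous elements. *)
Lemma irreducible_ind (P : V -> Prop) v : is_subspace P -> v <> 0 -> P v ->
  (forall ga X u, homogeneous ga X -> P u -> P (act X u)) -> forall u, P u.
Proof.
move=> sP v0 Pv hP; have stP X u : P u -> P (act X u).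
  move=> Pu; move: X; apply: fbar_homogeneous_ind => [|ga X hX]; last exact: hP hX Pu.
  split=> [|a X Y hX hY]; first by rewrite act0; exact: subsp0 sP.
  by rewrite (act_linearl u); exact: sP.2.
by have [_ /(_ P sP stP)[/(_ v Pv)|]] := Virr.
Qed.

(** Poincare-Birkhoff-Witt in the form needed here: the span of the vectors
    obtained from a singular vector [v] by elements of non-positive weight is
    stable under the elements of positive weight as well, since these can be
    commuted to the right until they reach [v]. *)
Lemma singular_weights v w : v <> 0 -> weight_vec w v ->
  (forall ga X, homogeneous ga X -> pos_cone ga -> ga <> 0 -> act X v = 0) ->
  forall u, weight_sum (fun w' => pos_cone (w - w')) u.
Proof.
move=> v0 hv sv.
pose low X := exists2 ga, homogeneous ga X & pos_cone (- ga).
pose P u := forall Q : V -> Prop, is_subspace Q -> Q v ->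
  (forall X u, low X -> Q u -> Q (act X u)) -> Q u.
have sP : is_subspace P.
  split=> [Q sQ _ _|a u u' hu hu' Q sQ Qv hQ]; first exact: subsp0 sQ.
  by apply: sQ.2; [exact: (hu Q sQ Qv hQ)|exact: (hu' Q sQ Qv hQ)].
have lowP X u : low X -> P u -> P (act X u).
  by move=> lX Pu Q sQ Qv hQ; apply: (hQ) => //; exact: (Pu Q sQ Qv hQ).
have Pv : P v by move=> Q.
have PQ u : P u -> P u /\ forall X, P (act X u).
  move=> Pu; apply: (Pu (fun u => P u /\ forall X, P (act X u))) => [||X u' lX [Pu' hu']].
  - split=> [|a u1 u2 [h1 k1] [h2 k2]].
      split=> [|X]; first exact: subsp0 sP.
      by rewrite (lin0 (act_linear X)); exact: subsp0 sP.
    split=> [|X]; first exact: sP.2.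
    by rewrite act_linear; exact: sP.2.
  - split=> //; apply: fbar_homogeneous_ind.
      split=> [|a X Y hX hY]; first by rewrite act0; exact: subsp0 sP.
      by rewrite (act_linearl v); exact: sP.2.
    move=> ga X hX; have [->|pga|nga] := homogeneous_sign hX.
    + by rewrite act0; exact: subsp0 sP.
    + have [ga0|ga0] := pselect (ga = 0).
        apply: lowP => //; exists ga => //.
        by rewrite ga0 oppr0; exact: pos_cone0.
      by rewrite (sv _ _ hX pga ga0); exact: subsp0 sP.
    by apply: lowP => //; exists ga.
  split=> [|Y]; first exact: lowP.
  rewrite act_commute; apply: (subspD sP) => //.
  by apply: lowP.
have Pall u : P u.
  apply: (irreducible_ind sP v0 Pv) => ga X u' _ /PQ[_]; exact.
move=> u; have sE := eigensum_subspace wchar cartan_op_linear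
  (fun w' => pos_cone (w - w')).
apply: (Pall u) => // [|X u' [ga hX nga] [r [z [_ rA ez ->]]]].
  apply: (eigensum1 cartan_op_linear (i := w)) => //.
  by rewrite subrr; exact: pos_cone0.
rewrite (lin_sum _ _ _ (act_linear X)); apply: (subsp_sum sE) => i ir.
apply: (eigensum1 cartan_op_linear (i := i + ga)).
  by rewrite opprD addrA; apply: pos_coneD => //; exact: rA.
exact: homogeneous_weight.
Qed.

(** Real root vectors are ad-locally nilpotent, so the vectors killed by one of
    their powers form a submodule; one nonzero such vector is therefore enough. *)
Lemma real_root_nilp_at al x p v : al <> 0 -> root_space gbr al x -> v <> 0 ->
  nilp_at (act (fb_x p (x, 0))) v -> forall u, nilp_at (act (fb_x p (x, 0))) u.
Proof.
move=> al0 hx v0 nv; set T := act _; have lT : linear T by exact: act_linear.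
have sN := nilp_at_subspace lT.
have fxx : gform x x = 0.
  apply: contrapT => /(gform_root hx hx)/eqP; rewrite -addr_eq0 -mulr2n.
  rewrite -scaler_nat scaler_eq0 pnatr_eq0 /= => /eqP.
  exact: al0.
have ncent Y u : fb_br (fb_x p (x, 0)) Y = 0 -> nilp_at T u ->
    nilp_at T (act Y u).
  move=> h; apply: (nilp_at_commutator lT (act_linear Y) (S1 := fun=> 0)) => [u'|_ _].
    by rewrite /T act_commute h act0.
  exact: subsp0 sN.
have nx m y : forall u, nilp_at T u -> nilp_at T (act (fb_x m (y, 0)) u).
  have [N] := gbr_nilp y al0 hx; elim: N y m => [|N IHN] y m yN.
    by move=> u _; rewrite /= in yN; rewrite yN fb_x0 act0; exact: subsp0 sN.
  pose c : K := p%:~R * (p + m == 0)%:R * fdot_form (x, 0) (y, 0).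
  apply: (nilp_at_commutator lT (act_linear _)
    (S1 := fun u => act (fb_x (p + m) (gbr x y, 0)) u + c *: act (fb_k0 g) u)) => u.
    by rewrite /T act_commute fb_br_xx (linD (act_linearl u)) (linZ _ _ (act_linearl u)).
  move=> nu; apply: (subspD sN).
    by apply: IHN => //; rewrite -iterSr.
  by apply: (subspZ sN); apply: ncent => //; exact: fb_br_central_r.
apply: (irreducible_ind sN v0 nv) => ga X u [m|m be y _|m a b||] nu.
- move: u nu; apply: (nilp_at_commutator lT (act_linear _)
    (S1 := fun u => p%:~R *: act (fb_x (p + m) (x, 0)) u)) => u.
    by rewrite /T act_commute fb_br_xL (linZ _ _ (act_linearl u)).
  by move=> nu; apply: (subspZ sN); exact: nx.
- exact: nx.
- apply: ncent => //; rewrite fb_br_xx /fdot_br /= gbr0r fb_x0 add0r.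
  by rewrite /fdot_form /= gform0r !mul0r !addr0 mulr0 scale0r.
- by apply: ncent => //; exact: fb_br_central_r.
by apply: ncent => //; exact: fb_br_central_r.
Qed.
End Irreducible.
End FbarModule.

(** * Integrability of the highest weight module *)

Section Integrability.
Variables (K : numClosedFieldType) (g : simpleLie K).
Variables (V : lmodType K) (act : fbar g -> V -> V).
Hypothesis Vmod : lie_module (@fb_br K g) (fun=> True) act.
Hypothesis Virr : irreducible_module act.
Local Notation hd := 'Hom(hdot g, K^o).
Local Notation isroot al := (lroot (@gbr _ g) al).
Local Notation afw := (afw g).
Local Notation weight_vec := (eigen (cartan_op act) (@wchar K g)).
Local Notation weight_sum := (eigensum (cartan_op act) (@wchar K g)).
Local Notation B := (gbase g).
Variables (v : V) (w0 : afw) (c : K).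
Hypothesis v0 : v <> 0.
Hypothesis v_weight : weight_vec w0 v.
Hypothesis v_singular :
  forall ga X, homogeneous ga X -> pos_cone ga -> ga <> 0 -> act X v = 0.
Hypothesis v_level : act (fb_k0 g) v = c *: v.
Implicit Types (X Y : fbar g) (u : V) (w ga : afw) (al be : hd) (x y z : g).

Lemma level_act u : act (fb_k0 g) u = c *: u.
Proof.
move: u; apply: (irreducible_ind Vmod Virr _ v0 v_level).
  exact: (subspace_eigen c (act_linear Vmod (fb_k0 g))).
move=> ga X u _ hu; rewrite (act_commute Vmod) hu (linZ _ _ (act_linear Vmod X)).
by rewrite (_ : fb_br _ _ = 0) ?(act0 Vmod) ?addr0//; exact: fb_br_central.
Qed.

Lemma weights_in_cone w u : weight_vec w u -> u <> 0 -> pos_cone (w0 - w).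
Proof.
move=> hu u0.
have := singular_weights Vmod Virr v0 v_weight v_singular u.
move=> /(eigensum_eigen (cartan_op_linear Vmod) (@wchar_inj K g)).
by apply.
Qed.

(** The value of a weight of level [c] on the coroot of the real affine root
    [al + p delta_0]. *)
Definition coroot_value al (p : int) w : K :=
  w.1 (coroot_of al) + p%:~R * (2%:R / hform al al) * c.

Section RealRoot.
Variables (al : hd) (p : int) (y : g).
Hypotheses (ral : isroot al) (hy : root_space gbr (- al) y).

Local Notation F := (act (fb_x (- p) (y, 0))).
(** The coroot of [al + p delta_0] is the coroot of [al] plus a multiple of the
    central element [k_0], which acts by [c]. *)
Definition affine_coroot u :=
  act (fb_x 0 (vsval (coroot_of al), 0)) u + (p%:~R * (2%:R / hform al al) * c) *: u.
Local Notation H := affine_coroot.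

Lemma coroot_weight w u : weight_vec w u -> H u = coroot_value al p w *: u.
Proof.
by move=> hu; rewrite /H scalerDl; congr (_ + _); exact: hu (Some _).
Qed.

Lemma affine_coroot_root be q x (a : K) u : root_space gbr be x ->
  be (coroot_of al) = a :> K ->
  H (act (fb_x q (x, 0)) u) = act (fb_x q (x, 0)) (H u) + a *: act (fb_x q (x, 0)) u.
Proof.
move=> hx <-; rewrite /H (linD (act_linear Vmod _)) (linZ _ _ (act_linear Vmod _)).
rewrite (act_commute Vmod (fb_x 0 _)) [RHS]addrAC; congr (_ + _ + _).
rewrite fb_br_xx mulr0z !mul0r scale0r addr0 add0r -(linZ _ _ (act_linearl Vmod u)).
congr act; rewrite -(linZ _ _ (fb_x_linear q)); congr fb_x.
apply: injective_projections; rewrite /= ?scaler0//; exact: (hx (coroot_of al)).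
Qed.

Lemma affine_coroot_f u : H (F u) = F (H u) - 2%:R *: F u.
Proof.
rewrite (affine_coroot_root (a := - 2%:R) _ _ hy) ?scaleNr//.
by rewrite opp_lfunE coroot_of_root.
Qed.

Lemma affine_ef z u : root_space gbr al z ->
  act (fb_x p (z, 0)) (F u) =
  F (act (fb_x p (z, 0)) u) + (gform z y * hform al al / 2%:R) *: H u.
Proof.
move=> hz; rewrite (act_commute Vmod) fb_br_xx subrr eqxx mulr1; congr (_ + _).
rewrite (linD (act_linearl Vmod u)) (linZ _ _ (act_linearl Vmod u)) level_act.
have /eqP al0 := hform_root_neq0 ral.
rewrite /H scalerDr !scalerA; congr (_ + _ *: _); last first.
  by rewrite /fdot_form /= !mul0r !addr0; field.
rewrite -(linZ _ _ (act_linearl Vmod u)); congr act.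
rewrite -(linZ _ _ (fb_x_linear 0)); congr fb_x.
apply: injective_projections; last by rewrite /= scaler0.
change (gbr z y = (gform z y * hform al al / 2%:R) *: vsval (coroot_of al)).
have [t [-> tE]] := opposite_br hz hy; rewrite -linearZ; congr vsval.
have -> : t = gform z y *: dual al.
  apply/eqP; rewrite -subr_eq0; apply/eqP; apply: hdot_nondeg => s.
  rewrite linearB (linB _ _ (gform_linl (vsval s))) /= tE.
  by rewrite gformZl dualE subrr.
rewrite /coroot_of scalerA; congr (_ *: _).
by field.
Qed.
End RealRoot.

(** Let [u] be the power applied to [v]. If it were nonzero, it would be
    singular: an element of positive weight that is no multiple of the simple
    root moves [u] out of the cone of weights, proper multiples of the simple
    root are not roots, and the vectors of the simple root itself kill [u] by
    the sl2-relations. So [u] would generate the module, and its weight would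
    dominate that of [v]. *)
Lemma simple_root_nilp j al (p : int) y (n : nat) : (j < (size B).+1)%N ->
  asimple g j = (al, - p%:~R) -> isroot al -> root_space gbr (- al) y ->
  coroot_value al p w0 = n%:R -> iter n.+1 (act (fb_x (- p) (y, 0))) v = 0.
Proof.
move=> jB jE ral hy nE; set F := act _; have lF : linear F by exact: act_linear.
apply: contrapT => u0; set u := iter _ _ _ in u0.
have hF : homogeneous (- asimple g j) (fb_x (- p) (y, 0)).
  rewrite jE (_ : - _ = (- al, - (- p)%:~R)); first exact: Homx.
  by apply: injective_projections; rewrite //= rmorphN.
have hu : weight_vec (w0 - asimple g j *+ n.+1) u.
  rewrite /u; elim: n.+1 => [|m IHm]; first by rewrite mulr0n subr0.
  rewrite iterS mulrSr opprD addrA; exact: (homogeneous_weight Vmod IHm hF).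
have su ga X : homogeneous ga X -> pos_cone ga -> ga <> 0 -> act X u = 0.
  move=> hX pga ga0; apply: contrapT => Xu0.
  have := weights_in_cone (homogeneous_weight Vmod hu hX) Xu0.
  have -> : w0 - (w0 - asimple g j *+ n.+1 + ga) = asimple g j *+ n.+1 - ga.
    by rewrite !opprD opprK !addrA subrr add0r.
  case=> m' mE'; case: pga => m mE.
  have h i : (i < (size B).+1)%N -> (m i + m' i = (i == j) * n.+1)%N.
    apply: (@acomb_inj _ g (fun i => m i + m' i)%N (fun i => (i == j) * n.+1)%N).
    rewrite -acombD -mE -mE' acomb_single//.
    by rewrite addrCA subrr addr0.
  have gaE : ga = asimple g j *+ m j.
    rewrite mE -acomb_single//; rewrite /acomb; apply: eq_bigr => i _.
    have := h i (ltn_ord i); case: eqP => [-> _|_ /eqP]; first by rewrite mul1n.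
    by rewrite mul0n addn_eq0 => /andP[/eqP -> _].
  have /eqP al0 : al <> 0 by apply/eqP; case: ral.
  have mj0 : m j != 0%N by apply/eqP => mj0; apply: ga0; rewrite gaE mj0 mulr0n.
  have alM : al *+ m j = 0 -> False.
    by move=> /eqP; rewrite -scaler_nat scaler_eq0 pnatr_eq0 (negPf mj0) (negPf al0).
  have fstE : ga.1 = al *+ m j by rewrite gaE jE raddfMn.
  have sndE : ga.2 = - (p%:~R *+ m j) by rewrite gaE jE raddfMn /= mulNrn.
  case: hX ga0 fstE sndE Xu0 => [q|q be z hz|q a b||] _ /=.
  - by move=> h0; case: alM.
  - move=> beE /oppr_inj qE Xu0; have [mj1|mj1] := leqP (m j) 1; last first.
      by apply: Xu0; rewrite beE in hz; rewrite (root_reduced ral hz mj1) fb_x0 (act0 Vmod).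
    have mjE : m j = 1%N by lia.
    rewrite mjE mulr1n in beE; rewrite mjE mulr1n in qE.
    have {}qE : q = p by exact: (@intr_inj K).
    apply: Xu0; rewrite qE /u.
    rewrite beE in hz.
    set r := gform z y * hform al al / 2%:R.
    rewrite (@string_ef _ _ (act (fb_x p (z, 0))) F
      (fun u => r *: affine_coroot al p u) (r * 2%:R) lF _ _ (r * n%:R)).
    + have -> : act (fb_x p (z, 0)) v = 0.
        apply: (v_singular (ga := asimple g j)); first by rewrite jE; exact: Homx.
          exact: pos_cone_simple.
        by rewrite jE => -[/eqP]; rewrite (negPf al0).
      rewrite (lin0 (lin_iter _ lF)) add0r.
      rewrite (_ : r * n%:R - n%:R * (r * 2%:R) / 2%:R = 0); last by field.
      by rewrite mulr0 scale0r.
    + by move=> u'; rewrite (affine_ef p ral hy _ hz).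
    + move=> u'; rewrite (affine_coroot_f p ral hy) scalerBr scalerA.
      by rewrite (linZ _ _ lF).
    by rewrite (coroot_weight al p v_weight) nE scalerA.
  - by move=> h0; case: alM.
  - by move=> h0; case: alM.
  by move=> h0; case: alM.
have := singular_weights Vmod Virr u0 hu su v.
move=> /(eigensum_eigen (cartan_op_linear Vmod) (@wchar_inj K g)).
move=> /(_ _ v_weight v0); rewrite addrAC subrr add0r => -[m mE].
have := @acomb_inj _ g (fun i => (i == j) * n.+1 + m i)%N (fun=> 0%N).
rewrite -acombD acomb_single// -mE subrr => /(_ _ _ jB).
rewrite eqxx mul1n => h; have : (n.+1 + m j = 0)%N by apply: h; rewrite /acomb big1.
by [].
Qed.

Hypothesis v_dominant : forall j al p, (j < (size B).+1)%N ->
  asimple g j = (al, - p%:~R) -> exists n : nat, coroot_value al p w0 = n%:R.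

Lemma asimple_real j : (j < (size B).+1)%N ->
  exists al p, asimple g j = (al, - p%:~R) /\ isroot al.
Proof.
case: j => [_|j jB]; first by exists (- ghighest g), 1; split=> //;
  exact: root_opp (highest_root_isroot g).
exists B`_j, 0; split; first by rewrite /= oppr0.
by have [_ Br _] := gbaseP g; apply/Br/mem_nth.
Qed.

(** The weights on the coroot of a simple root are integers, and a weight whose
    value is negative can be reflected. *)
Lemma simple_reflection j al p w u : (j < (size B).+1)%N ->
  asimple g j = (al, - p%:~R) -> isroot al -> weight_vec w u -> u <> 0 ->
  (exists m : nat, coroot_value al p w = m%:R) \/
  exists (m : nat) u', [/\ u' <> 0, weight_vec (w + asimple g j *+ m) u',
    coroot_value al p w = - m%:R & (0 < m)%N].
Proof.
move=> jB jE ral hu u0; have [x [y [hx hy fxy _]]] := sl2_triple ral.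
have /eqP al0 : al != 0 by case: ral.
have alN0 : - al <> 0 by move=> /eqP; rewrite oppr_eq0 => /eqP.
set E := act (fb_x p (x, 0)); set F := act (fb_x (- p) (y, 0)).
have lE : linear E by exact: act_linear.
have lF : linear F by exact: act_linear.
have hE : homogeneous (asimple g j) (fb_x p (x, 0)) by rewrite jE; exact: Homx.
have nE u' : nilp_at E u'.
  apply: (real_root_nilp_at Vmod Virr al0 hx v0).
  exists 1%N; apply: (v_singular hE); first exact: pos_cone_simple.
  by rewrite jE => -[].
have nF u' : nilp_at F u'.
  apply: (real_root_nilp_at Vmod Virr alN0 hy v0).
  have [n nE'] := v_dominant jB jE.
  by exists n.+1; exact: simple_root_nilp jB jE ral hy nE'.
pose H := affine_coroot al p.
have EF u' : E (F u') = F (E u') + H u'.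
  have /eqP al2 := hform_root_neq0 ral.
  rewrite /E /F (affine_ef p ral hy u' hx) fxy mulfVK// divff ?pnatr_eq0//.
  by rewrite scale1r.
have HE u' : H (E u') = E (H u') + 2%:R *: E u'.
  by apply: (affine_coroot_root _ _ _ hx); exact: coroot_of_root.
have HF u' : H (F u') = F (H u') - 2%:R *: F u' by exact: affine_coroot_f.
have Hu : H u = coroot_value al p w *: u by exact: coroot_weight.
have [i [k]] := string_eigenvalue lE lF EF HF HE Hu u0 (nE u) nF.
rewrite mulfK ?pnatr_eq0// => ik.
have aE : coroot_value al p w = (i%:Z - (k * 2)%N%:Z)%:~R.
  by rewrite rmorphB /= -!pmulrn natrM -ik addrK.
move: aE; case: (i%:Z - (k * 2)%N%:Z) => m.
  by move=> ->; left; exists m; rewrite pmulrn.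
rewrite NegzE mulrNz -pmulrn => aE; right; exists m.+1, (iter m.+1 E u); split=> //.
  move=> Eu; apply: u0.
  have [N Fu] := nF u.
  apply: (@string_injective _ _ F E (fun u => - H u) 2%:R lF lE _ _ _ m.+1 N) => //.
  - by move=> u'; rewrite EF addrK.
  - by move=> u'; rewrite HE opprD (linN _ lE).
  - by move=> u'; rewrite HF opprD opprK (linN _ lF).
  by rewrite Hu aE scaleNr opprK.
elim: m.+1 => [|q IHq]; first by rewrite mulr0n addr0.
by rewrite iterS mulrSr addrA; exact: (homogeneous_weight Vmod IHq hE).
Qed.

(** The square of a weight of level [c], up to a constant. *)
Definition wnorm w : K := hform w.1 w.1 - 2%:R * c * w.2.

(** The pairing of a weight of level [c] with an element of the root lattice,
    which has level [0]. *)
Definition wpair w ga : K := hform w.1 ga.1 - c * ga.2.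

Lemma wnormD w ga : wnorm (w + ga) = wnorm w + 2%:R * wpair w ga + hform ga.1 ga.1.
Proof.
rewrite /wnorm /wpair /= hformDr !hformDl (hformC ga.1 w.1).
by ring.
Qed.

Lemma wnormB w w' : wnorm w - wnorm w' = wpair w (w - w') + wpair w' (w - w').
Proof.
rewrite /wnorm /wpair /= (linB _ _ (hform_linr w.1)) (linB _ _ (hform_linr w'.1)).
by rewrite (hformC w'.1 w.1); ring.
Qed.

Lemma wpair_linear w : linear (wpair w : afw -> K^o).
Proof.
move=> a ga ga'; rewrite /wpair /= hformDr hformZr [a *: ga.2]/(a * _).
change (a * hform w.1 ga.1 + hform w.1 ga'.1 - c * (a * (ga.2 : K) + (ga'.2 : K)) =
  a * (hform w.1 ga.1 - c * ga.2) + (hform w.1 ga'.1 - c * ga'.2)).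
by ring.
Qed.

Lemma wpairMn w ga k : wpair w (ga *+ k) = k%:R * wpair w ga.
Proof. by rewrite -scaler_nat (linZ _ _ (wpair_linear w)). Qed.

Lemma wnormDMn w ga k : wnorm (w + ga *+ k) =
  wnorm w + k%:R * (2%:R * wpair w ga) + k%:R ^+ 2 * hform ga.1 ga.1.
Proof.
rewrite wnormD wpairMn -scaler_nat /= hformZl hformZr.
by ring.
Qed.

Lemma wpair_simple j al p w : asimple g j = (al, - p%:~R) -> isroot al ->
  wpair w (asimple g j) = hform al al / 2%:R * coroot_value al p w.
Proof.
move=> jE /hform_root_neq0/eqP al0; rewrite /wpair jE /coroot_value coroot_ofE.
by rewrite /= (hformC al w.1); field.
Qed.

(** Every weight is at most as long as the highest one: reflecting in simple
    roots on whose coroots the weight is negative keeps the length and shortens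
    the difference with the highest weight, until the weight is dominant; and
    for dominant weights the bound is a sum of non-negative terms. *)
Lemma weight_norm_le w u : weight_vec w u -> u <> 0 -> 0 <= wnorm w0 - wnorm w.
Proof.
move=> hu u0; have [n nE] := weights_in_cone hu u0.
have [N] := ubnP (\sum_(j < (size B).+1) n j)%N.
elim: N w u n hu u0 nE => [//|N IHN] w u n hu u0 nE; rewrite ltnS => nN.
have [[j [al [p [jB [jE [ral hneg]]]]]]|hpos] := pselect (exists j al p,
    (j < (size B).+1)%N /\ asimple g j = (al, - p%:~R) /\ isroot al /\
    ~ exists m : nat, coroot_value al p w = m%:R).
  have [//|[m [u' [u'0 hu' mE m0]]]] := simple_reflection jB jE ral hu u0.
  have <- : wnorm (w + asimple g j *+ m) = wnorm w.
    by rewrite wnormDMn (wpair_simple w jE ral) mE jE /=; field.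
  have [n' n'E] := weights_in_cone hu' u'0.
  apply: (IHN _ _ _ hu' u'0 n'E).
  have h i : (i < (size B).+1)%N -> (n' i + (i == j) * m = n i)%N.
    apply: (@acomb_inj _ g (fun i => n' i + (i == j) * m)%N n).
    by rewrite -acombD -nE -n'E acomb_single// opprD addrA subrK.
  apply: leq_trans nN; have := h j jB; rewrite eqxx mul1n => hj.
  rewrite (bigD1 (Ordinal jB))//= [X in (_ < X)%N](bigD1 (Ordinal jB))//=.
  rewrite -hj -addSn leq_add//; first by rewrite -addn1 leq_add2l.
  by apply: leq_sum => i _; rewrite -(h i (ltn_ord i)) leq_addr.
rewrite wnormB nE /acomb !(lin_sum _ _ _ (wpair_linear _)) -big_split /=.
apply: sumr_ge0 => j _; rewrite !wpairMn.
have [al [p [jE ral]]] := asimple_real (ltn_ord j).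
have al0 : 0 <= hform al al / 2%:R.
  by rewrite divr_ge0 ?ler0n// ltW// hform_root_gt0.
have pge0 w' : (exists m : nat, coroot_value al p w' = m%:R) ->
    0 <= wpair w' (asimple g j).
  by move=> [m mE]; rewrite (wpair_simple _ jE ral) mE mulr_ge0.
have w0ge := pge0 _ (v_dominant (ltn_ord j) jE).
have wge : 0 <= wpair w (asimple g j).
  apply: pge0; apply: contrapT => h; apply: hpos; exists j, al, p.
  by split; [exact: ltn_ord|split=> //].
by rewrite addr_ge0// mulr_ge0 ?ler0n.
Qed.

(** Along a real root direction the length grows quadratically, so only
    finitely many steps stay below the bound. *)
Lemma real_root_nilp be p x u : (forall z : K, exists k : nat, ~ k%:R <= z) ->
  isroot be -> root_space gbr be x -> nilp_at (act (fb_x p (x, 0))) u.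
Proof.
move=> arch rbe hx; have /eqP be0 : be != 0 by case: rbe.
apply: (real_root_nilp_at Vmod Virr be0 hx v0).
set E := act _; pose D := hform be be; pose ga : afw := (be, - p%:~R).
have D0 : 0 < D by exact: hform_root_gt0.
(* beyond this bound the quadratic expression in the number of steps is
   positive *)
have [k kE] := arch (- (2%:R * wpair w0 ga) / D).
have {kE} : ~ k.+1%:R <= - (2%:R * wpair w0 ga) / D.
  by move=> h; apply: kE; apply: le_trans h; rewrite ler_nat.
move: k.+1 (ltn0Sn k) => {}k k0 kE; exists k; apply: contrapT => Ek.
have hk : weight_vec (w0 + ga *+ k) (iter k E v).
  elim: (k) => [|q IHq]; first by rewrite mulr0n addr0.
  by rewrite iterS mulrSr addrA; exact: (homogeneous_weight Vmod IHq (Homx p hx)).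
have := weight_norm_le hk Ek.
rewrite wnormDMn /= -/D => h; apply: kE.
rewrite ler_pdivlMr// -subr_ge0 -(pmulr_rge0 _ (_ : 0 < k%:R)) ?ltr0n//.
by apply: le_trans h _; rewrite le_eqVlt; apply/orP; left; apply/eqP; ring.
Qed.
End Integrability.

(** * Vertex operators *)

Lemma fsbig_seqE (T : choiceType) (V : zmodType) (A : set T) (F : T -> V)
    (r : seq T) : uniq r -> (forall t, A t -> t \notin r -> F t = 0) ->
  \sum_(t \in A) F t = \sum_(t <- r | t \in A) F t.
Proof.
move=> ur hF; rewrite (fsbigE [seq t <- r | t \in A]) ?filter_uniq//.
- by rewrite big_filter_cond; apply: eq_bigl => t; rewrite andbb.
- by move=> t; rewrite /= mem_filter => /andP[/set_mem].
move=> t At; rewrite mem_filter mem_set//=; exact: hF.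
Qed.

Section ExpCoef.
Variables (K : fieldType) (V : lmodType K) (A : nat -> V -> V).
Hypothesis Alin : forall j, linear (A j).

Lemma pow_coef_linear s r : linear (pow_coef A s r).
Proof.
elim: s r => [|s IHs] r a u v /=; first by case: ifP; rewrite ?scaler0 ?addr0.
rewrite scaler_sumr -big_split; apply: eq_bigr => j _ /=.
by rewrite IHs Alin.
Qed.

Lemma exp_coef_linear r : linear (exp_coef A r).
Proof.
move=> a u v; rewrite /exp_coef scaler_sumr -big_split; apply: eq_bigr => s _ /=.
by rewrite pow_coef_linear scalerDr !scalerA mulrC.
Qed.

Lemma exp_coef_comm (T : V -> V) r u : linear T ->
  (forall j u, T (A j u) = A j (T u)) -> T (exp_coef A r u) = exp_coef A r (T u).
Proof.
move=> lT TA; have TP s q : T (pow_coef A s q u) = pow_coef A s q (T u).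
  elim: s q => [|s IHs] q /=; first by case: ifP; rewrite // lin0.
  by rewrite (lin_sum _ _ _ lT); apply: eq_bigr => j _; rewrite TA IHs.
rewrite /exp_coef (lin_sum _ _ _ lT); apply: eq_bigr => s _.
by rewrite (linZ _ _ lT) TP.
Qed.

(** If [A j] lowers a filtration by [j], so does the coefficient of [z^r] in the
    exponential by [r]. *)
Lemma exp_coef_filtration (P : int -> V -> Prop) r (d : int) u :
  (forall d, is_subspace (P d)) -> (forall d j u, P d u -> P (d - j%:Z) (A j u)) ->
  P d u -> P (d - r%:Z) (exp_coef A r u).
Proof.
move=> sP PA Pu; have PP s q : P (d - q%:Z) (pow_coef A s q u).
  elim: s q => [|s IHs] q /=.
    by case: eqP => [->|_]; [rewrite subr0|exact: subsp0 (sP _)].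
  apply: (subsp_sum (sP _)) => j; rewrite mem_index_iota ltnS => /andP[_ jq].
  have := PA _ j _ (IHs (q - j)%N); congr P.
  by rewrite -subzn//; ring.
by apply: (subsp_sum (sP _)) => s _; apply: (subspZ (sP _)); exact: PP.
Qed.

Lemma exp_coef0 r u : (forall j u, A j u = 0) ->
  exp_coef A r u = if r == 0%N then u else 0.
Proof.
move=> A0; rewrite /exp_coef big_nat_recl//= invr1 scale1r big1 ?addr0// => s _.
by rewrite big1 ?scaler0// => j _; rewrite A0.
Qed.
End ExpCoef.

Section CommutingNilpotents.
Variables (K : fieldType) (V : lmodType K).

Lemma nilp_atD (S T : V -> V) u : linear S -> linear T ->
  (forall u, S (T u) = T (S u)) -> nilp_at S u -> nilp_at T u ->
  nilp_at (fun u => S u + T u) u.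
Proof.
move=> lS lT ST [m Sm] [n Tn]; have lST : linear (fun u => S u + T u).
  by move=> a v w; rewrite lS lT scalerDr addrACA.
have STn k v : S (iter k T v) = iter k T (S v).
  by elim: k => //= k IHk; rewrite ST IHk.
have TSn k v : T (iter k S v) = iter k S (T v).
  by elim: k => //= k IHk; rewrite -ST IHk.
have [N] := ubnP (m + n); elim: N m n u Sm Tn => // N IHN.
case=> [|m] [|n] u Sm Tn mn; try by exists 0%N.
apply: nilp_at_step; apply: (subspD (nilp_at_subspace lST)).
  apply: (IHN m n.+1); last by rewrite ltnS in mn.
    by rewrite -iterSr.
  by rewrite -STn Tn lin0.
apply: (IHN m.+1 n); last by rewrite addnS ltnS in mn.
  by rewrite -TSn Sm lin0.
by rewrite -iterSr.
Qed.

Lemma nilp_at_sum (I : Type) (r : seq I) (T : I -> V -> V) u :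
  (forall i, linear (T i)) -> (forall i j u, T i (T j u) = T j (T i u)) ->
  (forall i, nilp_at (T i) u) -> nilp_at (fun u => \sum_(i <- r) T i u) u.
Proof.
move=> lT TT nT; elim: r => [|i r IHr].
  by exists 1%N; rewrite /= big_nil.
have lr : linear (fun u => \sum_(i <- r) T i u).
  by move=> a v w; rewrite scaler_sumr -big_split; apply: eq_bigr => j _; rewrite lT.
have [N NE] : nilp_at (fun u => T i u + \sum_(j <- r) T j u) u.
  apply: nilp_atD => // v; rewrite (lin_sum _ _ _ (lT i)).
  by apply: eq_bigr => j _; rewrite TT.
by exists N; rewrite -[RHS]NE; apply: eq_iter => v; rewrite big_cons.
Qed.
End CommutingNilpotents.

Section VertexNilpotency.
Variables (K : numClosedFieldType) (g : simpleLie K) (V : lmodType K).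
Variables (act : fbar g -> V -> V) (c : K) (n : int).
Hypothesis Vmod : lie_module (@fb_br K g) (fun=> True) act.

Local Notation Em := (exp_coef
  (fun j w => (n%:~R / (c * j%:R)) *: act (fb_x (- j%:Z) (fk1 g)) w)).
(** The half of [E(n, z)] made of the positive modes of [k_1]. *)
Definition Eplus := exp_coef
  (fun j w => - (n%:~R / (c * j%:R)) *: act (fb_x j%:Z (fk1 g)) w).
Local Notation Ep := Eplus.

Let actl X : linear (act X).
Proof. exact: act_linear. Qed.

Let scl (a : K) X : linear (fun w => a *: act X w).
Proof. by move=> b u v; rewrite actl scalerDr !scalerA mulrC. Qed.

Let Em_linear r : linear (Em r). Proof. exact: exp_coef_linear. Qed.
Let Ep_linear r : linear (Ep r). Proof. exact: exp_coef_linear. Qed.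

Section Commutation.
Variable T : V -> V.
Hypothesis Tlin : linear T.
Hypothesis Tk1 : forall p u,
  T (act (fb_x p (fk1 g)) u) = act (fb_x p (fk1 g)) (T u).

Lemma Em_comm r u : T (Em r u) = Em r (T u).
Proof. by apply: exp_coef_comm => // j v; rewrite (linZ _ _ Tlin) Tk1. Qed.
Lemma Ep_comm r u : T (Ep r u) = Ep r (T u).
Proof. by apply: exp_coef_comm => // j v; rewrite (linZ _ _ Tlin) Tk1. Qed.
End Commutation.

Variable x : g.
Hypothesis gxx : gbr x x = 0.
Hypothesis fxx : gform x x = 0.

Let act_comm X Y u : fb_br X Y = 0 -> act X (act Y u) = act Y (act X u).
Proof. by move=> XY; rewrite (act_commute Vmod) XY (act0 Vmod) addr0. Qed.

Let k1k1 p q u :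
  act (fb_x p (fk1 g)) (act (fb_x q (fk1 g)) u) =
  act (fb_x q (fk1 g)) (act (fb_x p (fk1 g)) u).
Proof.
apply: act_comm; rewrite fb_br_xx /fdot_br /fdot_form /= gbr0l gform0l fb_x0.
by rewrite mulr0 mul0r !addr0 mulr0 scale0r addr0.
Qed.

Let xk1 p q u :
  act (fb_x p (x, 0)) (act (fb_x q (fk1 g)) u) =
  act (fb_x q (fk1 g)) (act (fb_x p (x, 0)) u).
Proof.
apply: act_comm; rewrite fb_br_xx /fdot_br /fdot_form /= gbr0r gform0r fb_x0.
by rewrite !mul0r !addr0 mulr0 scale0r addr0.
Qed.

Let xx p q u : act (fb_x p (x, 0)) (act (fb_x q (x, 0)) u) =
  act (fb_x q (x, 0)) (act (fb_x p (x, 0)) u).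
Proof.
apply: act_comm; rewrite fb_br_xx /fdot_br /fdot_form /= gxx fxx fb_x0.
by rewrite !mul0r !addr0 mulr0 scale0r addr0.
Qed.

(** A bound [D] on the positive modes that do not vanish turns [E(n, z)] into a
    finite sum in each degree. *)
Variable D : nat.
Let bounded u := (forall s, (D < s)%N -> Ep s u = 0) /\
  forall p : int, (D%:Z < p)%R -> act (fb_x p (x, 0)) u = 0.

(* the pairs with [s - r = q] and [s <= D]; the absolute value is a default when
   [s < q], and such pairs are filtered out *)
Let pairs (q : int) := [seq (absz (s%:Z - q), s) | s <- iota 0 D.+1].
Let Et (q : int) u := \sum_(rs <- pairs q | rs.2%:Z - rs.1%:Z == q)
  Em rs.1 (Ep rs.2 u).

Let Et_linear q : linear (Et q).
Proof.
move=> a u v; rewrite /Et scaler_sumr -big_split; apply: eq_bigr => rs _ /=.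
by rewrite Ep_linear Em_linear.
Qed.

Let Et_comm (T : V -> V) q u : linear T ->
  (forall p u, T (act (fb_x p (fk1 g)) u) = act (fb_x p (fk1 g)) (T u)) ->
  T (Et q u) = Et q (T u).
Proof.
move=> lT Tk1; rewrite /Et (lin_sum _ _ _ lT); apply: eq_bigr => rs _.
by rewrite Em_comm// Ep_comm.
Qed.

Let Et0 q u : (D%:Z < q)%R -> Et q u = 0.
Proof.
move=> Dq; rewrite /Et big_seq_cond big1// => -[r s] /andP[/mapP[t]].
rewrite mem_iota add0n => /andP[_ tD] [-> ->] /= /eqP; lia.
Qed.

Let EcoefE q u : bounded u -> Ecoef c act n q u = Et q u.
Proof.
move=> [hE _]; rewrite /Ecoef (fsbig_seqE (r := pairs q)).
- by apply: eq_bigl => rs; apply/idP/eqP => [/set_mem//|h]; exact/mem_set.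
- by rewrite map_inj_uniq ?iota_uniq// => s t [].
move=> [r s] /= rsq; have [sD|sD] := leqP s D; last first.
  move=> _; rewrite -/(Ep s u) hE// lin0//; exact: Em_linear.
move=> /negP[]; apply/mapP; exists s; first by rewrite mem_iota add0n ltnS.
by congr pair; lia.
Qed.

Let bounded_step (T : V -> V) u : linear T ->
  (forall p u, T (act (fb_x p (fk1 g)) u) = act (fb_x p (fk1 g)) (T u)) ->
  (forall p u, T (act (fb_x p (x, 0)) u) = act (fb_x p (x, 0)) (T u)) ->
  bounded u -> bounded (T u).
Proof.
move=> lT Tk1 Tx [hE hx]; split=> [s sD|p pD].
  by rewrite -Ep_comm// hE// lin0.
by rewrite -Tx hx// lin0.
Qed.

(** On bounded vectors the modes of [x(z) E(n, z)] are finite sums of the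
    commuting operators [x(p) E(n)_(m - p)], each nilpotent because [x(p)] is. *)
Lemma x_op_nilp_at m u : bounded u ->
  (forall p, nilp_at (act (fb_x p (x, 0))) u) ->
  nilp_at (x_op c act x m n) u.
Proof.
move=> bu nx; pose T p u := act (fb_x p (x, 0)) (Et (m - p) u).
have lT p : linear (T p) by move=> a v w; rewrite /T Et_linear actl.
have xEt p q v : act (fb_x p (x, 0)) (Et q v) = Et q (act (fb_x p (x, 0)) v).
  by apply: Et_comm => //; exact: actl.
have Etk1 q p v : Et q (act (fb_x p (fk1 g)) v) = act (fb_x p (fk1 g)) (Et q v).
  by rewrite [RHS]Et_comm//; exact: actl.
have EtEt q q' v : Et q (Et q' v) = Et q' (Et q v).
  by rewrite Et_comm.
have TT p q v : T p (T q v) = T q (T p v).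
  by rewrite /T -!xEt xx EtEt.
(* the range [r] of [p] contains the interval from [m - D] to [D] *)
pose N := (absz m + D)%N; pose r := [seq i%:Z - N%:Z | i <- iota 0 (N + N).+1].
have inr p : p \notin r -> (D%:Z < p)%R \/ (D%:Z < m - p)%R.
  move=> pr; apply: contrapT => h; move/negP: pr; apply.
  apply/mapP; exists (absz (p + N%:Z)); last by rewrite /N in h *; lia.
  by rewrite mem_iota add0n /N in h *; lia.
have Tb p v : bounded v -> bounded (T p v).
  move=> bv; apply: (@bounded_step (act (fb_x p (x, 0))) (Et (m - p) v)) => //.
  by apply: bounded_step => // q w; rewrite xEt.
have opE v : bounded v -> x_op c act x m n v = \sum_(p <- r) T p v.
  move=> bv; rewrite /x_op /timesE (fsbig_seqE (r := r)).
  - by apply: eq_big => [p|p _]; [rewrite in_setT|rewrite EcoefE].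
  - by rewrite map_inj_uniq ?iota_uniq// => i j /addIr[].
  move=> p _ /inr[pD|pD]; rewrite EcoefE//.
    by rewrite xEt; case: bv => _ ->//; rewrite lin0.
  by rewrite Et0// lin0.
have iterT p k v : iter k (T p) v = iter k (Et (m - p)) (iter k (act (fb_x p (x, 0))) v).
  elim: k v => // k IHk v; rewrite !iterSr IHk; congr iter.
  rewrite /T; elim: k {IHk} => //= k IHk; rewrite IHk xEt.
  by [].
have nT p : nilp_at (T p) u.
  have [k kE] := nx p; exists k; rewrite iterT kE lin0//.
  by apply: lin_iter; exact: Et_linear.
have [k kE] := nilp_at_sum r lT TT nT; exists k; rewrite -[RHS]kE.
suff : iter k (x_op c act x m n) u = iter k (fun u => \sum_(p <- r) T p u) u
    /\ bounded (iter k (x_op c act x m n) u) by case.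
elim: (k) => [|q [IHq bq]]; first by [].
have sb : is_subspace bounded.
  split=> [|a v w [h1 h2] [h3 h4]].
    by split=> *; [exact: lin0 (Ep_linear _)|exact: lin0 (actl _)].
  split=> [s sD|p pD]; first by rewrite Ep_linear h1// h3// scaler0 addr0.
  by rewrite actl h2// h4// scaler0 addr0.
split; first by rewrite !iterS opE// IHq.
by rewrite iterS opE//; apply: (subsp_sum sb) => p _; exact: Tb.
Qed.
End VertexNilpotency.

Section DegreeFiltration.
Variables (K : numClosedFieldType) (g : simpleLie K).
Variables (V : lmodType K) (act : fbar g -> V -> V).
Hypothesis Vmod : lie_module (@fb_br K g) (fun=> True) act.
Hypothesis Virr : irreducible_module act.
Local Notation afw := (afw g).
Local Notation weight_vec := (eigen (cartan_op act) (@wchar K g)).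
Variables (v : V) (w0 : afw).
Hypothesis v0 : v <> 0.
Hypothesis v_weight : weight_vec w0 v.
Hypothesis v_singular :
  forall ga X, homogeneous ga X -> pos_cone ga -> ga <> 0 -> act X v = 0.

(** The degree filtration. It bounds the positive modes that do not kill a given
    vector, which makes the series of the vertex operators finite. *)
Definition degree_le (d : int) : V -> Prop := lspan (fun u =>
  exists w (e : int), [/\ weight_vec w u, w.2 = w0.2 + e%:~R & (e <= d)%R]).

Lemma degree_le_subspace d : is_subspace (degree_le d).
Proof. exact: lspan_subspace. Qed.

Lemma degree_le_mono d d' u : (d <= d')%R -> degree_le d u -> degree_le d' u.
Proof.
move=> dd hu; apply: (hu (degree_le d')); first exact: degree_le_subspace.
move=> u' [w [e [hw we ed]]]; apply: lspan1; exists w, e; split=> //.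
exact: le_trans ed dd.
Qed.

Lemma degree_lt0 d u : (d < 0)%R -> degree_le d u -> u = 0.
Proof.
move=> d0 hu; apply: (hu (fun u => u = 0)).
  by split=> [|a u1 u2 -> ->]; rewrite ?scaler0 ?addr0.
move=> u' [w [e [hw we ed]]]; apply: contrapT => u'0.
have [n] := pos_cone_snd (weights_in_cone Vmod Virr v0 v_weight v_singular hw u'0).
rewrite /= we opprD addrA subrr add0r => /oppr_inj; rewrite pmulrn => /(@intr_inj K) en.
by move: (le_lt_trans ed d0); rewrite en.
Qed.

Lemma degree_exists u : exists D : nat, degree_le D%:Z u.
Proof.
have sP : is_subspace (fun u => exists D : nat, degree_le D%:Z u).
  split=> [|a u1 u2 [d1 h1] [d2 h2]].
    by exists 0%N; exact: subsp0 (degree_le_subspace _).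
  exists (maxn d1 d2); apply: (degree_le_subspace _).2.
    by apply: degree_le_mono h1; rewrite lez_nat leq_maxl.
  by apply: degree_le_mono h2; rewrite lez_nat leq_maxr.
have [r [z [_ rA ez ->]]] := singular_weights Vmod Virr v0 v_weight v_singular u.
apply: (subsp_sum sP) => w wr; have [n nE] := pos_cone_snd (rA w wr).
exists n; apply: lspan1; exists w, n%:Z; split=> //.
by rewrite -pmulrn -[n%:R]opprK -nE /= opprB addrC subrK.
Qed.

Lemma degree_act d m be X u : homogeneous ((be, - m%:~R) : afw) X ->
  degree_le d u -> degree_le (d - m) (act X u).
Proof.
move=> hX hu; apply: (hu (fun u => degree_le (d - m) (act X u))).
  split=> [|a u1 u2 h1 h2].
    by rewrite (lin0 (act_linear Vmod X)); exact: subsp0 (degree_le_subspace _).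
  by rewrite (act_linear Vmod); exact: (degree_le_subspace _).2.
move=> u' [w [e [hw we ed]]]; apply: lspan1.
exists (w + (be, - m%:~R)), (e - m); split.
- exact: homogeneous_weight hX.
- by rewrite /= we rmorphB addrA.
by rewrite lerD2r.
Qed.

Lemma hw_x_op_nilp (c : K) (al : 'Hom(hdot g, K^o)) x (m n : int) u : al <> 0 -> root_space gbr al x ->
  (forall p u, nilp_at (act (fb_x p (x, 0))) u) ->
  nilp_at (x_op c act x m n) u.
Proof.
move=> al0 hx nx; have [D hD] := degree_exists u.
have gxx : gbr x x = 0 by exact: lie_alt (gbr_lie g) x.
have fxx : gform x x = 0.
  apply: contrapT => /(gform_root hx hx)/eqP; rewrite -addr_eq0 -mulr2n.
  rewrite -scaler_nat scaler_eq0 pnatr_eq0 /= => /eqP.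
  exact: al0.
apply: (x_op_nilp_at Vmod gxx fxx (D := D)) => //; split=> [s sD|p pD].
  apply: (@degree_lt0 (D%:Z - s%:Z)); first by lia.
  apply: exp_coef_filtration hD => [d|d j u' hu']; first exact: degree_le_subspace.
  apply: (subspZ (degree_le_subspace _)); apply: degree_act hu'.
  exact: (Homb _ _ 1 0).
apply: (@degree_lt0 (D%:Z - p)); first by lia.
exact: degree_act (Homx p hx) hD.
Qed.
End DegreeFiltration.

(** * Highest weight modules with dominant highest weight *)

Section DominantModule.
Variables (K : numClosedFieldType) (g : simpleLie K) (mu : K).
Variables (la : 'Hom(haff g, K^o)) (V : lmodType K) (act : fbar g -> V -> V).
Hypothesis V_hw : irreducible_highest_weight (lambda_bar mu la) act.
Local Notation afw := (afw g).
Local Notation hd := 'Hom(hdot g, K^o).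
Local Notation weight_vec := (eigen (cartan_op act) (@wchar K g)).

(** The three properties on which the tensor products depend: the action of the
    zero mode of [k_1], local nilpotency of the vertex operators of root
    vectors, and weight vectors spanning the module. *)
Lemma dominant_module : dominant la ->
  (forall z : K, exists k : nat, ~ k%:R <= z) ->
  [/\ forall u, act (fb_x 0 (fk1 g)) u = 0,
      forall (al : hd) x (m n : int) u, lroot (@gbr _ g) al ->
        root_space gbr al x -> nilp_at (x_op (level la) act x m n) u
    & forall u, lspan (fun u => exists w : afw, weight_vec w u) u].
Proof.
move=> [dom_simple dom_highest] arch; have [Vmod Virr [v [/eqP v0 hv sv]]] := V_hw.
have lin_mu : linear (fun t : hdot g => la (t, 0, 0) : K^o).
  move=> a s t; rewrite -linearP; congr (la _).
  by apply: injective_projections; [apply: injective_projections|];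
    rewrite /= ?scaler0 ?addr0.
have [mu0 mu0E] := linear_lfun lin_mu.
pose w0 : afw := (mu0, - la (0, 0, 1)).
have etaE t : lambda_bar mu la t = la t.1.1 + 24%:R * mu * level la * t.2 :> K.
  by rewrite lfunE.
have zeroE : fb_x 0 ((vsval (0 : hdot g), (0, 0)) : fdot g) = 0.
  by rewrite linear0; exact: fb_x0.
have v_weight : weight_vec w0 v.
  case=> [t|].
    have := hv ((t, 0, 0), (0, 0), 0); rewrite etaE /= mulr0 addr0 => h.
    rewrite mu0E -h; congr act.
    by rewrite /fb0_emb /= !scale0r !addr0.
  have := hv ((0, 0, 1), (0, 0), 0); rewrite etaE /= mulr0 addr0 => h.
  rewrite scaleNr -h /cartan_op /fb0_emb zeroE !scale0r !addr0 add0r scale1r.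
  by rewrite /fb_d0 (linN _ (act_linearl Vmod v)) opprK.
have v_level : act (fb_k0 g) v = level la *: v.
  have := hv ((0, 1, 0), (0, 0), 0); rewrite etaE /= mulr0 addr0 => <-; congr act.
  by rewrite /fb0_emb zeroE !scale0r !addr0 add0r scale1r.
have v_singular ga X : homogeneous ga X -> pos_cone ga -> ga <> 0 -> act X v = 0.
  move=> hX pga ga0; have [->|/sv//] := homogeneous_plus hX pga ga0.
  exact: act0.
have v_k1 : act (fb_x 0 (fk1 g)) v = 0.
  have := hv (0, (1, 0), 0); rewrite etaE mulr0 addr0 linear0 scale0r => <-.
  congr act; rewrite /fb0_emb !scale0r !addr0; congr (fb_x 0 (_, _)).
have v_dominant j al p : (j < (size (gbase g)).+1)%N ->
    asimple g j = (al, - p%:~R) ->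
    exists n : nat, coroot_value (level la) al p w0 = n%:R.
  have crt (al' : hd) : lroot (@gbr _ g) al' -> coroot (@gbr _ g) al' (coroot_of al').
    move=> ral; split; first exact: coroot_of_root.
    by have [x [y [hx hy _ xy]]] := sl2_triple ral; exists x, y.
  have int0 (q : int) : - q%:~R = 0 :> K -> q = 0.
    by move=> /eqP; rewrite oppr_eq0 intr_eq0 => /eqP.
  have [_ Br _] := gbaseP g; case: j => [_ /= [<- /oppr_inj pE]|j jB /= [<- /esym/int0 ->]].
    have [n nE] := dom_highest _ (crt _ (highest_root_isroot g)); exists n.
    have hN be : hform (- ghighest g) be = - hform (ghighest g) be.
      by rewrite -scaleN1r hformZl mulN1r.
    have hNN : hform (- ghighest g) (- ghighest g) = 2%:R.
      by rewrite hN hformC hN opprK highest_hform.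
    rewrite -nE -mu0E /coroot_value -pE /= !coroot_ofE hNN hN highest_hform.
    by field.
  have jm : (gbase g)`_j \in gbase g by exact: mem_nth.
  have [n nE] := dom_simple _ _ jm (crt _ (Br _ jm)); exists n.
  by rewrite -nE -mu0E /coroot_value mulr0z !mul0r addr0.
split=> [u|al x m n u ral hx|u].
- move: u; apply: (irreducible_ind Vmod Virr _ v0 v_k1).
    split=> [|a u u' h h']; first exact: lin0 (act_linear Vmod _).
    by rewrite (act_linear Vmod) h h' scaler0 addr0.
  move=> ga X u hX hu; rewrite (act_commute Vmod) hu (lin0 (act_linear Vmod X)) add0r.
  rewrite (_ : fb_br _ _ = 0) ?(act0 Vmod)//.
  case: hX => [q|q al x _|q a b||]; try exact: fb_br_central_r.
  + by rewrite fb_br_xL mulr0z scale0r.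
  + by rewrite fb_br_xx /fdot_br /= gbr0l fb_x0 mulr0z !mul0r scale0r addr0.
  by rewrite fb_br_xx /fdot_br /= gbr0l fb_x0 mulr0z !mul0r scale0r addr0.
- have /eqP al0 : al != 0 by case: ral.
  apply: (@hw_x_op_nilp _ _ _ _ Vmod Virr v w0 v0 v_weight v_singular
    _ al x m n u al0 hx) => p u'.
  by apply: (real_root_nilp Vmod Virr v0 v_weight v_singular v_level v_dominant _ _
    arch ral hx).
have [r [z [_ _ ez ->]]] := singular_weights Vmod Virr v0 v_weight v_singular u.
apply: (subsp_sum (lspan_subspace _)) => w _; apply: lspan1.
by exists w.
Qed.
End DominantModule.

(** * Root spaces of the toroidal algebra *)

Section ToroidalRoots.
Variables (K : numClosedFieldType) (g : simpleLie K) (mu : K).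
Local Notation hd := 'Hom(hdot g, K^o).

Lemma ht_emb_h (t : hdot g) : ht_emb ((t, (0, 0), (0, 0)) : htilde g) =
  gt_x 0 (vsval t).
Proof. by rewrite /ht_emb !scale0r !addr0. Qed.

Lemma gt_x00 m : gt_x m (0 : g) = 0.
Proof. by rewrite /gt_x mono0. Qed.

Lemma ht_emb_d0 : ht_emb ((0, (0, 0), (1, 0)) : htilde g) = gt_d0 g.
Proof. by rewrite /ht_emb linear0 gt_x00 !scale0r !addr0 add0r scale1r. Qed.

Lemma ht_emb_d1 : ht_emb ((0, (0, 0), (0, 1)) : htilde g) = gt_d1 g.
Proof. by rewrite /ht_emb linear0 gt_x00 !scale0r !addr0 add0r scale1r. Qed.

Lemma sx_x_fun (a b : K) (f : fsupp Z2 g) m :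
  sx_x ((a, b, 0) : skewder K) f m = (a * m.1%:~R + b * m.2%:~R) *: f m.
Proof.
have [r ur fr] := fsupp_seq f.
rewrite /sx_x (@lextE _ _ _ _ _ _ r)//; last by move=> n; exact: sx_x_phi0.
rewrite (big_morph (fun f : fsupp Z2 g => fsval f m) (id1 := 0) (op1 := +%R))//.
have tE n : fsval (mono n (sdeg ((a, b, 0) : skewder K) n *: f n) +
   lext (V := K^o) (W := fsupp Z2 g) (fun (m : Z2nz) (b : K) =>
      mono (val m + n) ((b * detZ2 K (val m) n) *: f n)) 0) m =
   if `[< m = n >] then (a * m.1%:~R + b * m.2%:~R) *: f m else 0.
  rewrite lext0 ?addr0 => [|p]; last by rewrite mul0r scale0r mono0.
  by rewrite /=; case: asboolP => // ->.
under eq_bigr do rewrite tE.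
have [mr|mr] := boolP (m \in r).
  rewrite (bigD1_seq m)//= asboolT// big1 ?addr0// => n /eqP nm.
  by rewrite asboolF// => mn; exact: nm.
rewrite (fr m mr) scaler0 big1// => n _; case: asboolP => // _.
Qed.

(** A root vector for a non-isotropic root is of the form [t^m x], with [x] a
    root vector of the finite algebra: the Cartan subalgebra of the latter acts
    by [0] on the other summands, and the degree derivations fix [m]. *)
Lemma nonisotropic_root_space (ga : 'Hom(htilde g, K^o)) (X : gtilde g) :
  nonisotropic_root ga -> gt_root_space mu ga X ->
  exists (al : hd) (m : Z2) (x : g),
    [/\ lroot (@gbr _ g) al, root_space gbr al x & X = gt_x m x].
Proof.
case=> al [m [ral gaE]] hX; case: X hX => [[f q] s] hX.
have [/eqP al0 _] := ral; have [t0 alt0] := root_neq0 al0.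
have qE : q = qproj (@kd_rel K) (qrepr q) by rewrite qreprK.
have q0 : 0 = qproj (@kd_rel K) 0 by rewrite linear0.
have h0 (t : hdot g) : gt_br mu (gt_x 0 (vsval t)) ((f, q, s) : gtilde g) =
    al t *: ((f, q, s) : gtilde g).
  by rewrite -ht_emb_h hX gaE /= !mulr0 !addr0.
have [qs0 ss0] : q = 0 /\ s = 0.
  have := h0 t0; rewrite /gt_x {1}qE [X in (_, X, _)]q0 gt_brE.
  rewrite !sk_k0l sk_k0r ss_s0l ss_k0l subr0 !addr0.
  rewrite [xx_k _ _](_ : _ = 0); last first.
    rewrite /xx_k lext_mono; last first.
      by move=> p; rewrite lextl0// => p' y; rewrite gform0l scale0r mono0.
    rewrite lextl0// => p y.
    by rewrite (_ : kvec K 0 = 0) ?scaler0 ?mono0.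
  move=> E; have /esym/eqP := congr1 (fun Z : gtilde g => Z.1.2) E.
  have /esym/eqP := congr1 (fun Z : gtilde g => Z.2) E.
  rewrite /= linear0 => /eqP s0 /eqP q0'.
  split.
    by move: q0' => /eqP; rewrite scaler_eq0 => /orP[/eqP//|/eqP].
  apply/eqP; have : al t0 *: s == 0 by rewrite s0.
  by rewrite scaler_eq0 => /orP[/eqP//|].
rewrite {}qs0 {}ss0 in hX h0 *.
have degE (a b : K) (n : Z2) : gt_br mu ((0, 0, (a, b, 0)) : gtilde g)
    ((f, 0, 0) : gtilde g) = (a * m.1%:~R + b * m.2%:~R) *: ((f, 0, 0) : gtilde g) ->
    (a * n.1%:~R + b * n.2%:~R) *: f n = (a * m.1%:~R + b * m.2%:~R) *: f n.
  rewrite [X in gt_br mu X](_ : _ = (0, qproj (@kd_rel K) 0, (a, b, 0))); last first.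
    by rewrite -q0.
  rewrite [X in gt_br mu _ X](_ : _ = (f, qproj (@kd_rel K) 0, 0)); last by rewrite -q0.
  rewrite gt_brE xx_x0l sx_x0l subr0 add0r => E.
  have := congr1 (fun Z : gtilde g => Z.1.1 n) E.
  by rewrite /= sx_x_fun.
have fm n : n != m -> f n = 0.
  move=> nm; apply/eqP; apply: contraT => fn0.
  have inj (i j : int) : i%:~R *: f n = j%:~R *: f n -> i = j.
    move=> /eqP; rewrite -subr_eq0 -scalerBl scaler_eq0 (negPf fn0) orbF subr_eq0.
    by move=> /eqP/(@intr_inj K).
  move/eqP: nm; case; apply: injective_projections; apply: inj.
    have := @degE 1 0 n; rewrite !mul1r !mul0r !addr0; apply.
    by have := hX (0, (0, 0), (1, 0)); rewrite ht_emb_d0 gaE /= linear0 mulr1 mulr0 add0r addr0.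
  have := @degE 0 1 n; rewrite !mul1r !mul0r !add0r; apply.
  by have := hX (0, (0, 0), (0, 1)); rewrite ht_emb_d1 gaE /= linear0 mulr1 mulr0 !add0r.
have fE : f = mono m (f m).
  apply: val_inj; apply/funext => n /=; case: asboolP => [->//|/eqP nm].
  exact: fm.
exists al, m, (f m); split=> //; last by rewrite /gt_x -fE.
move=> t; have := h0 t; rewrite {1}fE -/(gt_x m (f m)) gt_br_xx add0r => E.
have := congr1 (fun Z : gtilde g => Z.1.1 m) E.
rewrite gt_kmE /= scaler0 addr0.
by rewrite asboolT.
Qed.
End ToroidalRoots.

(** * Tensor products *)

Section TensorTheory.
Variables (K : fieldType) (k : nat) (V : 'I_k -> lmodType K).
Implicit Types v : forall i, V i.

Lemma tpure_upd_linear v i : linear (fun x : V i => tpure (upd v x)).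
Proof.
move=> a x y; rewrite /tpure -linearP; apply/qprojP; apply: lspan1.
by exists v, i, a, x, y.
Qed.

Lemma upd_in v i (x : V i) : upd v x i = x.
Proof. exact: dfwith_in. Qed.

Lemma upd_out v i (x : V i) j : i != j -> upd v x j = v j.
Proof. exact: dfwith_out. Qed.

Lemma upd_id v i : upd v (v i) = v.
Proof.
apply: functional_extensionality_dep => j.
have [<-|ij] := eqVneq i j; first by rewrite upd_in.
by rewrite upd_out.
Qed.

Lemma tpure_eq0 v i : v i = 0 -> tpure v = 0.
Proof.
by move=> vi; have := lin0 (@tpure_upd_linear v i); rewrite /= -{1}vi upd_id.
Qed.

Lemma tpure_updZ v i (a : K) : tpure (upd v (a *: v i)) = a *: tpure v.
Proof. by rewrite (linZ _ _ (@tpure_upd_linear v i)) upd_id. Qed.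

Lemma tensor_ind (P : tensor V -> Prop) : is_subspace P ->
  (forall v, P (tpure v)) -> forall u, P u.
Proof.
move=> sP Pt u; rewrite -[u]qreprK; move: (qrepr u) => f.
(* finitely supported sums need a choice structure on the index type *)
have [r ->] := fsupp_sum (f : fsupp {classic (forall i, V i)} K^o).
rewrite (lin_sum _ _ _ (qproj_linear (tensor_rel (V := V)))).
apply: (subsp_sum sP) => v _.
have -> : mono v (f v) = (f v : K) *: mono v 1.
  by rewrite -monoZ /GRing.scale /= mulr1.
rewrite qprojZ; apply: (subspZ sP); exact: Pt.
Qed.

(** A sum of operators, each acting on one factor, is nilpotent on a pure tensor
    when each of them is nilpotent on the corresponding component: each
    application lowers one of the exponents. *)
Lemma tensor_nilp (L : tensor V -> tensor V) (X : forall i, V i -> V i)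
    (b : 'I_k -> K) : linear L ->
  (forall v, L (tpure v) = \sum_i b i *: tpure (upd v (X i (v i)))) ->
  (forall i u, nilp_at (X i) u) -> forall u, nilp_at L u.
Proof.
move=> lL LE nX; have sN := nilp_at_subspace lL; apply: (tensor_ind sN) => v.
have [n nE] := choice (fun i => nX i (v i)).
have [N] := ubnP (\sum_i n i)%N; elim: N v n nE => // N IHN v n nE nN.
have [[i ni]|n0] := pselect (exists i, n i = 0%N).
  by rewrite (tpure_eq0 (i := i)); [exact: subsp0 sN|have := nE i; rewrite ni].
apply: nilp_at_step; rewrite LE; apply: (subsp_sum sN) => i _; apply: (subspZ sN).
have ni0 : (0 < n i)%N by rewrite lt0n; apply/eqP => ni; apply: n0; exists i.
apply: (IHN _ (fun j => if j == i then (n i).-1 else n j)) => [j|].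
  have [->|ji] := eqVneq j i; first by rewrite upd_in -iterSr prednK.
  by rewrite upd_out// eq_sym.
move: nN; rewrite (bigD1 i)//= [X in _ -> (X < _)%N](bigD1 i)//= eqxx.
rewrite [X in _ -> (_ + X < _)%N](eq_bigr n); last by move=> j /negPf ->.
by rewrite ltnS; apply: leq_trans; rewrite -addSn prednK.
Qed.
End TensorTheory.

Section ZeroModes.
Variables (K : fieldType) (g : simpleLie K) (V : lmodType K).
Variables (act : fbar g -> V -> V) (c : K).

(** As [E(0, z) = 1], the operators with [n = 0] are the plain modes. *)
Lemma Ecoef_n0 q u : Ecoef c act 0 q u = if q == 0 then u else 0.
Proof.
have cE r : exp_coef (fun j w => (0%:~R / (c * j%:R)) *:
    act (fb_x (- j%:Z) (fk1 g)) w) r =1 fun u => if r == 0%N then u else 0.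
  by move=> w; apply: exp_coef0 => j u'; rewrite mul0r scale0r.
have dE s : exp_coef (fun j w => - (0%:~R / (c * j%:R)) *:
    act (fb_x j%:Z (fk1 g)) w) s =1 fun u => if s == 0%N then u else 0.
  by move=> w; apply: exp_coef0 => j u'; rewrite mul0r oppr0 scale0r.
rewrite /Ecoef (fsbig_seqE (r := [:: (0, 0)%N]))//; last first.
  move=> [r s] _; rewrite inE cE dE xpair_eqE negb_and /=.
  by case: eqP => // _; case: eqP.
rewrite big_mkcond big_seq1 cE dE !eqxx.
by case: ifP => [/set_mem <-|/negP h] //; case: eqP => // q0; case: h; apply/mem_set.
Qed.

Lemma timesE_n0 A m u : (forall p, A p 0 = 0) -> timesE c act A m 0 u = A m u.
Proof.
move=> A0; rewrite /timesE (fsbig_seqE (r := [:: m]))//.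
  by rewrite big_mkcond big_seq1 in_setT Ecoef_n0 subrr eqxx.
move=> p _; rewrite inE => pm; rewrite Ecoef_n0 subr_eq0 eq_sym (negPf pm).
exact: A0.
Qed.
End ZeroModes.

(** * The modules for the toroidal algebra *)

Section ToroidalModule.
Variables (K : numClosedFieldType) (g : simpleLie K) (mu : K) (k : nat).
Variables (la : 'I_k -> 'Hom(haff g, K^o)) (a : 'I_k -> K).
Variables (V : 'I_k -> lmodType K) (actV : forall i, fbar g -> V i -> V i).
Variable act : gtilde g -> Vtilde V -> Vtilde V.
Local Notation hd := 'Hom(hdot g, K^o).
Local Notation weight_vec i := (eigen (cartan_op (@actV i)) (@wchar K g)).

Hypothesis arch : forall z : K, exists n : nat, ~ n%:R <= z.
Hypothesis la_dom : forall i, dominant (la i).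
Hypothesis V_hw :
  forall i, irreducible_highest_weight (lambda_bar mu (la i)) (@actV i).
Hypothesis act_V : Vtilde_action mu la a actV act.

Let actl X : linear (act X).
Proof. exact: (act_linr (Vtilde_module act_V) I). Qed.

Lemma Vtilde_ind (P : Vtilde V -> Prop) : is_subspace P ->
  (forall l v, P (mono l (tpure v))) -> forall u, P u.
Proof.
move=> sP hP u; have [r ->] := fsupp_sum u; apply: (subsp_sum sP) => l _.
move: (u l); apply: tensor_ind => [|v]; last exact: hP.
split=> [|b x y hx hy]; first by rewrite mono0; exact: subsp0 sP.
by rewrite mono_linear; exact: sP.2.
Qed.

Lemma Vtilde_root_nilp (al : hd) (m : Z2) x u : lroot (@gbr _ g) al ->
  root_space gbr al x -> nilp_at (act (gt_x m x)) u.
Proof.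
move=> ral hx; case: m => m n; have [act' hact' actE] := Vtilde_hat act_V.
have hX : ghat (gt_x (m, n) x : gtilde g) by [].
have hd1 : gt_br mu (gt_d1 g) (gt_x (m, n) x) = n%:~R *: gt_x (m, n) x.
  exact: gt_br_d1x.
have lX : linear (act' (gt_x (m, n) x)) by exact: (act_linr (Vhat_module hact') hX).
have nX : forall w, nilp_at (act' (gt_x (m, n) x)) w.
  apply: (tensor_nilp lX (Vhat_x hact' x m n)) => i w.
  by have [_ h _] := dominant_module (V_hw i) (la_dom i) arch; exact: h ral hx.
move: u; apply: Vtilde_ind => [|l v]; first exact: nilp_at_subspace (actl _).
have [N NE] := nX (tpure v); exists N.
have itE q : iter q (act (gt_x (m, n) x)) (mono l (tpure v)) =
    mono (l + n *+ q) (iter q (act' (gt_x (m, n) x)) (tpure v)).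
  elim: q => [|q IHq]; first by rewrite mulr0n addr0.
  by rewrite !iterS IHq (actE n)// mulrSr addrA.
by rewrite itE NE mono0.
Qed.

Lemma tensor_sum_scalar (X : forall i, V i -> V i) (b : 'I_k -> K) v :
  (forall i, X i (v i) = b i *: v i) -> tensor_sum a X 0 v = (\sum_i b i) *: tpure v.
Proof.
move=> Xb; rewrite /tensor_sum scaler_suml; apply: eq_bigr => i _.
by rewrite expr0z scale1r Xb tpure_updZ.
Qed.

(** In degree zero the finite Cartan subalgebra, [k_0] and [d_0] act as
    derivations of the tensor product, [k_1] acts by [0] because its zero mode
    does, and [d_1] by the exponent of [t_1]. *)
Lemma tpure_weight l (v : forall i, V i) (w : 'I_k -> afw g) :
  (forall i, weight_vec i (w i) (v i)) ->
  exists ga : 'Hom(htilde g, K^o), weight_space act ga (mono l (tpure v)).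
Proof.
move=> hw; have [act' hact' actE] := Vtilde_hat act_V.
pose ga (t : htilde g) : K^o := \sum_i (w i).1 t.1.1 + t.1.2.1 * \sum_i level (la i)
  - t.2.1 * (\sum_i (w i).2 : K) + t.2.2 * l%:~R.
have ga_lin : linear ga.
  move=> b s t; rewrite /ga /=.
  have -> : \sum_i (w i).1 (b *: s.1.1 + t.1.1) =
      b * (\sum_i (w i).1 s.1.1) + \sum_i (w i).1 t.1.1 :> K.
    rewrite mulr_sumr -big_split; apply: eq_bigr => i _.
    exact: (linearP (w i).1 b s.1.1 t.1.1).
  by rewrite /GRing.scale /=; ring.
have [G GE] := linear_lfun ga_lin; exists G => t.
have actXl u : linear (act^~ u : gtilde g -> Vtilde V).
  by move=> b X Y; exact: (act_linl (Vtilde_module act_V) b u I I).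
have act0 X (b : 'I_k -> K) Y : ghat X -> gt_br mu (gt_d1 g) X = 0%:~R *: X ->
    act' X (tpure v) = tensor_sum a Y 0 v -> (forall i, Y i (v i) = b i *: v i) ->
    act X (mono l (tpure v)) = (\sum_i b i) *: mono l (tpure v).
  move=> hX hd hY Yb; rewrite (actE 0 X hX hd) addr0 hY.
  by rewrite (tensor_sum_scalar Yb) monoZ.
have Vmod i : lie_module (@fb_br K g) (fun=> True) (@actV i) by case: (V_hw i).
have k1_0 i u : actV (fb_x 0 (fk1 g)) u = 0 :> V i.
  by have [h _ _] := dominant_module (V_hw i) (la_dom i) arch.
have x0E : act (gt_x 0 (vsval t.1.1)) (mono l (tpure v)) =
    (\sum_i (w i).1 t.1.1) *: mono l (tpure v).
  apply: (act0 _ _ (fun i => x_op (level (la i)) (@actV i) (vsval t.1.1) 0 0)) => //.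
  - exact: gt_br_d1x.
  - exact: (Vhat_x hact').
  move=> i; rewrite /x_op timesE_n0 => [|p]; last exact: lin0 (act_linear (Vmod i) _).
  exact: (hw i (Some t.1.1)).
have k0E : act (gt_k0 g 0) (mono l (tpure v)) =
    (\sum_i level (la i)) *: mono l (tpure v).
  apply: (act0 _ _ (fun i => k0_op (level (la i)) (@actV i) 0 0)) => //.
  - exact: gt_br_d1k0.
  - exact: (Vhat_k0 hact').
  by move=> i; rewrite /k0_op Ecoef_n0 eqxx.
have k1E : act (gt_k1 g 0) (mono l (tpure v)) = 0.
  rewrite (act0 _ (fun=> 0) (fun i => k1_op (level (la i)) (@actV i) 0 0)) //.
  - by rewrite big1// scale0r.
  - exact: gt_br_d1k1.
  - exact: (Vhat_k1 hact').
  move=> i; rewrite /k1_op timesE_n0 => [|p]; last exact: lin0 (act_linear (Vmod i) _).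
  by rewrite k1_0 scale0r.
have d0E : act (gt_d0 g) (mono l (tpure v)) =
    (\sum_i - (w i).2) *: mono l (tpure v).
  apply: (act0 _ _ (fun i => actV (fb_d0 g))) => //.
  - by rewrite gt_br_ss scale0r.
  - exact: (Vhat_d0 hact').
  move=> i; rewrite /fb_d0 (linN _ (act_linearl (Vmod i) _)) scaleNr.
  by congr (- _); exact: (hw i None).
rewrite /ht_emb !(linD (actXl _)) !(linZ _ _ (actXl _)) x0E k0E k1E d0E.
rewrite (Vtilde_d1 act_V) monoZ scaler0 addr0 !scalerA -!scalerDl GE.
by congr (_ *: _); rewrite /ga sumrN mulrN.
Qed.

Lemma Vtilde_weight_sum u : exists (s : seq 'Hom(htilde g, K^o))
    (w : 'Hom(htilde g, K^o) -> Vtilde V),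
  (forall ga, weight_space act ga (w ga)) /\ u = \sum_(ga <- s) w ga.
Proof.
pose T (t : htilde g) := act (ht_emb t).
pose chi (ga : 'Hom(htilde g, K^o)) (t : htilde g) : K := ga t.
have lT t : linear (T t) by exact: actl.
suff : eigensum T chi (fun=> True) u by case=> s [w [_ _ ew ->]]; exists s, w.
have sE := eigensum_subspace chi lT (fun=> True).
move: u; apply: Vtilde_ind => // l v.
have lp : linear (fun x => mono l x : Vtilde V) by exact: mono_linear.
(* [H j] allows arbitrary components below [j]; all of them are free for
   [j = k], and none for [j = 0] *)
suff H j : (j <= k)%N -> forall v : forall i, V i,
    (forall i : 'I_k, (j <= i)%N -> exists w, weight_vec i w (v i)) ->
    eigensum T chi (fun=> True) (mono l (tpure v)).
  by apply: (H k) => // i; rewrite leqNgt ltn_ord.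
elim: j => [_ v' hv'|j IHj jk v' hv'].
  have [w hw] := choice (fun i => hv' i isT).
  have [ga hga] := tpure_weight l hw.
  exact: (eigensum1 lT (i := ga)).
pose i0 := Ordinal jk; rewrite -[v'](upd_id v' i0).
pose P (x : V i0) := eigensum T chi (fun=> True) (mono l (tpure (upd v' x))).
have sP : is_subspace P.
  split=> [|b x y hx hy].
    rewrite /P (tpure_eq0 (i := i0)) ?upd_in// mono0; exact: subsp0 sE.
  by rewrite /P tpure_upd_linear mono_linear; exact: sE.2.
have [_ _ hs] := dominant_module (V_hw i0) (la_dom i0) arch.
apply: (hs (v' i0) P sP) => x [w hx]; apply: IHj => [|i ji]; first exact: ltnW.
have [ii|ii] := eqVneq i0 i; first by rewrite -ii upd_in; exists w.
rewrite upd_out//; apply: hv'; rewrite ltn_neqAle ji andbT.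
by apply: contra ii => /eqP ji'; apply/eqP/val_inj.
Qed.

Lemma Vtilde_integrable : integrable_module mu act.
Proof.
split; last first.
  move=> ga X hga hX; have [al [m [x [ral hx ->]]]] := nonisotropic_root_space hga hX.
  by move=> u; exact: Vtilde_root_nilp ral hx.
split; first exact: Vtilde_weight_sum.
move=> s w us hw sw ga gas.
have chi_inj (ga1 ga2 : 'Hom(htilde g, K^o)) :
  (forall t : htilde g, ga1 t = ga2 t :> K) -> ga1 = ga2 by move=> h; apply/lfunP.
exact: (eigen_free (fun t => actl (ht_emb t)) chi_inj us (fun ga _ => hw ga) sw gas).
Qed.
End ToroidalModule.

(** Comparison in the complex numbers includes comparison of the real parts. *)
Lemma complex_archimedean (R : realType) (z : R[i]) : exists n : nat, ~ n%:R <= z.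
Proof.
exists (Num.bound `|complex.Re z|); rewrite lecE => /andP[_].
rewrite raddfMn /=; apply/negP; rewrite -ltNge.
exact: le_lt_trans (ler_norm _) (Num.Theory.archi_boundP (normr_ge0 _)).
Qed.
Unset Implicit Arguments.

Theorem proposition4p7 (R : realType) (g : simpleLie R[i]) (mu : R[i])
    (k : nat) (la : 'I_k -> 'Hom(haff g, R[i]^o)) (a : 'I_k -> R[i])
    (V : 'I_k -> lmodType R[i]) (actV : forall i, fbar g -> V i -> V i)
    (act : gtilde g -> Vtilde V -> Vtilde V)
    (k_ge1 : (1 <= k)%N)
    (level_neq0 : forall i, level (la i) <> 0)
    (a_neq0 : forall i, a i <> 0)
    (a_inj : injective a)
    (la_dom : forall i, dominant (la i))
    (V_hw : forall i,
      irreducible_highest_weight (lambda_bar mu (la i)) (actV i))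
    (act_V : Vtilde_action mu la a actV act) :
  integrable_module mu act.
Proof. exact: (Vtilde_integrable (@complex_archimedean R) la_dom V_hw act_V). Qed.
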